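(* Let $\mathbb T$ be the triangular lattice, embedded in $\mathbb R^2$ so that its sites are the centers of the hexagonal faces of the hexagonal lattice $\mathbb H$, and for $\delta>0$ let $\delta\mathbb T$, $\delta\mathbb H$ be the rescaled lattices. Let $\sigma^0\in\{-1,+1\}^{\mathbb T}$ have i.i.d. coordinates with $\mu^0(\sigma^0_x=+1)=1/2$, and let $\sigma^n=\mathrm T^n\sigma^0$, $n\ge 1$, and $\sigma^\infty=\lim_n\sigma^n$ (which exists almost surely, each spin flipping only finitely often), where $\mathrm T$ is the cellular automaton described in the context. For $n\in\{0,1,2,\dots\}\cup\{\infty\}$ and $\delta>0$, let $\mathcal F^n_\delta$ be the (closed) set of curves in $\dot{\mathbb R}^2$ formed by the b-paths of the configuration $\sigma^n$ placed on $\delta\mathbb T$. Then for $\mu^0$-almost every $\sigma^0$, $$\lim_{\delta\to 0}\operatorname{dist}(\mathcal F^0_\delta,\mathcal F^n_\delta)=0\quad\text{for every } n\in\{1,2,\dots\}\cup\{\infty\}.$$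
   Context: Each site $x$ of $\mathbb T$ has a set $\mathcal N(x)$ of six nearest neighbors. The cellular automaton $\mathrm T:\{-1,+1\}^{\mathbb T}\to\{-1,+1\}^{\mathbb T}$ acts synchronously: $(\mathrm T\sigma)_x=\sigma_x$ if $x$ has at least two neighbors $y_1,y_2$ with $\sigma_{y_1}=\sigma_{y_2}=\sigma_x$ and $y_1,y_2$ not neighbors of each other; otherwise $(\mathrm T\sigma)_x=-\sigma_x$. For neighboring sites $x,y$, $\eta^*_{x,y}$ denotes the edge of $\mathbb H$ (dual edge) that is the perpendicular bisector of the edge $xy$. A b-path (boundary path) of a configuration $\sigma$ is a sequence $(\eta^*_{\zeta_0,\xi_0},\dots,\eta^*_{\zeta_k,\xi_k})$ of distinct dual edges such that for each $i$ either $\zeta_{i+1}=\zeta_i$ and $\xi_{i+1}\in\mathcal N(\xi_i)$, or $\xi_{i+1}=\xi_i$ and $\zeta_{i+1}\in\mathcal N(\zeta_i)$, and $\sigma_{\zeta_i}=-\sigma_{\xi_i}$ for all $i$; it is viewed as a polygonal curve in the plane. Metric on $\mathbb R^2$: $\mathrm d(u,v)=\inf_\phi\int(1+|\phi|^2)^{-1}ds$, infimum over smooth curves $\phi$ from $u$ to $v$ parametrized by arc length; $\dot{\mathbb R}^2$ is the one-point compactification (isometric to the sphere). Curves are continuous maps $[0,1]\to\dot{\mathbb R}^2$ modulo monotone reparametrization, with distance $\mathrm D(\mathcal C_1,\mathcal C_2)=\inf_{f_1,f_2}\sup_{t\in[0,1]}\mathrm d(\gamma_1(f_1(t)),\gamma_2(f_2(t)))$,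 infimum over monotone continuous surjections $f_1,f_2$ of $[0,1]$. For closed sets of curves $\mathcal F,\mathcal F'$, $\operatorname{dist}(\mathcal F,\mathcal F')\le\varepsilon$ iff every $\mathcal C\in\mathcal F$ has some $\mathcal C'\in\mathcal F'$ with $\mathrm D(\mathcal C,\mathcal C')\le\varepsilon$ and vice versa (induced Hausdorff metric). *)

(* Defs.v *)
From HB Require Import structures.
From mathcomp Require Import all_boot all_order all_algebra.
From mathcomp Require Import all_classical all_reals all_analysis.
Set Implicit Arguments. Unset Strict Implicit. Unset Printing Implicit Defensive.
Import Order.TTheory GRing.Theory Num.Theory.
Import numFieldNormedType.Exports.
Local Open Scope classical_set_scope.
Local Open Scope ring_scope.

(* ---------- The triangular lattice T = Z^2 (axial coordinates) ---------- *)
Definition site := (int * int)%type.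

Definition offsets : seq (int * int) :=
  [:: (1, 0); (-1, 0); (0, 1); (0, -1); (1, -1); (-1, 1)]%R.

Definition adj (x y : site) : bool := (y.1 - x.1, y.2 - x.2)%R \in offsets.

(* Spin configurations: true = +1, false = -1. *)
Definition config := site -> bool.

Definition step (sigma : config) : config := fun x =>
  if `[< exists y1 y2 : site, [/\ adj x y1, adj x y2, y1 != y2,
           ~~ adj y1 y2 & sigma y1 = sigma x /\ sigma y2 = sigma x] >]
  then sigma x else ~~ sigma x.

Definition sigma_n (sigma0 : config) (n : nat) : config := iter n step sigma0.

(* sigma^infty: the eventual value of each spin (= lim_n sigma^n_x whenever
   the spin flips only finitely often). *)
Definition sigma_inf (sigma0 : config) : config := fun x =>
  `[< exists N : nat, forall n : nat, (N <= n)%N -> sigma_n sigma0 n x = true >].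

Section Geometry.
Variable R : realType.

Definition pt := (R * R)%type.

(* position of site x in delta*T: sites at distance delta from neighbours *)
Definition pos (delta : R) (x : site) : pt :=
  (delta * (x.1%:~R + x.2%:~R / 2), delta * (x.2%:~R * Num.sqrt 3 / 2)).

Definition centroid (a b c : pt) : pt :=
  ((a.1 + b.1 + c.1) / 3, (a.2 + b.2 + c.2) / 3).

(* the vertices of the hexagonal lattice delta*H are the centres of the
   triangular faces of delta*T; the dual edge eta*_{x,y} (perpendicular
   bisector of xy) joins the centres of the two triangles containing xy.
   [dual_edge_ends delta x y u v] : u and v are the two (distinct) endpoints of
   eta*_{x,y}, listed as (u, v). *)
Definition dual_edge_ends (delta : R) (x y : site) (u v : pt) : Prop :=
  exists z z' : site, [/\ adj x z && adj y z, adj x z' && adj y z', z != z',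
    u = centroid (pos delta x) (pos delta y) (pos delta z) &
    v = centroid (pos delta x) (pos delta y) (pos delta z')].

Definition same_dual_edge (e f : site * site) : Prop :=
  (e.1 = f.1 /\ e.2 = f.2) \/ (e.1 = f.2 /\ e.2 = f.1).

Definition bpath (sigma : config) (k : nat) (p : nat -> site * site) : Prop :=
  [/\ (forall i, (i <= k)%N -> adj (p i).1 (p i).2),
      (forall i, (i <= k)%N -> sigma (p i).1 = ~~ sigma (p i).2),
      (forall i, (i < k)%N ->
         ((p i.+1).1 = (p i).1 /\ adj (p i).2 (p i.+1).2) \/
         ((p i.+1).2 = (p i).2 /\ adj (p i).1 (p i.+1).1)) &
      (forall i j, (i <= k)%N -> (j <= k)%N -> i != j ->
         ~ same_dual_edge (p i) (p j))].

(* None is the point at infinity of the one-point compactification. *)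
Definition spt := option pt.

Definition sqn (u : pt) : R := u.1 ^+ 2 + u.2 ^+ 2.

Definition smooth_fun (f : R -> R) : Prop :=
  forall (n : nat) (s : R), derivable (derive1n n f) s 1.

Definition weighted_length (phi1 phi2 : R -> R) (L : R) : R :=
  Rintegral lebesgue_measure `[0, L]
    (fun s => (1 + phi1 s ^+ 2 + phi2 s ^+ 2)^-1).

Definition dR2 (u v : pt) : R :=
  inf [set l | exists (phi1 phi2 : R -> R) (L : R),
    [/\ 0 <= L, smooth_fun phi1 /\ smooth_fun phi2,
        (forall s, 0 <= s <= L ->
           (derive1 phi1 s) ^+ 2 + (derive1 phi2 s) ^+ 2 = 1),
        (phi1 0, phi2 0) = u /\ (phi1 L, phi2 L) = v &
        l = weighted_length phi1 phi2 L]].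

(* distance to the point at infinity: limit of d(u,v) as |v| -> oo
   (written as the lim sup, which equals this limit) *)
Definition dR2_inf (u : pt) : R :=
  inf [set M | exists r : R, forall v : pt, r <= sqn v -> dR2 u v <= M].

Definition dS (a b : spt) : R :=
  match a, b with
  | Some u, Some v => dR2 u v
  | Some u, None => dR2_inf u
  | None, Some v => dR2_inf v
  | None, None => 0
  end.

(* a curve is represented by a parametrization gamma : R -> spt, of which only
   the restriction to [0,1] matters. *)
Definition curve := R -> spt.

Definition reparam (f : R -> R) : Prop :=
  [/\ {within `[0, 1], continuous f},
      {in `[0, 1] &, {homo f : s t / s <= t}} &
      f @` `[0, 1] = `[0, 1]%classic].

Definition Dcurve (g1 g2 : curve) : R :=
  inf [set r | exists f1 f2 : R -> R, [/\ reparam f1, reparam f2 &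
     r = sup [set dS (g1 (f1 t)) (g2 (f2 t)) | t in `[0, 1]]]].

Definition bpath_curves (delta : R) (sigma : config) : set curve :=
  [set gamma | exists (k : nat) (p : nat -> site * site) (v : nat -> pt),
     [/\ bpath sigma k p,
         (forall i, (i <= k)%N -> dual_edge_ends delta (p i).1 (p i).2 (v i) (v i.+1)) &
         (forall i, (i <= k)%N -> forall t : R,
            i%:R / k.+1%:R <= t <= i.+1%:R / k.+1%:R ->
            gamma t = Some ((v i).1 + (k.+1%:R * t - i%:R) * ((v i.+1).1 - (v i).1),
                            (v i).2 + (k.+1%:R * t - i%:R) * ((v i.+1).2 - (v i).2)))]].

Definition hclose (eps : R) (F G : set curve) : Prop :=
  (forall C, F C -> exists C', G C' /\ Dcurve C C' <= eps) /\
  (forall C', G C' -> exists C, F C /\ Dcurve C' C <= eps).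

Definition dist_to_zero (F G : R -> set curve) : Prop :=
  forall eps : R, 0 < eps -> exists delta0 : R, 0 < delta0 /\
    forall delta : R, 0 < delta < delta0 -> hclose eps (F delta) (G delta).

End Geometry.

Definition iid_fair (R : realType) (d : measure_display) (Omega : measurableType d)
  (P : probability Omega R) (s : site -> Omega -> bool) : Prop :=
  (forall x, measurable [set w | s x w]) /\
  (forall (l : seq site) (b : site -> bool), uniq l ->
     P [set w | forall x, x \in l -> s x w = b x] = ((2^-1) ^+ size l)%:E).

(* Main.v *)
Require Import Defs.
From HB Require Import structures.
From mathcomp Require Import all_boot all_order all_algebra.
From mathcomp Require Import all_classical all_reals all_analysis.
From mathcomp Require Import zify ring lra.
Set Implicit Arguments. Unset Strict Implicit. Unset Printing Implicit Defensive.
Import Order.TTheory GRing.Theory Num.Theory.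
Import numFieldNormedType.Exports.
Local Open Scope classical_set_scope.
Local Open Scope ring_scope.

(** Orient every interface edge with + on its left: it becomes a pair [(a, b)] of
    adjacent sites with spins + and -, the interface is the orbit structure of a
    bijection [nx], and b-paths are pieces of orbits, possibly reversed.

    A spin flips exactly when its opposite neighbours contain four consecutive
    ones, so a flip shortcuts the interface around one site.  There is an
    injection [psi] from the edges after one step to the edges before, for which
    the new [nx] is the first-return map of the old [nx] to the image of [psi];
    iterating gives injections [phi n] into the initial interface.  An edge is
    pinned if its two spins never flip; pinned edges are fixed by every [phi n],
    and what lies between two consecutive pinned edges never touches a site that
    it did not touch at time 0.

    Two monochromatic hexagons of opposite signs pin the edges between them.
    Exploring an interface from its start, each time it reaches a new extreme
    level in a coordinate direction the sites ahead are fresh, and with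
    probability at least 2^-13 they pin it within four steps.  Hence unpinned
    stretches have exponential tails, and by Borel-Cantelli those met at distance
    [N] from the origin have diameter at most [N / m + C], for every [m].  Matching
    curves along [phi n] then gives an error of order [1 / m + delta C], uniformly
    in [n]: the weight [1 / (1 + |u|^2)] absorbs the growth in [|u|].

    For [n = infinity] it remains to see that every spin stabilises.  The images
    of the maps [phi n] decrease, hence are eventually constant on finite sets; from
    then on a flipping site forces the flip of both its neighbours on some
    straight line, and such a line would be longer than any unpinned stretch. *)

(** * Interface edges *)

Notation edge := (site * site)%type.

(* Rotation of [y] about [x] by 60 degrees. *)
Definition turn (x y : site) : site := (x.1 + x.2 - y.2, y.1 + y.2 - x.1).

Arguments turn : simpl never.

Definition nb (k : nat) (x y : site) : site := iter k (turn x) y.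

Arguments nb : simpl never.

(* If [y] is a neighbour of [x], then so are the [nb k x y], [k < 6], and the pairs
   listed are the non-adjacent ones. *)
Definition stays (s : config) (x y : site) : bool :=
  let e k := s (nb k x y) == s x in
  [|| e 0 && e 2, e 1 && e 3, e 2 && e 4, e 3 && e 5, e 4 && e 0, e 5 && e 1,
      e 0 && e 3, e 1 && e 4 | e 2 && e 5]%N.

(** [turn e.1 e.2] is the third vertex of the triangle ahead of the dual edge; its spin decides
    which of the other two sides of that triangle the interface crosses next. *)
Definition nx (s : config) (e : edge) : edge :=
  let z := turn e.1 e.2 in if s z then (z, e.2) else (e.1, z).

(* [sa] and [sb] tell whether [a] and [b] keep their spins.  A flipping site has a run
   of at least four opposite neighbours; the new edges around it, at most two
   unless a neighbour flips too, are sent to the second and third edge of the run. *)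
Definition psi_rule (sa sb : bool) (s : config) (e : edge) : edge :=
  let: (a, b) := e in
  if sa then
    if sb then e
    else if s (nb 1 b a) then (b, nb 4 b a) else (b, nb 2 b a)
  else if sb then
    if s (nb 5 a b) then (nb 4 a b, a) else (nb 2 a b, a)
  else (b, a).

(* The first-return property of [psi] at an edge depends only on the twelve spins
   around a triangle; it is checked by evaluation over all their values.  Spins of other
   sites are unknown: [sure_stays] uses known ones only. *)
Module Patch.

Definition oa : site := (Posz 0, Posz 0).
Definition ob : site := (Posz 1, Posz 0).
Definition oz : site := (Posz 0, Posz 1).

Definition known (x : site) : bool :=
  match x with
  | (Posz 0, Posz 0) | (Posz 1, Posz 0) | (Posz 0, Posz 1) | (Negz 0, Posz 0)
  | (Posz 0, Negz 0) | (Posz 1, Negz 0) | (Negz 0, Posz 1) | (Posz 2, Posz 0)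
  | (Posz 2, Negz 0) | (Posz 1, Posz 1) | (Posz 0, Posz 2) | (Negz 0, Posz 2) => true
  | _ => false
  end.

Definition mk (b0 b1 b2 b3 b4 b5 b6 b7 b8 b9 b10 b11 : bool) (x : site) : bool :=
  match x with
  | (Posz 0, Posz 0) => b0 | (Posz 1, Posz 0) => b1 | (Posz 0, Posz 1) => b2
  | (Negz 0, Posz 0) => b3 | (Posz 0, Negz 0) => b4 | (Posz 1, Negz 0) => b5
  | (Negz 0, Posz 1) => b6 | (Posz 2, Posz 0) => b7 | (Posz 2, Negz 0) => b8
  | (Posz 1, Posz 1) => b9 | (Posz 0, Posz 2) => b10 | (Negz 0, Posz 2) => b11
  | _ => false
  end.

Arguments known : simpl never.
Arguments mk : simpl never.

Definition eqi (x y : int) : bool :=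
  match x, y with
  | Posz a, Posz b | Negz a, Negz b => eqn a b
  | _, _ => false
  end.
Definition eqp (x y : site) : bool := eqi x.1 y.1 && eqi x.2 y.2.
Definition eqe (e f : edge) : bool := eqp e.1 f.1 && eqp e.2 f.2.

(** One-sided: flips are asserted only at the three sites of the triangle, whose neighbours are all
    known. A negated [flips] claims nothing elsewhere, which keeps [skipped] conservative. *)
Definition flips (c : config) (x : site) : bool :=
  [|| eqp x oa && ~~ stays c oa ob, eqp x ob && ~~ stays c ob oa
    | eqp x oz && ~~ stays c oz oa].

Definition sure_stays (c : config) (x y : site) : bool :=
  let e k := known (nb k x y) && (c (nb k x y) == c x) in
  known x &&
  [|| e 0 && e 2, e 1 && e 3, e 2 && e 4, e 3 && e 5, e 4 && e 0, e 5 && e 1,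
      e 0 && e 3, e 1 && e 4 | e 2 && e 5]%N.

(** A certificate that [e] is not in the image of [psi]: exactly one of its ends flips, and both
    positions from which [psi_rule] could have produced [e] are ruled out. *)
Definition skipped (c : config) (e : edge) : bool :=
  let: (x, y) := e in
  [&& flips c x, sure_stays c y x, all (fun k => known (nb k x y)) (iota 0 6) &
   ~~ ((c (nb 4 x y) && ~~ flips c (nb 4 x y) && ~~ c (nb 5 x y)) ||
       (c (nb 2 x y) && ~~ flips c (nb 2 x y) && c (nb 3 x y)))] ||
  [&& flips c y, sure_stays c x y, all (fun k => known (nb k y x)) (iota 0 6) &
   ~~ ((~~ c (nb 2 y x) && ~~ flips c (nb 2 y x) && c (nb 1 y x)) ||
       (~~ c (nb 4 y x) && ~~ flips c (nb 4 y x) && ~~ c (nb 3 y x)))].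

(** Follows the old interface from [e] to [f] through certified non-images, and fails on leaving the
    patch; [n] is fuel. *)
Fixpoint walk (n : nat) (c : config) (e f : edge) : bool :=
  if n is m.+1 then
    let e' := nx c e in
    known (turn e.1 e.2) && (eqe e' f || (skipped c e' && walk m c e' f))
  else false.

Definition xr (c : config) (x y : site) : bool := if stays c x y then c x else ~~ c x.

Definition check (c : config) : bool :=
  if xr c oa ob then
    if xr c ob oa then true
    else
      let sa := stays c oa ob in let sb := stays c ob oa in let sz := stays c oz oa in
      let f := if xr c oz oa then psi_rule sz sb c (oz, ob) else psi_rule sa sz c (oa, oz) in
      walk 6 c (psi_rule sa sb c (oa, ob)) f
  else true.

Definition both (f : bool -> bool) : bool := if f true then f false else false.

Definition check_all : bool :=
  both (fun b0 => both (fun b1 => both (fun b2 => both (fun b3 =>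
  both (fun b4 => both (fun b5 => both (fun b6 => both (fun b7 =>
  both (fun b8 => both (fun b9 => both (fun b10 => both (fun b11 =>
    check (mk b0 b1 b2 b3 b4 b5 b6 b7 b8 b9 b10 b11))))))))))))).

Lemma check_allT : check_all.
Proof. by lazy. Qed.

End Patch.

Lemma adjE (x y : site) : adj x y =
  [|| (y.1 == x.1 + 1) && (y.2 == x.2), (y.1 == x.1 - 1) && (y.2 == x.2),
      (y.1 == x.1) && (y.2 == x.2 + 1), (y.1 == x.1) && (y.2 == x.2 - 1),
      (y.1 == x.1 + 1) && (y.2 == x.2 - 1) | (y.1 == x.1 - 1) && (y.2 == x.2 + 1)].
Proof. case: x y => x1 x2 [y1 y2]; rewrite /adj /offsets !inE !xpair_eqE /=; lia. Qed.

Lemma adj_sym x y : adj x y = adj y x.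
Proof. rewrite !adjE; lia. Qed.

Lemma adj_turn x y : adj x (turn x y) = adj x y.
Proof. rewrite !adjE /turn /=; lia. Qed.

Lemma adj_turn2 x y : adj x y -> adj y (turn x y).
Proof. rewrite !adjE /turn /=; lia. Qed.

Lemma adj_nb k x y : adj x (nb k x y) = adj x y.
Proof. by elim: k => //= k IH; rewrite adj_turn. Qed.

Lemma site_eq (x y : site) : x.1 = y.1 -> x.2 = y.2 -> x = y.
Proof. by case: x y => ? ? [? ?] /= -> ->. Qed.

Lemma nb6 x y : nb 6 x y = y.
Proof. by apply: site_eq; rewrite /nb /turn /=; lia. Qed.

Lemma nb_nb j k x y : nb j x (nb k x y) = nb (j + k) x y.
Proof. by rewrite /nb iterD. Qed.

Lemma nb_mod k x y : nb (k + 6) x y = nb k x y.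
Proof. by rewrite -nb_nb nb6. Qed.

Lemma turnC x y : turn y x = nb 5 x y.
Proof. by apply: site_eq; rewrite /nb /turn /=; lia. Qed.

Lemma nb5C x y : nb 5 y x = turn x y.
Proof. by rewrite turnC. Qed.

Lemma turn_back x y : turn y (turn x y) = x.
Proof. by apply: site_eq; rewrite /turn /=; lia. Qed.

Lemma turn_forth x y : turn (turn x y) x = y.
Proof. by apply: site_eq; rewrite /turn /=; lia. Qed.

Lemma adj_nbP x y y' : adj x y -> adj x y' -> exists2 k, (k < 6)%N & y' = nb k x y.
Proof.
move=> axy axy'.
suff : has (fun k => y' == nb k x y) (iota 0 6).
  by case/hasP => k; rewrite mem_iota => /andP[_ lk] /eqP ->; exists k.
case: x y y' axy axy' => x1 x2 [y1 y2] [z1 z2].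
rewrite !adjE /nb /turn /= !xpair_eqE /=.
by do 5 ?[case/orP]; case/andP => /eqP -> /eqP ->; lia.
Qed.

Lemma adj_nb_nb i j x y : adj x y -> (i < 6)%N -> (j < 6)%N ->
  adj (nb i x y) (nb j x y) =
  [|| (j == i + 1)%N, (i == j + 1)%N, (j == i + 5)%N | (i == j + 5)%N].
Proof.
case: x y => x1 x2 [y1 y2]; rewrite adjE /=.
do 6 ?[case: i => [|i]]; do 6 ?[case: j => [|j]]; rewrite ?adjE /nb /turn //=; lia.
Qed.

Lemma nb_inj i j x y : adj x y -> (i < 6)%N -> (j < 6)%N -> nb i x y = nb j x y -> i = j.
Proof.
case: x y => x1 x2 [y1 y2]; rewrite adjE /=.
by do 6 ?[case: i => [|i]]; do 6 ?[case: j => [|j]]; rewrite /nb /turn //= => + _ _ [? ?]; lia.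
Qed.

Lemma stepE s x y : adj x y -> step s x = if stays s x y then s x else ~~ s x.
Proof.
move=> axy; rewrite /step; congr (if _ then _ else _).
apply/asboolP/idP => [[y1 [y2 [a1 a2 n12 nadj [s1 s2]]]]|].
  have [i li ey1] := adj_nbP axy a1; have [j lj ey2] := adj_nbP axy a2.
  move: nadj n12 s1 s2; rewrite {}ey1 {}ey2 adj_nb_nb //.
  do 6 ?[case: i li => [|i] li //]; do 6 ?[case: j lj => [|j] lj //];
    rewrite /stays //= ?eqxx //;
    by move=> _ _ -> ->; rewrite !eqxx ?orbT.
have P i j : (i < 6)%N -> (j < 6)%N ->
    ~~ [|| i == j, (j == i + 1)%N, (i == j + 1)%N, (j == i + 5)%N | (i == j + 5)%N] ->
    (s (nb i x y) == s x) && (s (nb j x y) == s x) ->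
    exists y1 y2, [/\ adj x y1, adj x y2, y1 != y2, ~~ adj y1 y2 &
       s y1 = s x /\ s y2 = s x].
  move=> li lj; rewrite negb_or => /andP[nij nadj] /andP[/eqP s1 /eqP s2].
  exists (nb i x y), (nb j x y); rewrite !adj_nb adj_nb_nb //; split=> //.
  by apply: contra_neq nij; apply: nb_inj.
rewrite /stays; do 8 ?[case/orP].
- exact: (P 0%N 2%N). 
- exact: (P 1%N 3%N).
- exact: (P 2%N 4%N).
- exact: (P 3%N 5%N).
- exact: (P 4%N 0%N).
- exact: (P 5%N 1%N).
- exact: (P 0%N 3%N).
- exact: (P 1%N 4%N).
- exact: (P 2%N 5%N).
Qed.

Definition stay (s : config) (x : site) : bool := step s x == s x.

Lemma step_stay s x : step s x = if stay s x then s x else ~~ s x.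
Proof. by rewrite /stay; case: (step s x) (s x) => [] []. Qed.

Lemma stayE s x y : adj x y -> stay s x = stays s x y.
Proof. by move=> axy; rewrite /stay (stepE _ axy); case: stays (s x) => [] []. Qed.

Definition iface (s : config) (e : edge) : bool := [&& adj e.1 e.2, s e.1 & ~~ s e.2].

Definition psi (s : config) (e : edge) : edge := psi_rule (stay s e.1) (stay s e.2) s e.

Lemma iface_nx s e : iface s e -> iface s (nx s e).
Proof.
case: e => a b /and3P[/= ab sa sb]; rewrite /nx /iface /=.
case: ifP => /= sz; rewrite sz ?sa ?sb ?andbT /=; last by rewrite adj_turn.
by rewrite adj_sym adj_turn2.
Qed.

Lemma iface_iter s e n : iface s e -> iface s (iter n (nx s) e).
Proof. by move=> He; elim: n => //= n; apply: iface_nx. Qed.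

Definition pv (s : config) (e : edge) : edge :=
  let z := turn e.2 e.1 in if s z then (z, e.2) else (e.1, z).

Lemma nxK s e : iface s e -> pv s (nx s e) = e.
Proof.
case: e => a b /and3P[/= ab sa sb]; rewrite /nx /pv /=.
by case: (s (turn a b)) => /=; rewrite ?turn_back ?turn_forth ?sa ?(negbTE sb).
Qed.

Lemma pvK s e : iface s e -> nx s (pv s e) = e.
Proof.
case: e => a b /and3P[/= ab sa sb]; rewrite /nx /pv /=.
by case: (s (turn b a)) => /=; rewrite ?turn_back ?turn_forth ?sa ?(negbTE sb).
Qed.

Lemma nx_inj s e f : iface s e -> iface s f -> nx s e = nx s f -> e = f.
Proof. by move=> He Hf E; rewrite -(nxK He) E nxK. Qed.

(** A flipping site has no two non-adjacent neighbours of its own spin, so one agreeing neighbour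
    [y] forces the three sites across to disagree, and at most one of the two sites next to [y]
    agrees. *)
Lemma flip_opp s x y : adj x y -> ~~ stay s x -> s y = s x ->
  [/\ s (nb 2 x y) = ~~ s x, s (nb 3 x y) = ~~ s x, s (nb 4 x y) = ~~ s x &
      s (nb 1 x y) = s x -> s (nb 5 x y) = ~~ s x].
Proof.
move=> axy; rewrite (stayE _ axy) /stays => + sy.
rewrite -[nb 0 x y]/y sy eqxx /=.
by case: (s x); case: (s (nb 1 x y)); case: (s (nb 2 x y)); case: (s (nb 3 x y));
  case: (s (nb 4 x y)); case: (s (nb 5 x y)).
Qed.

(** The two sites next to [y] on the ring around [x] are neighbours of [y] but not of each other. *)
Lemma stay_between s x y : adj x y ->
  s (nb 1 x y) = s y -> s (nb 5 x y) = s y -> stay s y.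
Proof.
move=> axy s1 s5; rewrite (@stayE _ _ x) 1?adj_sym // /stays.
have -> : nb 1 y x = nb 5 x y by rewrite -turnC.
by rewrite (nb5C x y) -[turn x y]/(nb 1 x y) s1 s5 eqxx /= !orbT.
Qed.

Lemma psi_iface s e : iface (step s) e -> iface s (psi s e).
Proof.
case: e => a b /and3P[/= ab]; rewrite !step_stay /psi /=.
have ba : adj b a by rewrite adj_sym.
case: (boolP (stay s a)) => fa; case: (boolP (stay s b)) => fb /= sa sb.
- by rewrite /iface /= ab sa sb.
- have {}sb : s b by case: (s b) sb.
  have [s2 s3 s4 _] := flip_opp ba fb (etrans sa (esym sb)).
  by case: ifP => _; rewrite /iface /= ?adj_turn ba sb ?s2 ?s4 sb.
- have {}sa : ~~ s a by [].
  have [s2 s3 s4 _] := flip_opp ab fa (etrans (negbTE sb) (esym (negbTE sa))).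
  by case: ifP => _; rewrite /iface /= adj_sym ?adj_turn ab sa ?s2 ?s4 sa.
- by rewrite /iface /= ba sa andbT; case: (s b) sb.
Qed.

(** If exactly one end flips, the image joins it to an opposite neighbour [u] that stays, being
    inside the run. The final disjunction gives the two possible places of the staying end relative
    to [u], with the spin that selects each. *)
Variant psi_spec (s : config) (a b : site) : edge -> Prop :=
| PsiNone of stay s a & stay s b & s a & ~~ s b : psi_spec s a b (a, b)
| PsiBoth of ~~ stay s a & ~~ stay s b & ~~ s a & s b : psi_spec s a b (b, a)
| PsiRight u of stay s a & ~~ stay s b & stay s u & s a & s b & ~~ s u & adj b u &
    (a = nb 4 b u /\ ~~ s (nb 5 b u)) \/ (a = nb 2 b u /\ s (nb 3 b u)) :
    psi_spec s a b (b, u)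
| PsiLeft u of ~~ stay s a & stay s b & stay s u & ~~ s a & ~~ s b & s u & adj a u &
    (b = nb 2 a u /\ s (nb 1 a u)) \/ (b = nb 4 a u /\ ~~ s (nb 3 a u)) :
    psi_spec s a b (u, a).

Lemma psiP s a b : iface (step s) (a, b) -> psi_spec s a b (psi s (a, b)).
Proof.
case/and3P => /= ab; rewrite !step_stay /psi /=.
have ba : adj b a by rewrite adj_sym.
case: (boolP (stay s a)) => fa; case: (boolP (stay s b)) => fb /= sa sb.
- exact: PsiNone.
- have {}sb : s b by case: (s b) sb.
  have [s2 s3 s4 s5] := flip_opp ba fb (etrans sa (esym sb)); rewrite sb /= in s2 s3 s4 s5.
  have s1E : nb 1 b (nb 1 b a) = nb 2 b a by rewrite nb_nb.
  case: ifP => s1; apply: PsiRight => //.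
  + apply: (@stay_between _ b); rewrite ?adj_nb // nb_nb ?(nb_mod 3) ?s3 ?s4 //.
    by rewrite s5 //.
  + by rewrite s4.
  + by rewrite adj_nb.
  + by right; rewrite !nb_nb (nb_mod 0) (nb_mod 1).
  + apply: (@stay_between _ b); rewrite ?adj_nb // nb_nb ?(nb_mod 1) ?s2 ?s3 //.
  + by rewrite s2.
  + by rewrite adj_nb.
  + by left; rewrite !nb_nb (nb_mod 0) (nb_mod 1) s1.
- have {}sa : s a = false by apply/negbTE.
  have {}sb : s b = false by apply/negbTE.
  have [s2 s3 s4 s5] := flip_opp ab fa (etrans sb (esym sa)); rewrite sa /= in s2 s3 s4 s5.
  have s51 : s (nb 5 a b) = false -> s (nb 1 a b).
    by case E: (s (nb 1 a b)) => // H; rewrite s5 // in H.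
  case: ifP => s1; apply: PsiLeft => //; rewrite ?sa ?sb //.
  + apply: (@stay_between _ a); rewrite ?adj_nb // nb_nb ?(nb_mod 3) ?s3 ?s4 //.
  + by rewrite adj_nb.
  + by left; rewrite !nb_nb (nb_mod 0).
  + apply: (@stay_between _ a); rewrite ?adj_nb // nb_nb ?(nb_mod 1) ?s2 ?s3 // s51 //.
  + by rewrite adj_nb.
  + by right; rewrite !nb_nb (nb_mod 0) s1.
- by apply: PsiBoth => //; case: (s b) sb.
Qed.

(** The shape of the preimage is read off from which ends of the image flip. The two candidate
    places in [PsiRight] or [PsiLeft] are not adjacent, so the flipping site cannot agree with both
    ([Q] below). *)
Lemma psi_inj s e f : iface (step s) e -> iface (step s) f -> psi s e = psi s f -> e = f.
Proof.
case: e f => a b [a' b'] He Hf; move: (He) (Hf) => /and3P[ab _ _] /and3P[ab' _ _].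
case: (psiP He) => [sa sb _ _|sa sb _ _|u sa sb su ca cb cu adju Hu|u sa sb su ca cb cu adju Hu];
case: (psiP Hf) => [sa' sb' _ _|sa' sb' _ _|u' sa' sb' su' ca' cb' cu' adju' Hu'|u' sa' sb' su' ca' cb' cu' adju' Hu'].
all: case=> E1 E2; subst.
all: try by [].
all: try match goal with
  H : is_true ?c, H' : is_true (~~ ?c) |- _ => by rewrite H in H' end.
- congr pair.
  have Q : s (nb 2 b' u') -> s (nb 4 b' u') -> False.
    move=> s2 s4.
    have [|+ _ _ _] := @flip_opp s b' (nb 2 b' u') _ sb' (etrans s2 (esym cb')).
      by rewrite adj_nb.
    by rewrite nb_nb s4 cb'.
  by case: Hu Hu' => [] [? H1] [] [? H2]; subst => //; case: Q.
- congr pair.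
  have Q : ~~ s (nb 2 a' u') -> ~~ s (nb 4 a' u') -> False.
    move=> s2 s4.
    have [|+ _ _ _] := @flip_opp s a' (nb 2 a' u') _ sa' (etrans (negbTE s2) (esym (negbTE ca'))).
      by rewrite adj_nb.
    by rewrite nb_nb (negbTE s4) (negbTE ca').
  by case: Hu Hu' => [] [? H1] [] [? H2]; subst => //; case: Q.
Qed.

Lemma psi_fix s e : iface s e -> stay s e.1 -> stay s e.2 ->
  iface (step s) e /\ psi s e = e.
Proof.
case: e => a b /and3P[/= ab sa sb] fa fb.
by rewrite /iface /psi /= !step_stay fa fb ab sa sb.
Qed.

Definition has_site (x : site) (e : edge) : bool := (x == e.1) || (x == e.2).

Definition moving (s : config) (e : edge) : bool := ~~ (stay s e.1 && stay s e.2).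

(* The sites met by the new interface were already met by the old one, nearby: this
   is what prevents stretches of interface from drifting over time. *)
Lemma psi_sites s e x : iface (step s) e -> has_site x e ->
  has_site x (psi s e) \/
  exists f m, [/\ iface s f, has_site x f, moving s m, moving s (psi s e) &
    (m = nx s f /\ psi s e = nx s m) \/ (m = nx s (psi s e) /\ f = nx s m)].
Proof.
case: e => a b He; have := psi_iface He; have := psiP He.
case: (psi s (a, b)) / => [fa fb sa sb|fa fb sa sb|u fa fb fu sa sb su adju Hu|u fa fb fu sa sb su adju Hu] Ie.
- by rewrite /has_site /= => ->; left.
- by rewrite /has_site /= orbC => ->; left.
- case/orP => /= /eqP->; last by left; rewrite /has_site eqxx.
  right; have ba : adj b a by case/and3P: He => /=; rewrite adj_sym.
  case: Hu => [[Ea s5]|[Ea s3]].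
  + exists (a, nb 5 b u), (b, nb 5 b u).
    have Ie' : nx s (b, nb 5 b u) = (b, u).
      by rewrite /nx /= -[turn b _]/(nb 6 b u) nb6 (negbTE su).
    have If : nx s (a, nb 5 b u) = (b, nb 5 b u).
      rewrite /nx /=; have -> : turn a (nb 5 b u) = b; last by rewrite sb.
      by rewrite Ea -[nb 5 b u]/(turn b (nb 4 b u)) turn_back.
    split; rewrite /has_site ?eqxx /moving ?(negbTE fb) //; last by left.
    by rewrite /iface /= sa s5 andbT Ea -[nb 5 b u]/(turn b (nb 4 b u)) adj_turn2 // adj_nb.
  + have s1 : ~~ s (nb 1 b u).
      have [_ _ _ +] := flip_opp ba fb (etrans sa (esym sb)).
      by rewrite Ea !nb_nb (nb_mod 1) sb => ->.
    have E1 : nx s (b, u) = (b, nb 1 b u) by rewrite /nx /= (negbTE s1).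
    have E2 : nx s (b, nb 1 b u) = (a, nb 1 b u).
      by rewrite /nx /= -[turn b _]/(nb 2 b u) -Ea sa.
    exists (a, nb 1 b u), (b, nb 1 b u).
    split; rewrite /has_site ?eqxx /moving ?(negbTE fb) //; try by [right].
    by rewrite -E2 -E1; do 2 apply: iface_nx.
- case/orP => /= /eqP->; first by left; rewrite /has_site eqxx orbT.
  right; have ab : adj a b by case/and3P: He.
  case: Hu => [[Eb s1]|[Eb s3]].
  + have E1 : nx s (nb 1 a u, b) = (nb 1 a u, a).
      rewrite /nx /=; have -> : turn (nb 1 a u) b = a; last by rewrite (negbTE sa).
      by rewrite Eb -[nb 2 a u]/(turn a (nb 1 a u)) turn_back.
    have E2 : nx s (nb 1 a u, a) = (u, a).
      rewrite /nx /=; have -> : turn (nb 1 a u) a = u; last by rewrite su.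
      exact: turn_forth.
    exists (nb 1 a u, b), (nb 1 a u, a).
    split; rewrite /has_site ?eqxx ?orbT /moving ?(negbTE fa) ?andbF //; last by left.
    by rewrite /iface s1 sb andbT Eb -[nb 2 a u]/(turn a (nb 1 a u)) adj_turn2 // adj_nb.
  + have s5 : s (nb 5 a u).
      have [_ _ _ +] := flip_opp ab fa (etrans (negbTE sb) (esym (negbTE sa))).
      rewrite Eb !nb_nb (nb_mod 3) (negbTE sa) -[nb (1 + 4) a u]/(nb 5 a u).
      by case: (s (nb 5 a u)) => // /(_ erefl); rewrite (negbTE s3).
    have E1 : nx s (u, a) = (nb 5 a u, a) by rewrite /nx /= turnC s5.
    have E2 : nx s (nb 5 a u, a) = (nb 5 a u, b).
      rewrite /nx /=; have -> : turn (nb 5 a u) a = b; last by rewrite (negbTE sb).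
      by rewrite Eb -[nb 5 a u]/(turn a (nb 4 a u)) turn_forth.
    exists (nb 5 a u, b), (nb 5 a u, a).
    split; rewrite /has_site ?eqxx ?orbT /moving ?(negbTE fa) ?andbF //; try by [right].
    by rewrite -E2 -E1; do 2 apply: iface_nx.
Qed.

(** * Transport of the finite check to an arbitrary edge *)

Section Embedding.
Variables (s : config) (a b : site).

(** In Eisenstein integers this is [v] times [b - a], plus [a]: for adjacent [a] and [b], the
    rotation of the lattice taking the edge from (0, 0) to (1, 0) onto that from [a] to [b]. *)
Definition emb (v : site) : site :=
  (a.1 + v.1 * (b.1 - a.1) - v.2 * (b.2 - a.2),
   a.2 + v.1 * (b.2 - a.2) + v.2 * (b.1 - a.1 + (b.2 - a.2))).

Definition embe (e : edge) : edge := (emb e.1, emb e.2).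

Lemma emb_turn x y : emb (turn x y) = turn (emb x) (emb y).
Proof. by apply: site_eq; rewrite /emb /turn /=; ring. Qed.

Lemma emb_nb k x y : emb (nb k x y) = nb k (emb x) (emb y).
Proof. by rewrite /nb; elim: k => //= k IH; rewrite emb_turn IH. Qed.

Lemma emb_stays x y : stays s (emb x) (emb y) = stays (s \o emb) x y.
Proof. by rewrite /stays /= !emb_nb. Qed.

Lemma emb_nx e : nx s (embe e) = embe (nx (s \o emb) e).
Proof. by case: e => x y; rewrite /nx /= emb_turn; case: ifP => _; rewrite /embe /= emb_turn. Qed.

Lemma emb_psi_rule p q x y :
  psi_rule p q s (emb x, emb y) = embe (psi_rule p q (s \o emb) (x, y)).
Proof.
by case: p; case: q; rewrite /psi_rule /= ?emb_nb //; case: ifP => _; rewrite /embe /= emb_nb.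
Qed.

Lemma emb_oa : emb Patch.oa = a.
Proof. by apply: site_eq; rewrite /emb /=; lia. Qed.
Lemma emb_ob : emb Patch.ob = b.
Proof. by apply: site_eq; rewrite /emb /=; lia. Qed.
Lemma emb_oz : emb Patch.oz = turn a b.
Proof. by apply: site_eq; rewrite /emb /turn /=; lia. Qed.

Hypothesis ab : adj a b.

Let c := s \o emb.
(** The pulled-back spins in the closed form over which [Patch.check_all] ranges; it agrees with [c]
    on known sites. *)
Let ck : config :=
  Patch.mk (c (0, 0)) (c (1, 0)) (c (0, 1)) (c (-1, 0)) (c (0, -1)) (c (1, -1))
    (c (-1, 1)) (c (2, 0)) (c (2, -1)) (c (1, 1)) (c (0, 2)) (c (-1, 2)).

Lemma ck_known x : Patch.known x -> ck x = c x.
Proof.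
by case: x => [[[|[|[|?]]]|[|?]] [[|[|[|?]]]|[|?]]].
Qed.

Lemma ck_check : Patch.check ck.
Proof.
have B f : Patch.both f -> forall t, f t.
  by rewrite /Patch.both; case E: (f true) => // E' [].
by move: Patch.check_allT;
  move/B/(_ (c (0, 0)))/B/(_ (c (1, 0)))/B/(_ (c (0, 1)))/B/(_ (c (-1, 0)));
  move/B/(_ (c (0, -1)))/B/(_ (c (1, -1)))/B/(_ (c (-1, 1)))/B/(_ (c (2, 0)));
  move/B/(_ (c (2, -1)))/B/(_ (c (1, 1)))/B/(_ (c (0, 2)))/B/(_ (c (-1, 2))).
Qed.

Lemma stays_ck x y : Patch.known x -> all (fun k => Patch.known (nb k x y)) (iota 0 6) ->
  stays ck x y = stays c x y.
Proof.
move=> kx /= /and5P[k0 k1 k2 k3 /and3P[k4 k5 _]].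
by rewrite /stays !ck_known.
Qed.

Lemma stay_oa : stay s a = stays ck Patch.oa Patch.ob.
Proof. by rewrite (stayE _ ab) stays_ck // -{1}emb_oa -{1}emb_ob emb_stays. Qed.

Lemma stay_ob : stay s b = stays ck Patch.ob Patch.oa.
Proof. by rewrite (@stayE _ _ a) 1?adj_sym // stays_ck // -{1}emb_oa -{1}emb_ob emb_stays. Qed.

Lemma stay_oz : stay s (turn a b) = stays ck Patch.oz Patch.oa.
Proof.
by rewrite (@stayE _ _ a) 1?adj_sym ?adj_turn // stays_ck // -{2}emb_oa -emb_oz emb_stays.
Qed.

Lemma eqpP x y : Patch.eqp x y -> x = y.
Proof.
case: x y => [[m|m] [n|n]] [[p|p] [q|q]]; rewrite /Patch.eqp /=; rewrite ?andbF //.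
all: by case/andP => /eqnP -> /eqnP ->.
Qed.

Lemma eqeP e f : Patch.eqe e f -> e = f.
Proof. by case: e f => x y [z t] /andP[/eqpP /= -> /eqpP ->]. Qed.

Lemma flips_ck x : Patch.flips ck x -> ~~ stay s (emb x) /\ Patch.known x.
Proof.
case/or3P => /andP[/eqpP -> H]; split => //.
- by rewrite emb_oa stay_oa.
- by rewrite emb_ob stay_ob.
- by rewrite emb_oz stay_oz.
Qed.

Lemma sure_stays_ck x y : adj (emb x) (emb y) -> Patch.sure_stays ck x y -> stay s (emb x).
Proof.
move=> xy /andP[kx]; rewrite (stayE _ xy) emb_stays -/c /stays (ck_known kx).
have E k : Patch.known (nb k x y) && (ck (nb k x y) == c x) -> c (nb k x y) == c x.
  by case/andP => /ck_known ->.
by do 8 ?[case/orP]; case/andP => /E -> /E ->; rewrite ?orbT.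
Qed.

Lemma walkP n e f : Patch.walk n ck e f ->
  exists2 j, iter j.+1 (nx c) e = f &
    forall i, (i < j)%N -> Patch.skipped ck (iter i.+1 (nx c) e).
Proof.
elim: n e => //= n IH e /andP[kz].
have -> : nx ck e = nx c e by rewrite /nx ck_known.
case/orP => [/eqeP <-|/andP[sk /IH[j Ej Hj]]]; first by exists 0%N.
exists j.+1; first by rewrite iterSr.
by case=> // i /Hj; rewrite -iterSr.
Qed.

(** One end flips and the other stays, so of the cases of [psiP] only [PsiRight] or [PsiLeft]
    survives, and its two positions are those excluded by the certificate. *)
Lemma skipped_ck e : iface s (embe e) -> Patch.skipped ck e ->
  forall g, iface (step s) g -> psi s g <> embe e.
Proof.
case: e => x y /and3P[/= xy sx sy] /orP[] /and4P[/flips_ck[fx kx] /sure_stays_ck fy];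
  move=> /= /and5P[_ k1 k2 k3 /and3P[k4 k5 _]]; rewrite !ck_known //.
- have {}fy := fy (etrans (adj_sym _ _) xy).
  rewrite /c /= !emb_nb => H [p q] Hg.
  case: (psiP Hg) => [fp fq sp sq|fp fq sp sq|u fp fq fu sp sq su adju Hu|u fp fq fu sp sq su adju Hu];
    case=> ? ?; subst; try (by rewrite fp in fx); try (by rewrite fy in fp);
    try (by rewrite fu in fx).
  case: Hu => [] [Ep s']; rewrite Ep in sp fp.
    move: H; rewrite sp s' /= andbT.
    by case: (boolP (Patch.flips _ _)) => //= /flips_ck[]; rewrite emb_nb fp.
  move: H; rewrite sp s' /= andbT.
  by case: (boolP (Patch.flips _ (nb 2 _ _))) => [/flips_ck[]|]; rewrite ?emb_nb ?fp ?orbT.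
- have {}fy := fy xy.
  rewrite /c /= !emb_nb => H [p q] Hg.
  case: (psiP Hg) => [fp fq sp sq|fp fq sp sq|u fp fq fu sp sq su adju Hu|u fp fq fu sp sq su adju Hu];
    case=> ? ?; subst; try (by rewrite fq in fx); try (by rewrite fy in fq);
    try (by rewrite fu in fx).
  case: Hu => [] [Ep s']; rewrite Ep in sq fq.
    move: H; rewrite sq s' /= andbT.
    by case: (boolP (Patch.flips _ _)) => //= /flips_ck[]; rewrite emb_nb fq.
  move: H; rewrite sq s' /= andbT.
  by case: (boolP (Patch.flips _ (nb 4 _ _))) => [/flips_ck[]|]; rewrite ?emb_nb ?fq ?orbT.
Qed.

Lemma psi_rule_ck p q x y : Patch.known (nb 1 y x) -> Patch.known (nb 5 x y) ->
  psi_rule p q s (emb x, emb y) = embe (psi_rule p q ck (x, y)).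
Proof.
by move=> k1 k2; rewrite emb_psi_rule /psi_rule !ck_known.
Qed.

Lemma psi_next_patch : iface (step s) (a, b) ->
  exists2 j, iter j.+1 (nx s) (psi s (a, b)) = psi s (nx (step s) (a, b)) &
    forall i, (i < j)%N -> forall g, iface (step s) g ->
      psi s g <> iter i.+1 (nx s) (psi s (a, b)).
Proof.
move=> Iab; have /and3P[_ sa sb] := Iab; rewrite /= in sa sb.
have az : adj a (turn a b) by rewrite adj_turn.
have ba : adj b a by rewrite adj_sym.
have za : adj (turn a b) a by rewrite adj_sym.
have kxr x y : Patch.xr ck x y = if stays ck x y then ck x else ~~ ck x by [].
have ca : ck Patch.oa = s a by rewrite ck_known // /c /= emb_oa.
have cb : ck Patch.ob = s b by rewrite ck_known // /c /= emb_ob.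
have cz : ck Patch.oz = s (turn a b) by rewrite ck_known // /c /= emb_oz.
have := ck_check; rewrite /Patch.check !kxr ca cb cz -stay_oa -stay_ob -stay_oz.
rewrite -!step_stay sa (negbTE sb) => /walkP[j].
have Ep : psi s (a, b) = embe (psi_rule (stay s a) (stay s b) ck (Patch.oa, Patch.ob)).
  by rewrite -psi_rule_ck // emb_oa emb_ob.
have -> : psi s (nx (step s) (a, b)) = embe (if step s (turn a b)
    then psi_rule (stay s (turn a b)) (stay s b) ck (Patch.oz, Patch.ob)
    else psi_rule (stay s a) (stay s (turn a b)) ck (Patch.oa, Patch.oz)).
  by rewrite /nx /=; case: ifP => _; rewrite -psi_rule_ck // ?emb_oa ?emb_ob ?emb_oz.
have itE k e : iter k (nx s) (embe e) = embe (iter k (nx c) e).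
  by elim: k => //= k ->; rewrite emb_nx.
move=> <- H; exists j; first by rewrite Ep itE.
move=> i /H sk g Ig; rewrite Ep itE; apply: skipped_ck => //.
by rewrite -itE -Ep; apply: iface_iter; apply: psi_iface.
Qed.

End Embedding.

(* The new interface is the first-return map of the old one to the image of [psi]. *)
Lemma psi_next s e : iface (step s) e ->
  exists2 j, iter j.+1 (nx s) (psi s e) = psi s (nx (step s) e) &
    forall i, (i < j)%N -> forall g, iface (step s) g ->
      psi s g <> iter i.+1 (nx s) (psi s e).
Proof. by case: e => a b H; apply: psi_next_patch => //; case/and3P: H. Qed.

Definition edge_at (s : config) (x u : site) : edge := if s x then (x, u) else (u, x).

(** * Flipping sites all of whose interface edges are images *)

Section FlippingLine.
Variables (s : config) (x : site).
Hypothesis fx : ~~ stay s x.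
Hypothesis image : forall u, adj x u -> s u = ~~ s x ->
  exists2 g, iface (step s) g & psi s g = edge_at s x u.

Let o y k := s (nb k x y) != s x.
Let f y k := ~~ stay s (nb k x y).

Lemma image_cond u : adj x u -> s u != s x -> stay s u ->
  (~~ o u 4 && o u 5 || ~~ o u 2 && ~~ o u 3) || (~~ o u 2 && o u 1 || ~~ o u 4 && ~~ o u 3).
Proof.
move=> xu su fu; have fx' := fx; have {}su : s u = ~~ s x by case: (s u) (s x) su => [] [].
have [[p q] Hg] := image xu su; rewrite /edge_at.
case: (psiP Hg) => [fp fq sp sq|fp fq sp sq|v fp fq fv sp sq sv adjv Hv|v fp fq fv sp sq sv adjv Hv];
  case: ifP => sx [? ?]; subst; rewrite /o;
  try match goal with H : is_true ?c, H' : is_true (~~ ?c) |- _ => by rewrite H in H' end.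
- by case: Hv => [] [Ep s']; rewrite Ep in sp; rewrite sx ?sp ?s' ?(negbTE s') /= ?orbT.
- by case: Hv => [] [Ep s']; rewrite Ep in sq; rewrite sx (negbTE sq) ?s' ?(negbTE s') /= ?orbT.
Qed.

(** A finite check on six opposite-spin bits [o] and six flip bits [f]. The constraints are that [x]
    flips ([nst]), that an opposite neighbour which stays satisfies [image_cond] ([C]), and that the
    middle one of three consecutive opposite neighbours stays ([Bt]). *)
Lemma flip_bits y : adj x y ->
  (exists2 k, o y k & f y k) /\ (o y 0 -> f y 0 -> o y 3 /\ f y 3).
Proof.
move=> xy.
have sE k : (s (nb k x y) == s x) = ~~ o y k by rewrite /o negbK.
have nst := fx; rewrite (stayE _ xy) /stays !sE in nst.
have C k : o y k ==> f y k ||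
   ((~~ o y (4 + k) && o y (5 + k) || ~~ o y (2 + k) && ~~ o y (3 + k)) ||
    (~~ o y (2 + k) && o y (1 + k) || ~~ o y (4 + k) && ~~ o y (3 + k))).
  apply/implyP => ok; rewrite /f; case: (boolP (stay s (nb k x y))) => //= fk.
  have := @image_cond (nb k x y); rewrite adj_nb => /(_ xy ok fk).
  by rewrite /o !nb_nb.
have Bt k : [&& o y k, o y (1 + k) & o y (5 + k)] ==> ~~ f y k.
  apply/implyP => /and3P[]; rewrite /o /f negbK => h0 h1 h5.
  apply: (@stay_between _ x); rewrite ?adj_nb // nb_nb.
    by move: h0 h1; do 3 case: (s _).
  by move: h0 h5; do 3 case: (s _).
have om k : o y (k + 6) = o y k by rewrite /o nb_mod.
suff [H1 H2] : [|| o y 0 && f y 0, o y 1 && f y 1, o y 2 && f y 2, o y 3 && f y 3,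
      o y 4 && f y 4 | o y 5 && f y 5]%N /\ (o y 0 -> f y 0 -> o y 3 /\ f y 3).
  split=> //; move: H1; do 5 ?[case/orP]; case/andP => h1 h2;
  by [exists 0%N|exists 1%N|exists 2%N|exists 3%N|exists 4%N|exists 5%N].
move: nst (C 0%N) (C 1%N) (C 2%N) (C 3%N) (C 4%N) (C 5%N).
move: (Bt 0%N) (Bt 1%N) (Bt 2%N) (Bt 3%N) (Bt 4%N) (Bt 5%N) => {C Bt}.
(* Offsets of six or more wrap around the ring, so that only the bits 0 to 5 remain. *)
rewrite -[(1 + 5)%N]/(0 + 6)%N -[(2 + 4)%N]/(0 + 6)%N -[(2 + 5)%N]/(1 + 6)%N
  -[(3 + 3)%N]/(0 + 6)%N -[(3 + 4)%N]/(1 + 6)%N -[(3 + 5)%N]/(2 + 6)%N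
  -[(4 + 2)%N]/(0 + 6)%N -[(4 + 3)%N]/(1 + 6)%N -[(4 + 4)%N]/(2 + 6)%N
  -[(4 + 5)%N]/(3 + 6)%N -[(5 + 1)%N]/(0 + 6)%N -[(5 + 2)%N]/(1 + 6)%N
  -[(5 + 3)%N]/(2 + 6)%N -[(5 + 4)%N]/(3 + 6)%N -[(5 + 5)%N]/(4 + 6)%N !om.
rewrite !addnS !addn0.
case: (o y 0) (o y 1) (o y 2) (o y 3) (o y 4) (o y 5) => [] [] [] [] [] [] //=.
all: by case: (f y 0) (f y 1) (f y 2) (f y 3) (f y 4) (f y 5) => [] [] [] [] [] [] //=.
Qed.

Lemma flipping_neighbour : exists u, [/\ adj x u, s u = ~~ s x & ~~ stay s u].
Proof.
have xy : adj x (x.1 + 1, x.2) by rewrite adjE /= !eqxx.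
have [[k ok fk] _] := flip_bits xy; exists (nb k x (x.1 + 1, x.2)).
by split; rewrite ?adj_nb //; move: ok; rewrite /o; do 2 case: (s _).
Qed.

Lemma flipping_opposite u : adj x u -> s u = ~~ s x -> ~~ stay s u ->
  s (nb 3 x u) = ~~ s x /\ ~~ stay s (nb 3 x u).
Proof.
move=> xu su fu; have [_ /(_ _ fu)[|o3 f3]] := flip_bits xu.
  by rewrite /o /= -[nb 0 x u]/u su; case: (s x).
by split=> //; move: o3; rewrite /o; do 2 case: (s _).
Qed.
End FlippingLine.

(** * Evolution of the interface *)

Section FirstReturn.
Variable E : Type.

Definition first_return (I : E -> Prop) (N1 N0 : E -> E) (phi : E -> E) : Prop :=
  forall g, I g -> exists2 j, iter j.+1 N0 (phi g) = phi (N1 g) &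
    forall i, (i < j)%N -> forall g', I g' -> phi g' <> iter i.+1 N0 (phi g).

(** [t] lists the times at which the [N0]-orbit of [phi g] meets the image, obtained by summing the
    successive return times. *)
Lemma first_return_times I N1 N0 phi g :
  first_return I N1 N0 phi -> (forall e, I e -> I (N1 e)) -> I g ->
  exists t : nat -> nat, [/\ t 0%N = 0%N, (forall i, (t i < t i.+1)%N),
    (forall i, iter (t i) N0 (phi g) = phi (iter i N1 g)) &
    forall i l, (t i < l < t i.+1)%N -> forall g', I g' -> phi g' <> iter l N0 (phi g)].
Proof.
move=> FR IN Ig.
have Ii i : I (iter i N1 g) by elim: i => //= i; apply: IN.
have /choice[j Hj] : forall i, exists j, iter j.+1 N0 (phi (iter i N1 g)) = phi (iter i.+1 N1 g) /\
    forall l, (l < j)%N -> forall g', I g' -> phi g' <> iter l.+1 N0 (phi (iter i N1 g)).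
  by move=> i; have [j Hj Hj'] := FR _ (Ii i); exists j.
pose t i := (\sum_(k < i) (j k).+1)%N.
have tS i : t i.+1 = (t i + (j i).+1)%N by rewrite /t big_ord_recr.
have Ht i : iter (t i) N0 (phi g) = phi (iter i N1 g).
  elim: i => [|i IH]; first by rewrite /t big_ord0.
  by rewrite tS addnC iterD IH (Hj i).1.
exists t; split=> //.
- by rewrite /t big_ord0.
- by move=> i; rewrite tS; lia.
move=> i l /andP[l1 l2] g' Ig'.
have -> : l = ((l - t i).-1.+1 + t i)%N by lia.
rewrite iterD Ht; apply: (Hj i).2 => //.
by rewrite tS in l2; lia.
Qed.

(** A return to the smaller image takes [j.+1] returns to the larger one, hence time [t j.+1] for
    the innermost map. *)
Lemma first_return_comp I1 I2 N2 N1 N0 psi phi :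
  first_return I1 N1 N0 phi -> (forall e, I1 e -> I1 (N1 e)) ->
  (forall e f, I1 e -> I1 f -> phi e = phi f -> e = f) ->
  first_return I2 N2 N1 psi -> (forall e, I2 e -> I1 (psi e)) ->
  first_return I2 N2 N0 (phi \o psi).
Proof.
move=> FR1 IN1 inj FR2 I21 g Ig.
have [j Ej Hj] := FR2 _ Ig.
have [t [t0 tlt tE tgap]] := first_return_times FR1 IN1 (I21 _ Ig).
have tlt2 a b : (a < b)%N -> (t a < t b)%N.
  by elim: b => // b IH; rewrite ltnS leq_eqVlt => /predU1P[->//|/IH /ltn_trans]; apply.
exists (t j.+1).-1.
  have -> : (t j.+1).-1.+1 = t j.+1 by have := tlt j; lia.
  by rewrite /= tE Ej.
move=> i li g' Ig'; rewrite /comp => E'.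
(* An intermediate time is either some [t k], where injectivity of [phi] reduces to the gap of
   [psi], or strictly between two of them, where no image of [phi] occurs. *)
have ex : exists k, (i.+1 <= t k)%N by exists j.+1; lia.
case: (ex_minnP ex) => k Hk Hmin.
case: k Hk Hmin => [|k] Hk Hmin; first by rewrite t0 in Hk.
have lk : (t k < i.+1)%N by rewrite ltnNge; apply/negP => /Hmin; lia.
move: Hk; rewrite leq_eqVlt => /predU1P[Ei|li2].
  rewrite Ei tE in E'; have {}E' := inj _ _ (I21 _ Ig') _ E'.
  have kj : (k < j)%N.
    by case: (ltngtP k j) => // [jk|jk]; [have := tlt2 j.+1 k.+1 jk | rewrite jk in Ei]; lia.
  apply: (Hj k) kj _ Ig' _; apply: E'.
  by elim: (k.+1) => [|q] /=; [apply: I21 | apply: IN1].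
by apply: (tgap k i.+1) E'; rewrite ?lk ?li2 //; apply: I21.
Qed.

End FirstReturn.

Section Conn.
Variables (s : config) (U : edge -> Prop).

Definition conn (e f : edge) : Prop :=
  exists t, (f = iter t (nx s) e /\ forall i, (i <= t)%N -> U (iter i (nx s) e)) \/
            (e = iter t (nx s) f /\ forall i, (i <= t)%N -> U (iter i (nx s) f)).

Lemma conn_refl e : U e -> conn e e.
Proof. by move=> Ue; exists 0%N; left; split=> // -[]. Qed.

Lemma conn_sym e f : conn e f -> conn f e.
Proof. by case=> t [] H; exists t; [right|left]. Qed.

Lemma conn_nx e : U e -> U (nx s e) -> conn e (nx s e).
Proof. by move=> Ue Un; exists 1%N; left; split=> // -[|[]]. Qed.

Lemma iter_nx_inj t e f : iface s e -> iface s f ->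
  iter t (nx s) e = iter t (nx s) f -> e = f.
Proof.
move=> Ie If; elim: t => //= t IH E; apply: IH; apply: nx_inj E; exact: iface_iter.
Qed.

(** When the two pieces run in opposite directions they overlap, and injectivity of [nx] cancels the
    shorter one. *)
Lemma conn_trans f e h : iface s e -> iface s f -> iface s h ->
  conn e f -> conn f h -> conn e h.
Proof.
move=> Ie If Ih [t [] [E1 U1]] [r [] [E2 U2]].
- exists (r + t)%N; left; split; first by rewrite iterD -E1.
  move=> i le; case: (leqP i t) => [/U1//|lt].
  by rewrite -(subnK (ltnW lt)) iterD -E1; apply: U2; lia.
- case: (leqP t r) => tr.
  + exists (r - t)%N; right; split; last by move=> i le; apply: U2; lia.
    by apply: (@iter_nx_inj t) => //; rewrite ?iface_iter // -iterD subnKC // -E1.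
  + exists (t - r)%N; left; split; last by move=> i le; apply: U1; lia.
    apply: (@iter_nx_inj r) => //; rewrite ?iface_iter // -iterD subnKC -?E1 ?E2 //; lia.
- case: (leqP t r) => tr.
  + exists (r - t)%N; left; split; first by rewrite E1 -iterD subnK.
    by move=> i le; rewrite E1 -iterD; apply: U2; lia.
  + exists (t - r)%N; right; split; first by rewrite E2 -iterD subnK //; lia.
    by move=> i le; rewrite E2 -iterD; apply: U1; lia.
- exists (t + r)%N; right; split; first by rewrite iterD -E2.
  move=> i le; case: (leqP i r) => [/U2//|lt].
  by rewrite -(subnK (ltnW lt)) iterD -E2; apply: U1; lia.
Qed.

End Conn.

Section Dynamics.
Variable s0 : config.
Let sn n := sigma_n s0 n.

Definition stable (x : site) : Prop := forall n, sigma_n s0 n x = s0 x.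
Definition pin (e : edge) : Prop := stable e.1 /\ stable e.2.

Fixpoint phi (n : nat) (g : edge) : edge :=
  if n is m.+1 then phi m (psi (sigma_n s0 m) g) else g.

Lemma phi_iface n g : iface (sn n) g -> iface s0 (phi n g).
Proof. by elim: n g => //= n IH g H; apply: IH; apply: psi_iface. Qed.

Lemma phi_inj n e f : iface (sn n) e -> iface (sn n) f -> phi n e = phi n f -> e = f.
Proof.
elim: n e f => //= n IH e f He Hf E.
by apply: (@psi_inj (sn n)) => //; apply: IH E; apply: psi_iface.
Qed.

Lemma pin_iface n e : pin e -> iface (sn n) e = iface s0 e.
Proof. by case=> h1 h2; rewrite /iface /sn h1 h2. Qed.

Lemma stable_stay n x : stable x -> stay (sn n) x.
Proof. by move=> h; rewrite /stay /sn; have := h n.+1; rewrite /sigma_n /= => ->; rewrite -/(sigma_n s0 n) h. Qed.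

Lemma pin_phi n e : pin e -> iface s0 e -> phi n e = e.
Proof.
move=> pe Ie; elim: n => //= n IH.
have In : iface (sn n) e by rewrite pin_iface.
by have [_ ->] := psi_fix In (stable_stay n pe.1) (stable_stay n pe.2).
Qed.

Lemma phi_pin n g : iface (sn n) g -> pin (phi n g) -> phi n g = g.
Proof.
move=> Ig pg; have Ip := phi_iface Ig.
by apply: (@phi_inj n) => //; rewrite ?pin_iface // pin_phi.
Qed.

Lemma moving_unpin n e : moving (sn n) e -> ~ pin e.
Proof. by move=> /negP H [h1 h2]; apply: H; rewrite !stable_stay. Qed.

Lemma psi_unpin n g : iface (sn n.+1) g -> ~ pin g -> ~ pin (psi (sn n) g).
Proof.
move=> Ig npg pp; apply: npg.
have I1 := psi_iface Ig.
suff -> : g = psi (sn n) g by [].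
apply: (@psi_inj (sn n)) => //; first by rewrite -[step _]/(sn n.+1) pin_iface // -(pin_iface n).
by have [_ ->] // := @psi_fix (sn n) (psi (sn n) g) I1 (stable_stay n pp.1) (stable_stay n pp.2).
Qed.

Lemma phi_unpin n g : iface (sn n) g -> ~ pin g -> ~ pin (phi n g).
Proof. by move=> Ig npg pp; apply: npg; rewrite -(phi_pin Ig pp). Qed.

Lemma phi_first_return n :
  first_return (fun g => iface (sn n) g) (nx (sn n)) (nx s0) (phi n).
Proof.
elim: n => [|n IH].
  by move=> g Ig; exists 0%N.
apply: (first_return_comp IH) => [e|e f|g Ig|e].
- exact: iface_nx.
- exact: phi_inj.
- exact: psi_next.
- exact: psi_iface.
Qed.

(** Pinned interface edges are their own images, so everything jumped over by the first-return map
    is unpinned. *)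
Lemma nonimage_unpin n h : iface s0 h ->
  (forall g, iface (sn n) g -> phi n g <> h) -> ~ pin h.
Proof. by move=> Ih H ph; apply: (H h); rewrite ?pin_iface // pin_phi. Qed.

Let U e := ~ pin e.

Lemma phi_conn_nx n g : iface (sn n) g -> U g -> U (nx (sn n) g) ->
  conn s0 U (phi n g) (phi n (nx (sn n) g)).
Proof.
move=> Ig Ug Un; have [j Ej Hj] := phi_first_return Ig.
exists j.+1; left; split=> // -[|i] li; first exact: phi_unpin.
move: li; rewrite ltnS leq_eqVlt => /predU1P[->|li].
  by rewrite Ej; apply: phi_unpin => //; apply: iface_nx.
apply: (@nonimage_unpin n); last by apply: Hj.
by apply: iface_iter; apply: phi_iface.
Qed.

Lemma phi_conn n e f : iface (sn n) e -> iface (sn n) f ->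
  conn (sn n) U e f -> conn s0 U (phi n e) (phi n f).
Proof.
have H t g : iface (sn n) g -> (forall i, (i <= t)%N -> U (iter i (nx (sn n)) g)) ->
    conn s0 U (phi n g) (phi n (iter t (nx (sn n)) g)).
  move=> Ig; elim: t => [|t IH] HU.
    by apply: conn_refl; apply: phi_unpin => //; apply: (HU 0%N).
  have It := iface_iter t Ig.
  apply: (@conn_trans _ _ (phi n (iter t (nx (sn n)) g))).
  - exact: phi_iface.
  - exact: phi_iface.
  - by apply: phi_iface; apply: (iface_iter t.+1).
  - by apply: IH => i li; apply: HU; lia.
  - apply: phi_conn_nx => //; first exact: (HU t).
    exact: (HU t.+1).
by move=> Ie If [t [] [-> /H]] => [/(_ Ie)|/(_ If) /conn_sym].
Qed.

(* Every site of an interface edge at time [n] was visited, at time 0, by the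
   unpinned stretch of interface (ends included) that contains [phi n g]. *)
Lemma phi_sites n g x : iface (sn n) g -> U g -> has_site x g ->
  exists f h, [/\ iface s0 f, iface s0 h, conn s0 U (phi n g) f, has_site x h &
    [\/ h = f, h = nx s0 f | f = nx s0 h]].
Proof.
elim: n g => [|n IH] g Ig Ug xg.
  by exists g, g; split=> //; [apply: conn_refl | apply: Or31].
have I1 := psi_iface Ig; have U1 := psi_unpin Ig Ug.
case: (psi_sites Ig xg) => [|[f [m [If xf mm mp Hm]]]]; first exact: (IH _ I1 U1).
have Um := moving_unpin mm.
have Im : iface (sn n) m by case: Hm => [] [-> _]; apply: iface_nx.
have Cm : conn s0 U (phi n (psi (sn n) g)) (phi n m).
  apply: phi_conn => //; case: Hm => [] [E1 E2].
    by apply: conn_sym; rewrite E2; apply: conn_nx => //; rewrite -E2.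
  by rewrite E1; apply: conn_nx => //; rewrite -E1.
(* An unpinned [f] belongs to the stretch of [m], and induction applies to it. A pinned [f] ends the
   stretch: it is its own image, and the edges strictly between it and [phi n m] at time 0 are
   non-images, so the edge next to [f] lies in the stretch. *)
have [pf|Uf] := pselect (pin f); last first.
  have [f' [h' [If' Ih' Cf xh Hh]]] := IH _ If Uf xf.
  exists f', h'; split=> //.
  apply: (@conn_trans _ _ (phi n m)) => //; try exact: phi_iface.
  apply: (@conn_trans _ _ (phi n f)) => //; try exact: phi_iface.
  apply: phi_conn => //; case: Hm => [] [E1 E2].
    by apply: conn_sym; rewrite E1; apply: conn_nx => //; rewrite -E1.
  by rewrite E2; apply: conn_nx => //; rewrite -E2.
have If0 : iface s0 f by rewrite -(pin_iface n).
have Ef := pin_phi n pf If0.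
case: Hm => [] [E1 E2].
- have [j Ej Hj] := phi_first_return If; rewrite Ef -E1 in Ej Hj.
  exists (nx s0 f), f; split=> //; first exact: iface_nx.
    apply: (@conn_trans _ _ (phi n m)) => //; try exact: phi_iface.
      exact: iface_nx.
    exists j; right; split; first by rewrite -Ej iterSr.
    move=> i li; rewrite -iterSr.
    move: li; rewrite leq_eqVlt => /predU1P[->|li].
      by rewrite Ej; apply: phi_unpin.
    by apply: (@nonimage_unpin n); [apply: iface_iter | apply: Hj].
  exact: Or33.
- have [j Ej Hj] := phi_first_return Im; rewrite -E2 Ef in Ej.
  have If' : iface s0 (iter j (nx s0) (phi n m)) by apply: iface_iter; apply: phi_iface.
  exists (iter j (nx s0) (phi n m)), f; split=> //.
    apply: (@conn_trans _ _ (phi n m)) => //; try exact: phi_iface.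
    exists j; left; split=> // -[|i] li; first exact: phi_unpin.
    by apply: (@nonimage_unpin n); [apply: iface_iter; apply: phi_iface | apply: Hj].
  by apply: Or32; rewrite -Ej.
Qed.

End Dynamics.

(** * Lattice distances and boxes *)

Definition dist1 (x y : site) : nat := (`|x.1 - y.1| + `|x.2 - y.2|)%N.
Definition norm1 (x : site) : nat := (`|x.1| + `|x.2|)%N.

Lemma dist1C x y : dist1 x y = dist1 y x.
Proof. by rewrite /dist1; lia. Qed.

Lemma dist1_tri y x z : (dist1 x z <= dist1 x y + dist1 y z)%N.
Proof. by rewrite /dist1; lia. Qed.

Lemma dist1xx x : dist1 x x = 0%N.
Proof. by rewrite /dist1; lia. Qed.

Lemma norm1_le x y : (norm1 x <= norm1 y + dist1 x y)%N.
Proof. by rewrite /dist1 /norm1; lia. Qed.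

Lemma adj_dist1 x y : adj x y -> (dist1 x y <= 2)%N.
Proof. by rewrite adjE /dist1; lia. Qed.

Lemma line_dist1 x u k : adj x u ->
  (k <= dist1 x (x.1 + k%:Z * (u.1 - x.1), x.2 + k%:Z * (u.2 - x.2))%R)%N.
Proof.
by rewrite adjE /dist1 /=; do 5 ?[case/orP]; case/andP => /eqP -> /eqP ->; lia.
Qed.

Lemma has_site_dist1 s e x : iface s e -> has_site x e -> (dist1 e.1 x <= 2)%N.
Proof.
case/and3P => ae _ _ /orP[/eqP ->|/eqP ->]; first by rewrite dist1xx.
exact: adj_dist1.
Qed.

Lemma nx_dist1 s e : iface s e -> (dist1 e.1 (nx s e).1 <= 2)%N.
Proof.
case/and3P => ae _ _; rewrite /nx; case: ifP => _ /=; last by rewrite dist1xx.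
by apply: adj_dist1; rewrite adj_turn.
Qed.

Lemma eventually_all (T : eqType) (P : nat -> T -> Prop) (l : seq T) :
  (forall h, h \in l -> exists n0, forall n, (n0 <= n)%N -> P n h) ->
  exists n0, forall n, (n0 <= n)%N -> forall h, h \in l -> P n h.
Proof.
elim: l => [|a l IH] H; first by exists 0%N.
have [n1 H1] := IH (fun h hl => H h (@mem_behead _ (a :: l) h hl)).
have [n2 H2] := H a (mem_head _ _).
exists (maxn n1 n2) => n; rewrite geq_max => /andP[l1 l2] h; rewrite inE => /predU1P[->|hl].
  exact: H2.
exact: H1.
Qed.

Definition box (r : nat) : seq site :=
  [seq (i%:Z - r%:Z, j%:Z - r%:Z) | i <- iota 0 (2 * r).+1, j <- iota 0 (2 * r).+1].

Lemma mem_box r x : (norm1 x <= r)%N -> x \in box r.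
Proof.
case: x => x1 x2; rewrite /norm1 /= => H.
apply/allpairsP; exists (absz (x1 + r%:Z), absz (x2 + r%:Z)); split=> [||/=]; rewrite ?mem_iota ?[_.1]/= ?[_.2]/=; try lia.
by apply: site_eq => /=; lia.
Qed.

(** * Confined interfaces: displacement bounds and stabilisation of spins *)

Section Confined.
Variables (s0 : config) (m C : nat).

Definition confined : Prop := forall h, iface s0 h -> forall t,
  (forall i, (i <= t)%N -> ~ pin s0 (iter i (nx s0) h)) ->
  (m * dist1 (iter t (nx s0) h).1 h.1 <= norm1 h.1 + C)%N.

Hypothesis m4 : (4 <= m)%N.
Hypothesis conf : confined.

Let sn n := sigma_n s0 n.
Let U e := ~ pin s0 e.

(** The factor 2 serves the case of a stretch running from [f] to [e]: [norm1 f.1] is at most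
    [norm1 e.1] plus the distance, which is absorbed on the left as [m] is at least 4. *)
Lemma conn_dist e f : iface s0 e -> iface s0 f -> conn s0 U e f ->
  (m * dist1 e.1 f.1 <= 2 * norm1 e.1 + 2 * C)%N.
Proof.
move=> Ie If [t [] [-> HU]].
  by have := conf Ie HU; rewrite dist1C; lia.
have := conf If HU; set d := dist1 _ _ => H.
have := norm1_le f.1 (iter t (nx s0) f).1; rewrite dist1C -/d => H2.
by nia.
Qed.

Lemma phi_dist n g x : iface (sn n) g -> has_site x g ->
  (m * dist1 (phi s0 n g).1 x <= 2 * norm1 (phi s0 n g).1 + 2 * C + 4 * m)%N.
Proof.
move=> Ig xg; have [pg|Ug] := pselect (pin s0 g).
  have Ig0 : iface s0 g by rewrite -(pin_iface n).
  by rewrite pin_phi //; have := has_site_dist1 Ig xg; nia.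
have [f [h [If Ih Cf xh Hh]]] := phi_sites Ig Ug xg.
have := conn_dist (phi_iface Ig) If Cf.
have := has_site_dist1 Ih xh.
have : (dist1 f.1 h.1 <= 2)%N.
  case: Hh => [->|->|->]; first by rewrite dist1xx.
    exact: nx_dist1 If.
  by rewrite dist1C; exact: nx_dist1 Ih.
have := dist1_tri f.1 (phi s0 n g).1 x; have := dist1_tri h.1 f.1 x.
by nia.
Qed.

(** Replacing the norm of the image by that of [x] costs one distance, absorbed since [m] is at
    least 4. The bound does not depend on [n]. *)
Lemma phi_dist_site n g x : iface (sn n) g -> has_site x g ->
  (dist1 (phi s0 n g).1 x <= norm1 x + C + 8)%N.
Proof.
move=> Ig xg; have := phi_dist Ig xg; have := norm1_le (phi s0 n g).1 x.
by set d := dist1 _ _ => H1 H2; nia.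
Qed.

Definition in_image n h := exists2 g, iface (sn n) g & phi s0 n g = h.

Lemma image_anti n h : in_image n.+1 h -> in_image n h.
Proof. by case=> g Ig <-; exists (psi (sn n) g) => //; apply: psi_iface. Qed.

(** The images decrease with [n], so each of the finitely many edges near the origin leaves them at
    most once. *)
Lemma image_stabilises r : exists n0, forall n, (n0 <= n)%N ->
  forall h, iface s0 h -> (norm1 h.1 <= r)%N -> in_image n h -> in_image n.+1 h.
Proof.
pose l := [seq (x, y) | x <- box r, y <- box (r + 2)].
have [h _|n0 H] := @eventually_all _ (fun n h => in_image n h -> in_image n.+1 h) l.
  have [all|/existsNP[n1 Hn1]] := pselect (forall n, in_image n h).
    by exists 0%N.
  exists n1 => n ln Hn; case: Hn1; elim: n ln Hn => [|n IH].
    by rewrite leqn0 => /eqP ->.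
  by rewrite leq_eqVlt => /predU1P[->//|]; rewrite ltnS => /IH H /image_anti.
exists n0 => n ln h Ih hr; apply: H => //.
have := norm1_le h.2 h.1; rewrite dist1C => H2.
case/and3P: Ih => /adj_dist1 H3 _ _.
case: h hr H2 H3 => x y /= hr H2 H3; apply/allpairsP; exists (x, y).
by split=> //=; apply: mem_box => //; lia.
Qed.

Lemma edge_at_iface s x u : adj x u -> s u = ~~ s x -> iface s (edge_at s x u).
Proof. by rewrite /edge_at /iface => xu su; case: ifP => sx; rewrite /= ?xu ?su ?sx // adj_sym xu. Qed.

Lemma arc_conn n x w : ~~ stay (sn n) x -> adj x w ->
  sn n w = ~~ sn n x -> sn n (turn x w) = ~~ sn n x ->
  conn (sn n) U (edge_at (sn n) x w) (edge_at (sn n) x (turn x w)).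
Proof.
move=> fx xw sw st.
have Ux v : U (edge_at (sn n) x v).
  rewrite /edge_at; case: ifP => _ [] /= /(stable_stay n) h1 /(stable_stay n) h2.
    by move: fx; rewrite -/(sn n) in h1; rewrite h1.
  by move: fx; rewrite h2.
case sx : (sn n x) (Ux w) (Ux (turn x w)) => Uw Ut.
  have E : edge_at (sn n) x (turn x w) = nx (sn n) (edge_at (sn n) x w).
    by rewrite /edge_at sx /nx /= st sx.
  by rewrite E; apply: conn_nx; rewrite -?E.
have E : edge_at (sn n) x w = nx (sn n) (edge_at (sn n) x (turn x w)).
  rewrite /edge_at sx /nx /=.
  by rewrite turn_forth sw sx.
by rewrite E; apply: conn_sym; apply: conn_nx; rewrite -?E.
Qed.

(** No two non-adjacent neighbours agree with [x], so one of the two arcs from [u] to the site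
    across is entirely opposite. The interface follows it around [x], unpinned because [x] flips. *)
Lemma opposite_conn n x u : ~~ stay (sn n) x -> adj x u ->
  sn n u = ~~ sn n x -> sn n (nb 3 x u) = ~~ sn n x ->
  conn (sn n) U (edge_at (sn n) x u) (edge_at (sn n) x (nb 3 x u)).
Proof.
move=> fx xu s0u s3u.
have arcs v : adj x v -> sn n v = ~~ sn n x -> sn n (nb 1 x v) = ~~ sn n x ->
    sn n (nb 2 x v) = ~~ sn n x -> sn n (nb 3 x v) = ~~ sn n x ->
    conn (sn n) U (edge_at (sn n) x v) (edge_at (sn n) x (nb 3 x v)).
  move=> xv h0 h1 h2 h3.
  have Ik k : sn n (nb k x v) = ~~ sn n x -> iface (sn n) (edge_at (sn n) x (nb k x v)).
    by apply: edge_at_iface; rewrite adj_nb.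
  apply: (@conn_trans _ _ (edge_at (sn n) x (nb 1 x v))); try exact: Ik.
  - exact: (Ik 0%N).
  - exact: arc_conn.
  apply: (@conn_trans _ _ (edge_at (sn n) x (nb 2 x v))); try exact: Ik.
  - by apply: arc_conn => //; rewrite adj_nb.
  by apply: arc_conn => //; rewrite adj_nb.
have := fx; rewrite (stayE _ xu) /stays -[nb 0 x u]/u s0u s3u => H.
have [[h1 h2]|[h4 h5]] : (sn n (nb 1 x u) = ~~ sn n x /\ sn n (nb 2 x u) = ~~ sn n x) \/
    (sn n (nb 4 x u) = ~~ sn n x /\ sn n (nb 5 x u) = ~~ sn n x).
  move: H; case: (sn n x); case: (sn n (nb 1 x u)); case: (sn n (nb 2 x u));
    case: (sn n (nb 4 x u)); case: (sn n (nb 5 x u)) => //=; by [left | right].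
- exact: arcs.
- apply: conn_sym; have := arcs (nb 3 x u); rewrite adj_nb !nb_nb (nb_mod 0); apply => //.
Qed.

(* Once the images are stable, a flipping site starts an alternating line of flipping
   sites; [K] exceeds the diameter of its unpinned stretch. *)
Lemma flips_stop x : exists n0, forall n, (n0 <= n)%N -> stay (sn n) x.
Proof.
pose A := (2 * norm1 x + C + 8)%N.
(* The three summands bound the distances from [x] to the image of [e 0], from there to the image of
   [e K], and from that to [L K]; one more gives the contradiction. *)
pose K := ((norm1 x + C + 8) + (A + C) + (A + C + 4)).+1%N.
(* Sites of the line up to index [K.+1] have norm at most [norm1 x + 2 * K + 2], and by
   [phi_dist_site] the images of edges at such a site lie within the radius used here. *)
have [n0 Hn0] := image_stabilises (2 * (norm1 x + 2 * K + 2) + C + 8).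
exists n0 => n ln; apply/negPn/negP => fx.
have im y : (norm1 y <= norm1 x + 2 * K + 2)%N -> forall u, adj y u -> sn n u = ~~ sn n y ->
    exists2 g, iface (step (sn n)) g & psi (sn n) g = edge_at (sn n) y u.
  move=> Ny u yu su; have Ie := edge_at_iface yu su.
  have ye : has_site y (edge_at (sn n) y u).
    by rewrite /has_site /edge_at; case: ifP; rewrite eqxx ?orbT.
  have H1 := phi_dist_site Ie ye.
  have H2 := norm1_le (phi s0 n (edge_at (sn n) y u)).1 y.
  have [|||g Ig Eg] := Hn0 n ln (phi s0 n (edge_at (sn n) y u)).
  - exact: phi_iface.
  - by lia.
  - by exists (edge_at (sn n) y u).
  exists g => //; apply: (@phi_inj s0 n) => //; exact: psi_iface.
have [|u [xu su fu]] := flipping_neighbour fx (im x _); first by lia.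
pose L (k : nat) : site := (x.1 + k%:Z * (u.1 - x.1), x.2 + k%:Z * (u.2 - x.2)).
have LN k : (k <= K.+1)%N -> (norm1 (L k) <= norm1 x + 2 * K + 2)%N.
  move: xu; rewrite adjE /norm1 /L /=; do 5 ?[case/orP]; case/andP => /eqP -> /eqP -> lk; lia.
have Ladj k : adj (L k.+1) (L k).
  move: xu; rewrite !adjE /L /=; do 5 ?[case/orP]; case/andP => /eqP -> /eqP ->; lia.
have L3 k : nb 3 (L k.+1) (L k) = L k.+2.
  by apply: site_eq; rewrite /nb /turn /L /= ; lia.
have L0 : L 0%N = x by apply: site_eq; rewrite /L /=; lia.
have L1 : L 1%N = u by apply: site_eq; rewrite /L /=; lia.
have flip k : (k <= K)%N -> [/\ ~~ stay (sn n) (L k), ~~ stay (sn n) (L k.+1) &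
    sn n (L k) = ~~ sn n (L k.+1)].
  elim: k => [|k IH] lk; first by rewrite L0 L1 su negbK.
  have [|f0 f1 s1] := IH; first by lia.
  have [|s2 f2] := flipping_opposite f1 (im (L k.+1) _) (Ladj k) s1 f0.
    by apply: LN; lia.
  by rewrite L3 in s2 f2; rewrite s2 negbK.
pose e k := edge_at (sn n) (L k.+1) (L k).
have Ie k : (k <= K)%N -> iface (sn n) (e k).
  by move=> /flip[_ _ H]; apply: edge_at_iface.
have eE k : (k <= K)%N -> e k = edge_at (sn n) (L k) (L k.+1).
  by move=> /flip[_ _ H]; rewrite /e /edge_at H; case: (sn n _).
have Ce k : (k <= K)%N -> conn (sn n) U (e 0%N) (e k).
  elim: k => [|k IH] lk.
    apply: conn_refl => -[/(stable_stay n) h1 /(stable_stay n) h2].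
    by move: h1 h2 fx fu; rewrite /e /edge_at L0 L1; case: ifP => _ /= -> ->.
  apply: (@conn_trans _ _ (e k)); try by apply: Ie; lia.
    by apply: IH; lia.
  have [f1 f2 s12] := flip _ lk; have [|_ _ s01] := flip k; first by lia.
  rewrite (eE k.+1) // /e -L3; apply: opposite_conn => //.
  by rewrite L3 s12 negbK.
have C0 := phi_conn (Ie 0%N isT) (Ie K (leqnn _)) (Ce K (leqnn _)).
have I0 := Ie 0%N isT; have IK := Ie K (leqnn _).
have x0 : has_site x (e 0%N).
  by rewrite /has_site /e /edge_at L0; case: ifP; rewrite eqxx ?orbT.
have xK : has_site (L K) (e K).
  by rewrite /has_site /e /edge_at; case: ifP; rewrite eqxx ?orbT.
have d0 := phi_dist_site I0 x0.
have dK := phi_dist IK xK.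
have dC := conn_dist (phi_iface I0) (phi_iface IK) C0.
have n0' := norm1_le (phi s0 n (e 0%N)).1 x.
have nK := norm1_le (phi s0 n (e K)).1 (phi s0 n (e 0%N)).1.
have t1 := dist1_tri (phi s0 n (e 0%N)).1 x (L K).
have t2 := dist1_tri (phi s0 n (e K)).1 (phi s0 n (e 0%N)).1 (L K).
have lK : (K <= dist1 x (L K))%N by apply: line_dist1.
rewrite (dist1C x (phi s0 n (e 0%N)).1) in t1; rewrite (dist1C (phi s0 n (e K)).1 (phi s0 n (e 0%N)).1) in nK.
set a := dist1 (phi s0 n (e 0%N)).1 x in d0 n0' t1.
set b := dist1 (phi s0 n (e 0%N)).1 (phi s0 n (e K)).1 in dC nK t2.
set c := dist1 (phi s0 n (e K)).1 (L K) in dK t2.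
have mb : (4 * b <= m * b)%N by rewrite leq_mul2r m4 orbT.
have mc : (4 * (c - 4) <= m * (c - 4))%N by rewrite leq_mul2r m4 orbT.
rewrite mulnBr in mc.
have bA : (b <= A + C)%N by move: mb dC n0' d0; rewrite /A; clear; lia.
have cA : (c <= A + C + 4)%N by move: mc dK nK bA n0' d0; rewrite /A; clear; lia.
have KE : K = ((norm1 x + C + 8) + (A + C) + (A + C + 4)).+1%N by [].
by move: KE lK t1 t2 bA cA d0; clear; lia.
Qed.

Lemma sigma_inf_eventually x : exists n0, forall n, (n0 <= n)%N -> sigma_inf s0 x = sn n x.
Proof.
have [n0 H] := flips_stop x; exists n0 => n ln.
have E k : sn (n0 + k) x = sn n0 x.
  elim: k => [|k IH]; first by rewrite addn0.
  by rewrite addnS -IH; apply/eqP; apply: H; lia.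
have En : sn n x = sn n0 x by rewrite -(subnKC ln) E.
rewrite /sigma_inf En; apply/asboolP/idP => [[N HN]|h].
  by rewrite -(E N) /sn HN //; lia.
by exists n0 => k lk; rewrite -/(sn k) -(subnKC lk) E.
Qed.

End Confined.

(** * Pinning is frequent *)

(** Each site of a monochromatic ring has two agreeing, mutually non-adjacent neighbours on the
    ring, so the whole ring persists by induction on time. *)
Lemma ring_stable s c y v : adj c y -> (forall k, s (nb k c y) = v) ->
  forall k, stable s (nb k c y).
Proof.
move=> cy H; suff K n k : sigma_n s n (nb k c y) = v by move=> k n; rewrite K H.
elim: n k => [|n IH] k; first exact: H.
suff /eqP : stay (sigma_n s n) (nb k c y) by rewrite -[step _ _]/(sigma_n s n.+1 _) => ->.
by apply: (@stay_between _ c); rewrite ?adj_nb // nb_nb !IH.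
Qed.

Lemma ring_stable6 s c y v : adj c y ->
  [/\ s y = v, s (nb 1 c y) = v, s (nb 2 c y) = v, s (nb 3 c y) = v & s (nb 4 c y) = v] ->
  s (nb 5 c y) = v -> stable s y.
Proof.
move=> cy [h0 h1 h2 h3 h4] h5; apply: (@ring_stable _ c y v cy _ 0%N) => k.
rewrite (divn_eq k 6); have : (k %% 6 < 6)%N by rewrite ltn_mod.
have E i j : nb (i * 6 + j) c y = nb j c y.
  by elim: i => // i IH; rewrite mulSn -addnA addnC nb_mod IH.
by rewrite E; case: (k %% 6)%N => [|[|[|[|[|[|]]]]]].
Qed.

(* In coordinates relative to an edge [(a, b)] whose head is [(0, 1)]: the hexagon
   of + around [(-1, 2)], the hexagon of - around [(2, 2)], and the steering site
   [(1, 1)]; they force the interface through the pinned edge [((0, 2), (1, 2))]. *)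
Definition pattern : seq (site * bool) :=
  [:: ((0, 1), true); ((1, 1), false); ((0, 2), true); ((1, 2), false);
      ((-1, 1), true); ((-2, 2), true); ((-2, 3), true); ((-1, 3), true);
      ((3, 2), false); ((2, 3), false); ((2, 1), false); ((3, 1), false); ((1, 3), false)].

Definition pattern_at (a b : site) : seq (site * bool) :=
  [seq (emb a b p.1, p.2) | p <- pattern].

Definition pinned_edge (a b : site) : edge := (emb a b (0, 2), emb a b (1, 2)).

Definition cyl (l : seq (site * bool)) (s : config) : Prop :=
  forall p, p \in l -> s p.1 = p.2.

Lemma emb_adj a b x y : adj a b -> adj x y -> adj (emb a b x) (emb a b y).
Proof.
move=> ab xy; have [k _ ->] : exists2 k, (k < 6)%N & y = nb k x (x.1 + 1, x.2).
  by apply: adj_nbP => //; rewrite adjE /= !eqxx.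
rewrite emb_nb adj_nb; move: ab; rewrite !adjE /emb /=; nia.
Qed.

Section Pattern.
Variables (a b : site) (s : config).
Hypotheses (ab : adj a b) (cs : cyl (pattern_at a b) s).

Lemma pattern_val p : p \in pattern -> s (emb a b p.1) = p.2.
Proof. by move=> pp; apply: (cs (p := (emb a b p.1, p.2))); apply/mapP; exists p. Qed.

Lemma pattern_pinned : iface s (pinned_edge a b) /\ pin s (pinned_edge a b).
Proof.
have V x v : (x, v) \in pattern -> s (emb a b x) = v by apply: (pattern_val (p := (x, v))).
split; first by rewrite /iface /= (V _ true) // (V _ false) // emb_adj.
split=> /=.
  apply: (@ring_stable6 _ (emb a b (-1, 2)) _ true); rewrite ?emb_adj //; last by rewrite -emb_nb (V _ true).
  by split; rewrite -?emb_nb (V _ true).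
apply: (@ring_stable6 _ (emb a b (2, 2)) _ false); rewrite ?emb_adj //; last by rewrite -emb_nb (V _ false).
by split; rewrite -?emb_nb (V _ false).
Qed.

Lemma pattern_walk : [/\ nx s (a, b) = (emb a b (0, 1), b),
  iter 2 (nx s) (a, b) = (emb a b (0, 1), emb a b (1, 1)),
  iter 3 (nx s) (a, b) = (emb a b (0, 2), emb a b (1, 1)) &
  iter 4 (nx s) (a, b) = pinned_edge a b].
Proof.
have V x v : (x, v) \in pattern -> s (emb a b x) = v by apply: (pattern_val (p := (x, v))).
have E1 : nx s (a, b) = (emb a b (0, 1), b).
  by rewrite /nx /= -(emb_oz a b) (V _ true).
have E2 : nx s (emb a b (0, 1), b) = (emb a b (0, 1), emb a b (1, 1)).
  have H : turn (emb a b (0, 1)) b = emb a b (1, 1).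
    by apply: site_eq; rewrite /emb /turn /=; lia.
  by rewrite /nx /= H (V _ false).
have E3 : nx s (emb a b (0, 1), emb a b (1, 1)) = (emb a b (0, 2), emb a b (1, 1)).
  by rewrite /nx /= -emb_turn (V _ true).
have E4 : nx s (emb a b (0, 2), emb a b (1, 1)) = pinned_edge a b.
  by rewrite /nx /= -emb_turn (V _ false).
by rewrite /= E1 E2 E3 E4.
Qed.
End Pattern.

Lemma emb_inj a b x y : adj a b -> emb a b x = emb a b y -> x = y.
Proof.
case: x y => x1 x2 [y1 y2]; rewrite adjE /emb /= => ab [].
by move: ab; do 5 ?[case/orP]; case/andP => /eqP -> /eqP -> h1 h2; apply: site_eq => /=; lia.
Qed.

Lemma pattern_at_uniq a b : adj a b -> uniq (unzip1 (pattern_at a b)).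
Proof.
move=> ab; have -> : unzip1 (pattern_at a b) = map (emb a b) (unzip1 pattern).
  by rewrite /unzip1 -!map_comp.
by rewrite map_inj_uniq // => x y; apply: emb_inj.
Qed.

Lemma size_pattern_at a b : size (pattern_at a b) = 13%N.
Proof. by rewrite size_map. Qed.

(* [Cov A l w]: querying finitely many further spins adaptively, [A] can be
   enclosed, given the spins recorded in [l], in an event of conditional
   probability at most [w]. *)
Inductive Cov (R : realType) (A : config -> Prop) : seq (site * bool) -> R -> Prop :=
| Cov_all l w : 1 <= w -> Cov A l w
| Cov_none l w : 0 <= w -> (forall s, cyl l s -> ~ A s) -> Cov A l w
| Cov_split l z w1 w2 w : z \notin unzip1 l -> Cov A ((z, true) :: l) w1 ->
    Cov A ((z, false) :: l) w2 -> (w1 + w2) / 2 <= w -> Cov A l w.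

Section Cover.
Variable R : realType.
Implicit Types (A B : config -> Prop) (l : seq (site * bool)) (w : R).

Lemma cyl_cons p l s : cyl (p :: l) s <-> s p.1 = p.2 /\ cyl l s.
Proof.
split=> [H|[H1 H2] q]; first by split=> [|q ql]; apply: H; rewrite inE ?eqxx ?ql ?orbT.
by rewrite inE => /predU1P[->//|/H2].
Qed.

Lemma Cov_sub A B l w : (forall s, cyl l s -> B s -> A s) -> Cov A l w -> Cov B l w.
Proof.
move=> + H; elim: H => {l w} [l w H|l w w0 H|l z w1 w2 w zl _ IH1 _ IH2 ww] AB.
- exact: Cov_all.
- by apply: Cov_none => // s cs /(AB _ cs); apply: H.
- by apply: (Cov_split zl _ _ ww); [apply: IH1|apply: IH2] => s /cyl_cons[_ cs]; apply: AB.
Qed.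

(** Query the sites of [pl] one by one: the first mismatch leaves the bound [w], while a complete
    match, of conditional probability [2^-1 ^+ size pl], excludes [A]. *)
Lemma Cov_block A w pl l : 0 <= w -> uniq (unzip1 pl) ->
  (forall x, x \in unzip1 pl -> x \notin unzip1 l) ->
  (forall l', {subset l <= l'} -> {subset unzip1 l' <= unzip1 pl ++ unzip1 l} -> Cov A l' w) ->
  (forall s, cyl l s -> cyl pl s -> ~ A s) ->
  Cov A l ((1 - 2^-1 ^+ size pl) * w).
Proof.
move=> w0; elim: pl l => [|[z v] pl IH] l.
  move=> _ _ _ H; apply: Cov_none; first by rewrite expr0 subrr mul0r.
  by move=> s cs; apply: H.
rewrite /= => /andP[zpl upl] dis fail succ.
have zl : z \notin unzip1 l by apply: dis; rewrite mem_head.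
have Hv : Cov A ((z, v) :: l) ((1 - 2^-1 ^+ size pl) * w).
  apply: IH => // [x xpl|l' sub sub'|s /cyl_cons[h1 h2] h3].
  - by rewrite inE negb_or dis ?inE ?xpl ?orbT // andbT; apply: contraNneq zpl => /= <-.
  - apply: fail => [x xl|x /sub']; first by apply: sub; rewrite inE xl orbT.
    by rewrite !mem_cat !inE mem_cat => /or3P[->|->|->]; rewrite ?orbT.
  - by apply: succ => //; apply/cyl_cons.
have Hnv : Cov A ((z, ~~ v) :: l) w.
  apply: fail => [x xl|x]; first by rewrite inE xl orbT.
  by rewrite /= !inE mem_cat => /orP[->|->]; rewrite ?orbT.
case: v Hv Hnv succ => Hv Hnv succ; apply: (Cov_split zl); [exact: Hv|exact: Hnv| |exact: Hnv|exact: Hv|];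
  by rewrite exprS; lra.
Qed.

Definition dirs : seq (int * int) := [:: (1, 0); (-1, 0); (0, 1); (0, -1)].
Definition lev (d : int * int) (x : site) : int := d.1 * x.1 + d.2 * x.2.

Lemma lev_emb d a b v :
  lev d (emb a b v) = lev d a + v.1 * (lev d b - lev d a) + v.2 * (lev d (turn a b) - lev d a).
Proof. by rewrite /lev /emb /turn /=; ring. Qed.

(** The vertices of a triangle take exactly two consecutive levels in a coordinate direction. *)
Lemma lev_record d a b L : d \in dirs -> adj a b -> lev d a <= L -> lev d b <= L ->
  L < lev d (turn a b) -> [/\ lev d a = L, lev d b = L & lev d (turn a b) = L + 1].
Proof.
case: d => d1 d2; rewrite !inE !xpair_eqE /= adjE /lev /turn /=.
by do 3 ?[case/orP]; case/andP => /eqP -> /eqP -> ab *; split; lia.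
Qed.

(** The horizon [T] keeps the exploration finite; it is removed later by an increasing union. *)
Definition escapes (d : int * int) (T : nat) (e : edge) (H : int) (s : config) : Prop :=
  exists2 t, (t <= T)%N & H <= lev d (iter t (nx s) e).1 /\
    forall i, (i <= t)%N -> ~ pin s (iter i (nx s) e).

(* [pattern] has 13 sites. *)
Definition missp : R := 1 - 2^-1 ^+ 13.

Lemma missp_ge0 : 0 <= missp.
Proof. by rewrite /missp subr_ge0 exprn_ile1 // ?invr_ge0 ?invf_le1 ?ler1n. Qed.

(* Sites above the record level [L] have not been queried. *)
Lemma escapes_cov d T k l a b L H : d \in dirs -> adj a b ->
  (a, true) \in l -> (b, false) \in l ->
  (forall x, x \in unzip1 l -> lev d x <= L) -> L + (3 * k)%:Z < H ->
  Cov (escapes d T (a, b) H) l (missp ^+ k).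
Proof.
move=> dd; elim: T k l a b L => [|T IH] k l a b L ab al bl lL LH.
all: case: k LH => [|k] LH; first by apply: Cov_all; rewrite expr0.
all: have La : lev d a <= L by apply: lL; apply/mapP; exists (a, true).
all: have Lb : lev d b <= L by apply: lL; apply/mapP; exists (b, false).
  apply: Cov_none => [|s cs [t]]; first by rewrite exprn_ge0 // missp_ge0.
  by rewrite leqn0 => /eqP -> /= [h _]; lia.
have shift s : escapes d T.+1 (a, b) H s -> escapes d T (nx s (a, b)) H s.
  case=> -[|t] lt [h1 h2]; first by move: h1 => /=; lia.
  exists t => //; split; first by rewrite -iterSr.
  by move=> i li; rewrite -iterSr; apply: h2.
(* Once the spin ahead is recorded the next edge is determined, and the induction on [T] applies
   there. *)
have known k' l' L' : {subset l <= l'} -> turn a b \in unzip1 l' ->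
    (forall x, x \in unzip1 l' -> lev d x <= L') -> L' + (3 * k')%:Z < H ->
    Cov (escapes d T.+1 (a, b) H) l' (missp ^+ k').
  move=> sub /mapP[[z v] zl /= zE] lL' LH'; subst z.
  have nxE s : cyl l' s -> nx s (a, b) = if v then (turn a b, b) else (a, turn a b).
    by move=> cs; rewrite /nx /= (cs _ zl).
  apply: (@Cov_sub (escapes d T (if v then (turn a b, b) else (a, turn a b)) H)).
    by move=> s cs /shift; rewrite nxE.
  case: v zl nxE => zl nxE; apply: (IH _ _ _ _ L') => //; try exact: sub.
    by rewrite adj_sym adj_turn2.
  by rewrite adj_turn.
have [zl|zl] := boolP (turn a b \in unzip1 l); first exact: (known _ _ L).
have [zL|Lz] := lerP (lev d (turn a b)) L.
  apply: (@Cov_split _ _ _ (turn a b) (missp ^+ k.+1) (missp ^+ k.+1)) => //; last by lra.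
    apply: (known _ _ L) => // [x xl|/=|x]; rewrite ?inE ?xl ?orbT ?eqxx //.
    by case/predU1P => [->//|/lL].
  apply: (known _ _ L) => // [x xl|/=|x]; rewrite ?inE ?xl ?orbT ?eqxx //.
  by case/predU1P => [->//|/lL].
have [aL bL zL] := lev_record dd ab La Lb Lz.
(* The pattern lies strictly above the record, hence is fresh, and within three levels of it: each
   attempt uses up three levels. *)
have patL x : x \in unzip1 (pattern_at a b) -> L < lev d x <= L + 3.
  case/mapP => p /mapP[p' p'P ->] -> /=; rewrite lev_emb aL bL zL.
  by move: p'P; rewrite !inE; do 12 ?[case/predU1P => [->|]] => [||||||||||||/eqP->] /=; lia.
have upat := pattern_at_uniq ab.
have LH3 : L + 3 + (3 * k)%:Z < H by move: LH; lia.
have z1 : emb a b (0, 1) = turn a b by rewrite -[RHS](emb_oz a b).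
pose tail := behead (pattern_at a b).
have patE : pattern_at a b = (turn a b, true) :: tail by rewrite -z1.
have utail : uniq (unzip1 tail) by move: upat; rewrite patE /= => /andP[].
have zt : turn a b \notin unzip1 tail by move: upat; rewrite patE /= => /andP[].
(* The site ahead is queried before the other twelve, so that the walk can be resumed with [known]
   wherever the pattern fails. *)
apply: (@Cov_split _ _ _ (turn a b) ((1 - 2^-1 ^+ 12) * missp ^+ k) (missp ^+ k)) => //.
- rewrite -[12%N]/(size tail); apply: Cov_block => // [|x xt|l' sub sub'|s cs ct].
  + by rewrite exprn_ge0 // missp_ge0.
  + rewrite inE negb_or; apply/andP; split; first by apply: contraNneq zt => /= <-.
    apply/negP => /lL; have /patL : x \in unzip1 (pattern_at a b) by rewrite patE inE xt orbT.
    by lia.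
  + apply: (known _ _ (L + 3)) => // [x xl|/=|x /sub'].
    * by apply: sub; rewrite inE xl orbT.
    * by apply/mapP; exists (turn a b, true) => //; apply: sub; rewrite mem_head.
    * rewrite mem_cat => /orP[xt|].
        have /patL : x \in unzip1 (pattern_at a b) by rewrite patE inE xt orbT.
        by lia.
      by rewrite inE => /predU1P[->|/lL]; [rewrite zL; lia|lia].
  + have {}cs : cyl (pattern_at a b) s.
      by rewrite patE; apply/cyl_cons; split=> //; case/cyl_cons: cs.
    have [E1 E2 E3 E4] := pattern_walk ab cs; have [_ pp] := pattern_pinned ab cs.
    case=> t _ [h1 h2]; case: (leqP 4 t) => [/h2|]; first by rewrite E4.
    case: t h1 {h2} => [|[|[|[|t]]]] //=.
    * by lia.
    * by rewrite E1 lev_emb /= aL bL zL; lia.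
    * by rewrite -[nx s (nx s (a, b))]/(iter 2 _ _) E2 lev_emb /= aL bL zL; lia.
    * by rewrite -[nx s (nx s (nx s (a, b)))]/(iter 3 _ _) E3 lev_emb /= aL bL zL; lia.
- apply: (known _ _ (L + 3)) => // [x xl|/=|x]; rewrite ?inE ?xl ?orbT ?eqxx //.
  by case/predU1P => [->|/lL]; [rewrite zL; lia|lia].
- by rewrite [missp ^+ k.+1]exprS /missp [X in (1 - X) * _]exprS; lra.
Qed.

(** The two ends are queried first. They may have level [lev d a + 1], which together with the
    strict inequality in [escapes_cov] accounts for the 2. *)
Lemma escapes_cov0 d T k a b : d \in dirs -> adj a b ->
  Cov (fun s => iface s (a, b) /\ escapes d T (a, b) (lev d a + (3 * k + 2)%:Z) s) [::] (missp ^+ k).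
Proof.
move=> dd ab; have qk : 0 <= missp ^+ k by rewrite exprn_ge0 // missp_ge0.
apply: (@Cov_split _ _ _ a (missp ^+ k) 0) => //; last by lra.
- apply: (@Cov_split _ _ _ b 0 (missp ^+ k)); last by lra.
  + by rewrite inE /=; apply: contraTneq ab => ->; rewrite adjE; lia.
  + apply: Cov_none => // s /cyl_cons[/= sb _] [/and3P[_ _]].
    by rewrite /= sb.
  + apply: (@Cov_sub (escapes d T (a, b) (lev d a + (3 * k + 2)%:Z))); first by move=> s _ [].
    apply: (@escapes_cov _ _ _ _ _ _ (lev d a + 1)) => //; rewrite ?inE ?eqxx ?orbT //; last by lia.
    move=> x; rewrite !inE => /orP[]/eqP-> /=; last by lia.
    move: dd ab; case: d => d1 d2; rewrite !inE !xpair_eqE adjE /lev /=.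
    by do 3 ?[case/orP]; case/andP => /eqP -> /eqP -> H; lia.
- apply: Cov_none => // s /cyl_cons[/= sa _] [/and3P[_]].
  by rewrite /= sa.
Qed.

(** The pattern is six columns wide, so the spacing 6 makes the patterns of distinct spots
    disjoint. *)
Definition spot (x : site) (i : nat) : edge :=
  pinned_edge (x.1 + (6 * i)%:Z, x.2) (x.1 + (6 * i)%:Z + 1, x.2).

Definition nopin (x : site) (k : nat) (s : config) : Prop :=
  forall i, (i < k)%N -> ~ (iface s (spot x i) /\ pin s (spot x i)).

Lemma nopin_cov x k : Cov (nopin x k) [::] (missp ^+ k).
Proof.
suff H j l : (j <= k)%N -> (forall y, y \in unzip1 l -> y.1 < x.1 + (6 * (k - j))%:Z - 2) ->
    Cov (nopin x k) l (missp ^+ j).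
  by apply: H.
elim: j l => [|j IH] l jk lx; first by apply: Cov_all; rewrite expr0.
set a : site := (x.1 + (6 * (k - j.+1))%:Z, x.2).
set b : site := (x.1 + (6 * (k - j.+1))%:Z + 1, x.2).
have ab : adj a b by rewrite adjE /= !eqxx.
have patx y : y \in unzip1 (pattern_at a b) -> a.1 - 2 <= y.1 <= a.1 + 3.
  case/mapP => p /mapP[p' p'P ->] -> /=; rewrite /emb /a /b /=.
  by move: p'P; rewrite !inE; do 12 ?[case/predU1P => [->|]] => [||||||||||||/eqP->] /=; lia.
rewrite exprS /missp -{1}(size_pattern_at a b); apply: Cov_block => // [||y yp|l' _ sub|s cs cp].
- by rewrite exprn_ge0 // -/missp missp_ge0.
- exact: pattern_at_uniq.
- by apply/negP => /lx; have := patx _ yp; rewrite /a /=; lia.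
- apply: IH => [|y /sub]; first by lia.
  rewrite mem_cat => /orP[/patx|/lx]; rewrite /a /=; lia.
- have [h1 h2] := pattern_pinned ab cp => /(_ (k - j.+1)%N); apply; last by split.
  by lia.
Qed.

End Cover.

Lemma assoc_uniq (l : seq (site * bool)) y u v : uniq (unzip1 l) -> (y, u) \in l -> (y, v) \in l -> u = v.
Proof.
elim: l => // -[z t] l IH /= /andP[zl ul].
have K b : (z, b) \in l -> False by move=> h; case/negP: zl; apply/mapP; exists (z, b).
rewrite !inE !xpair_eqE => /orP[/andP[/eqP -> /eqP ->]|h1] /orP[/andP[/eqP e /eqP ->]|h2] //.
- by case: (K v).
- by case: (K u); rewrite -e.
- exact: IH.
Qed.

(** Provides a nearby one-edge curve at time [n] to match an initial curve that contains no image of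
    a later edge. *)
Definition pins_dense (s0 : config) (m C : nat) : Prop := forall x, exists e,
  [/\ iface s0 e, pin s0 e & (m * dist1 x e.1 <= norm1 x + C)%N].

Definition nbrs (x : site) : seq site := [seq nb k x (x.1 + 1, x.2) | k <- iota 0 6].

Lemma mem_nbrs x y : (y \in nbrs x) = adj x y.
Proof.
have xx : adj x (x.1 + 1, x.2) by rewrite adjE /= !eqxx.
apply/mapP/idP => [[k _ ->]|xy]; first by rewrite adj_nb.
by have [k lk ->] := adj_nbP xx xy; exists k => //; rewrite mem_iota.
Qed.

Lemma size_box r : size (box r) = ((2 * r).+1 ^ 2)%N.
Proof. by rewrite /box size_allpairs size_iota. Qed.

(** * From covers to almost sure statements *)

Section Coverable.
Context (R : realType) (d : measure_display) (Omega : measurableType d).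
Variable P : probability Omega R.

(** An outer-measure bound, so that the measurability of events such as [nopin] or [escapes] need
    not be discussed. *)
Definition coverable (A : set Omega) (c : R) : Prop :=
  exists2 B, measurable B & A `<=` B /\ (P B <= c%:E)%E.

Lemma coverable_sub A B c : A `<=` B -> coverable B c -> coverable A c.
Proof. by move=> AB [D mD [BD PD]]; exists D => //; split=> //; apply: subset_trans BD. Qed.

Lemma coverable_le A c c' : c <= c' -> coverable A c -> coverable A c'.
Proof. by move=> le [D mD [BD PD]]; exists D => //; split=> //; apply: le_trans PD _; rewrite lee_fin. Qed.

Lemma coverable0 c : 0 <= c -> coverable set0 c.
Proof. by move=> c0; exists set0 => //; split=> //; rewrite measure0 lee_fin. Qed.

Lemma coverableU A B a b : coverable A a -> coverable B b -> coverable (A `|` B) (a + b).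
Proof.
move=> [A' mA' [AA' PA]] [B' mB' [BB' PB]]; exists (A' `|` B'); first exact: measurableU.
split; first exact: setUSS.
by apply: le_trans (measureU2 _ mA' mB') _; rewrite EFinD; apply: leeD.
Qed.

Lemma coverable_seq (T : eqType) (l : seq T) (F : T -> set Omega) c : 0 <= c ->
  (forall x, x \in l -> coverable (F x) c) ->
  coverable [set w | exists2 x, x \in l & F x w] ((size l)%:R * c).
Proof.
move=> c0; elim: l => [|a l IH] H.
  by apply: coverable_sub (coverable0 _) => [w [x]|]; rewrite ?mul0r.
rewrite /= -natr1 mulrDl mul1r addrC.
apply: coverable_sub (coverableU (H a (mem_head _ _)) (IH _)).
  by move=> w [x]; rewrite inE => /predU1P[->|xl] Fx; [left|right; exists x].
by move=> x xl; apply: H; rewrite inE xl orbT.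
Qed.

(** The chosen covers [B n] need not increase; their tail intersections [G n] do, still contain
    [F n], and admit continuity from below. *)
Lemma coverable_bigcup (F : nat -> set Omega) c : (forall n, F n `<=` F n.+1) ->
  (forall n, coverable (F n) c) -> coverable (\bigcup_n F n) c.
Proof.
move=> nd cF.
have Fle n k : F n `<=` F (n + k)%N.
  elim: k => [|k IH]; first by rewrite addn0.
  by rewrite addnS; apply: subset_trans IH _.
have /choice[B HB] : forall n, exists B, [/\ measurable B, F n `<=` B & (P B <= c%:E)%E].
  by move=> n; have [B mB [h1 h2]] := cF n; exists B.
pose G n := \bigcap_k B (n + k)%N.
have mG n : measurable (G n) by apply: bigcapT_measurable => k; have [] := HB (n + k)%N.
exists (\bigcup_n G n); first exact: bigcup_measurable.
split.
  move=> w [n _ Fw]; exists n => // k _; have [_ + _] := HB (n + k)%N; apply.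
  exact: Fle.
have ndG : nondecreasing_seq G.
  apply/nondecreasing_seqP => n; apply/subsetPset => w Gw k _.
  by have := Gw k.+1 I; rewrite addnS.
have cv := @nondecreasing_cvg_mu _ _ _ P G mG (bigcup_measurable (fun n _ => mG n)) ndG.
rewrite -(cvg_lim _ cv) //; apply: lime_le; first by apply/cvg_ex; eexists; exact: cv.
apply: nearW => n /=; have [mB _ PB] := HB n; apply: le_trans PB.
apply: le_measure; rewrite ?inE // => w Gw.
by have := Gw 0%N I; rewrite addn0.
Qed.

(** The Borel-Cantelli lemma for covers with geometrically summable probabilities. *)
Lemma ae_eventually_not (F : nat -> set Omega) (K z : R) : 0 <= K -> 0 < z < 1 ->
  (forall n, coverable (F n) (K * z ^+ n)) ->
  {ae P, forall w, exists J, forall j, (J <= j)%N -> ~ F j w}.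
Proof.
move=> K0 /andP[z0 z1] cF.
have /choice[B HB] : forall n, exists B, [/\ measurable B, F n `<=` B & (P B <= (K * z ^+ n)%:E)%E].
  by move=> n; have [B mB [h1 h2]] := cF n; exists B.
have mB n : measurable (B n) by have [] := HB n.
exists (lim_sup_set B); split.
- apply: bigcapT_measurable => n; exact: bigcup_measurable.
- apply: lim_sup_set_cvg0 => //.
  apply: (@le_lt_trans _ _ (K * (1 - z)^-1)%:E); last exact: ltry.
  apply: lime_le; first exact: is_cvg_nneseries.
  apply: nearW => n /=; apply: (@le_trans _ _ (\sum_(0 <= i < n) (K * z ^+ i)%:E)%E).
    by apply: lee_sum => i _; have [] := HB i.
  rewrite sumEFin lee_fin; apply: le_trans (@geometric_le_lim _ n K z K0 z0 _).
    by rewrite /series /= /geometric.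
  by rewrite gtr0_norm.
- move=> w /= H n _; apply: contrapT => Hn; apply: H; exists n => j jn Fj; apply: Hn.
  by exists j => //; have [_ + _] := HB j; apply.
Qed.

Variable s : site -> Omega -> bool.
Hypothesis iid : iid_fair P s.

Let conf w : config := fun x => s x w.

Lemma measurable_cyl l : measurable [set w | cyl l (conf w)].
Proof.
elim: l => [|[x v] l IH]; first by rewrite (_ : [set _ | _] = setT) //; apply/seteqP; split.
have -> : [set w | cyl ((x, v) :: l) (conf w)] =
    (if v then [set w | s x w] else ~` [set w | s x w]) `&` [set w | cyl l (conf w)].
  apply/seteqP; split=> w /=.
    by case/cyl_cons => /= sx cl; split=> //; case: v sx => /= sx; rewrite -[s x w]/(conf w x) sx.
  case=> h1 h2; apply/cyl_cons; split=> //=.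
  by case: v h1 => //= /negP/negbTE.
by apply: measurableI => //; case: v; [|apply: measurableC]; apply: iid.1.
Qed.

Lemma prob_cyl l : uniq (unzip1 l) -> P [set w | cyl l (conf w)] = (2^-1 ^+ size l)%:E.
Proof.
move=> ul; have := iid.2 (unzip1 l) (fun x => (x, true) \in l) ul.
rewrite size_map => <-; congr (P _).
have E y v : (y, v) \in l -> ((y, true) \in l) = v.
  by case: v => // yl; apply/negP => yl'; have := assoc_uniq ul yl yl'.
apply/seteqP; split=> w /= H.
  by move=> x /mapP[[y v] yl /= ->]; rewrite (E _ _ yl) -[s y w]/(conf w y) (H _ yl).
by move=> [y v] yl /=; rewrite /conf H ?(E _ _ yl) //; apply/mapP; exists (y, v).
Qed.

Lemma Cov_coverable A l (w : R) : Cov A l w -> uniq (unzip1 l) ->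
  coverable [set om | cyl l (conf om) /\ A (conf om)] (2^-1 ^+ size l * w).
Proof.
elim=> {l w} [l w w1|l w w0 H|l z w1 w2 w zl _ IH1 _ IH2 ww] ul.
- exists [set om | cyl l (conf om)]; first exact: measurable_cyl.
  split=> [om [] // |]; rewrite prob_cyl // lee_fin ler_peMr // exprn_ge0 // invr_ge0 //.
- apply: coverable_sub (coverable0 _) => [om [/H] // |].
  by rewrite mulr_ge0 // exprn_ge0 // invr_ge0.
- have := coverableU (IH1 _) (IH2 _); rewrite /= zl ul => /(_ isT isT) H.
  apply: coverable_sub (coverable_le _ H) => [om [co Ao]|].
    by case E: (conf om z); [left|right]; split=> //; apply/cyl_cons.
  rewrite exprS -mulrDr -mulrA mulrCA ler_wpM2l // ?exprn_ge0 ?invr_ge0 //.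
  by rewrite mulrC.
Qed.

(** Scale [j] allows [3 * j] attempts: of the resulting factor [z ^+ (3 * j)], two thirds pay for
    the number of sites in the box and one third stays summable. *)
Definition bad (r : nat) (j : nat) : set Omega := [set w | exists2 x, x \in box (r * j.+1) &
  nopin x (3 * j) (conf w) \/ exists2 b, b \in nbrs x & exists2 d, d \in dirs &
    exists T, iface (conf w) (x, b) /\
      escapes d T (x, b) (lev d x + (3 * (3 * j) + 2)%:Z) (conf w)].

Let z := missp R.

Lemma z01 : 0 < z < 1.
Proof.
rewrite /z /missp subr_gt0 gtrBl exprn_gt0 ?invr_gt0 // andbT.
by rewrite exprn_ilt1 // ?invf_lt1 ?ltr1n.
Qed.

(** Union bound over at most [(3 * r * j.+1) ^ 2] sites and 25 events at each, whence 225 = 25 times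
    9; [jz] absorbs each factor [j.+1] into a [z ^+ j]. *)
Lemma bad_coverable r j : (0 < r)%N ->
  coverable (bad r j) (225 * r%:R ^+ 2 / (1 - z) ^+ 2 * z ^+ j).
Proof.
move=> r0; have /andP[z0 z1] := z01.
have zk k : 0 <= z ^+ k by rewrite exprn_ge0 // ltW.
have c1 x : coverable [set w | nopin x (3 * j) (conf w)] (z ^+ (3 * j)).
  have := @Cov_coverable _ _ _ (nopin_cov R x (3 * j)) isT.
  by rewrite expr0 mul1r; apply: coverable_sub => w /= H; split.
have c2 x b d' : b \in nbrs x -> d' \in dirs -> coverable [set w | exists T, iface (conf w) (x, b) /\
      escapes d' T (x, b) (lev d' x + (3 * (3 * j) + 2)%:Z) (conf w)] (z ^+ (3 * j)).
  rewrite mem_nbrs => xb dd.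
  apply: (@coverable_sub _ (\bigcup_T [set w | iface (conf w) (x, b) /\
      escapes d' T (x, b) (lev d' x + (3 * (3 * j) + 2)%:Z) (conf w)])).
    by move=> w [T HT]; exists T.
  apply: coverable_bigcup => [T w [Iw [t lt Ht]]|T].
    by split=> //; exists t => //; apply: leq_trans lt _.
  have := @Cov_coverable _ _ _ (escapes_cov0 R T (3 * j) dd xb) isT.
  by rewrite expr0 mul1r; apply: coverable_sub => w /= H; split.
have c3 x : coverable [set w | nopin x (3 * j) (conf w) \/ exists2 b, b \in nbrs x &
    exists2 d', d' \in dirs & exists T, iface (conf w) (x, b) /\
      escapes d' T (x, b) (lev d' x + (3 * (3 * j) + 2)%:Z) (conf w)]
    (z ^+ (3 * j) + 6%:R * (4%:R * z ^+ (3 * j))).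
  apply: coverableU (c1 x) _.
  apply: (@coverable_seq _ (nbrs x)) => [|b bx]; first by rewrite mulr_ge0.
  by apply: (@coverable_seq _ dirs) => // d' dd; apply: c2.
have jz : j.+1%:R * z ^+ j <= (1 - z)^-1.
  have H := @geometric_le_lim R j.+1 1 z ler01 z0; rewrite mul1r in H.
  apply: le_trans (H _); last by rewrite gtr0_norm.
  rewrite /series /= mulr_natl -[X in _ *+ X](subn0 j.+1) -sumr_const_nat.
  apply: ler_sum_nat => i /andP[_ lij].
  by rewrite /geometric /= mul1r ler_wiXn2l // ltW.
apply: (coverable_le _ (@coverable_seq _ (box (r * j.+1)) _ _ _ (fun x _ => c3 x))); last first.
  by rewrite addr_ge0 // mulr_ge0 // mulr_ge0.
rewrite size_box natrX.
have -> : z ^+ (3 * j) + 6%:R * (4%:R * z ^+ (3 * j)) = 25 * (z ^+ j) ^+ 2 * z ^+ j.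
  by rewrite mulnC exprM exprSr; ring.
have le3 : (2 * (r * j.+1)).+1%:R <= 3 * r%:R * j.+1%:R :> R.
  by rewrite -!natrM ler_nat; nia.
rewrite mulrA ler_wpM2r //.
have -> : 225 * r%:R ^+ 2 / (1 - z) ^+ 2 = 25 * (3 * r%:R * (1 - z)^-1) ^+ 2 :> R.
  by rewrite !exprMn exprVn; ring.
rewrite mulrCA -exprMn ler_pM2l ?ltr0n // ler_sqr ?nnegrE.
- apply: le_trans (ler_wpM2r (zk j) le3) _.
  by rewrite -[X in X <= _]mulrA ler_wpM2l // mulr_ge0.
- by rewrite mulr_ge0.
- by rewrite mulr_ge0 ?mulr_ge0 // invr_ge0 subr_ge0 ltW.
Qed.

(** The scale [jx x] is large enough for its box to contain [x], while a displacement of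
    [9 * jx x + 2] in each coordinate is at most about [norm1 x / m] in total: hence the ratio
    [18 * m]. *)
Lemma not_bad_confined m J w : (0 < m)%N ->
  (forall j, (J <= j)%N -> ~ bad (18 * m) j w) ->
  confined (conf w) m (m * (18 * J + 2)) /\ pins_dense (conf w) m (m * (18 * J + 2)).
Proof.
move=> m0 nb; have r0 : (0 < 18 * m)%N by rewrite muln_gt0.
pose jx x := maxn J (norm1 x %/ (18 * m)).
have xbox x : x \in box (18 * m * (jx x).+1).
  apply: mem_box; apply: ltnW; apply: leq_trans (ltn_ceil (norm1 x) r0) _.
  by rewrite mulnC leq_mul2l ltnS leq_maxr orbT.
have jle x : (m * (18 * jx x) <= norm1 x + m * (18 * J))%N.
  rewrite /jx; case: (leqP J (norm1 x %/ (18 * m))) => H.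
    by have := leq_trunc_div (norm1 x) (18 * m); nia.
  by rewrite leq_addl.
have Hnb x := nb (jx x) (leq_maxl _ _).
split=> [[x b] Ixb t Ht|x].
  set y := (iter t _ _).1; rewrite [(x, b).1]/= in y *.
  have lt d' : d' \in dirs -> (lev d' y < lev d' x + (3 * (3 * jx x) + 2)%:Z)%R.
    move=> dd; rewrite ltNge; apply/negP => le; apply: (Hnb x).
    exists x => //; right; exists b; first by rewrite mem_nbrs; case/and3P: Ixb.
    by exists d' => //; exists t; split=> //; exists t.
  have := lt (1, 0) isT; have := lt (-1, 0) isT; have := lt (0, 1) isT; have := lt (0, -1) isT.
  have := jle x; rewrite /lev /dist1 /= => h0 h1 h2 h3 h4.
  have : (`|y.1 - x.1| + `|y.2 - x.2| <= 18 * jx x + 2)%N by lia.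
  by move=> h5; nia.
have [i li [Is ps]] : exists2 i, (i < 3 * jx x)%N & iface (conf w) (spot x i) /\ pin (conf w) (spot x i).
  apply: contrapT => H; apply: (Hnb x); exists x => //; left => i li Hi.
  by apply: H; exists i.
exists (spot x i); split=> //.
have : (dist1 x (spot x i).1 <= 18 * jx x)%N by rewrite /dist1 /spot /pinned_edge /emb /=; lia.
by have := jle x; nia.
Qed.

Lemma ae_confined m : (0 < m)%N ->
  {ae P, forall w, exists C, confined (conf w) m C /\ pins_dense (conf w) m C}.
Proof.
move=> m0; have r0 : (0 < 18 * m)%N by rewrite muln_gt0.
have /andP[z0 z1] := z01.
have K0 : 0 <= 225 * (18 * m)%:R ^+ 2 / (1 - z) ^+ 2.
  by rewrite mulr_ge0 ?mulr_ge0 ?exprn_ge0 // invr_ge0 exprn_ge0 // subr_ge0 ltW.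
apply: filterS (ae_eventually_not K0 z01 (fun j => bad_coverable j r0)) => w [J HJ].
by exists (m * (18 * J + 2))%N; apply: not_bad_confined.
Qed.

End Coverable.

(** * Curves *)

Section Analysis.
Variable R : realType.

(* [inf] is 0 on a set without lower bound, so no lower bound is needed here. *)
Lemma inf_le_mem (S : set R) x e : S x -> x <= e -> 0 <= e -> inf S <= e.
Proof.
move=> Sx xe e0; have [hS|/inf_out -> //] := pselect (has_inf S).
by apply: le_trans xe; apply: ge_inf => //; case: hS.
Qed.

Lemma derivable_scale (c x : R) : derivable (fun s : R => s * c) x 1.
Proof. exact (@derivableM R R id (cst c) x 1 (@derivable_id R R x 1) (derivable_cst c x 1)). Qed.

Lemma derivable_affine (a c x : R) : derivable (fun s : R => a + s * c) x 1.
Proof. exact (derivableD (derivable_cst a x 1) (@derivable_scale c x)). Qed.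

Lemma derive1_affine (a c : R) : derive1 (fun s : R => a + s * c) = cst c.
Proof.
apply/funext => x; rewrite derive1E.
have -> : (fun s : R => a + s * c) = cst a + (fun s => s * c) by [].
rewrite (deriveD (derivable_cst a x 1) (@derivable_scale c x)).
by rewrite derive_cst add0r -derive1E derive1Mr // derive1E derive_id mul1r.
Qed.

Lemma smooth_affine (a c : R) : smooth_fun (fun s : R => a + s * c).
Proof.
have D2 n : derive1n n.+2 (fun s : R => a + s * c) = cst 0.
  elim: n => [|n IH]; first by apply/funext => x; rewrite !derive1nS derive1n0 derive1_affine derive1_cst.
  by apply/funext => x; rewrite derive1nS IH derive1_cst.
case=> [|[|n]] x; first exact: derivable_affine.
  by rewrite derive1nS derive1n0 derive1_affine.
by rewrite D2.
Qed.

Lemma weighted_length_le (f1 f2 : R -> R) (L M : R) : 0 <= L -> continuous f1 -> continuous f2 ->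
  (forall s, 0 <= s <= L -> (1 + f1 s ^+ 2 + f2 s ^+ 2)^-1 <= M) ->
  weighted_length f1 f2 L <= M * L.
Proof.
move=> L0 c1 c2 H; rewrite /weighted_length /Rintegral.
have pos s : 0 < 1 + f1 s ^+ 2 + f2 s ^+ 2.
  by have := sqr_ge0 (f1 s); have := sqr_ge0 (f2 s); lra.
have cg : continuous (fun s => (1 + f1 s ^+ 2 + f2 s ^+ 2)^-1).
  move=> s; apply: cvgV; first by rewrite gt_eqF.
  apply: cvgD; first apply: cvgD; first exact: cvg_cst.
    by rewrite expr2; apply: cvgM; apply: c1.
  by rewrite expr2; apply: cvgM; apply: c2.
have le : (\int[lebesgue_measure]_(x in `[0%R, L]) ((1 + f1 x ^+ 2 + f2 x ^+ 2)^-1)%:E <= (M * L)%:E)%E.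
  apply: (@le_trans _ _ (\int[lebesgue_measure]_(x in `[0%R, L]) (cst M%:E) x)%E).
    apply: ge0_le_integral => //.
    - by move=> x _; rewrite lee_fin invr_ge0 ltW.
    - apply/measurable_realfun.measurable_EFinP; apply: measurable_funTS; exact: measurable_realfun.continuous_measurable_fun.
  rewrite integral_cst //= lebesgue_measure_itv /= lte_fin.
  by case: ifP => [_|]; rewrite ?oppr0 ?adde0 -?EFinD ?subr0 -?EFinM ?mule0 // lee_fin => /negbT;
    rewrite -leNgt => L0'; have -> : L = 0 by lra; rewrite mulr0.
have ge : (0 <= \int[lebesgue_measure]_(x in `[0%R, L]) ((1 + f1 x ^+ 2 + f2 x ^+ 2)^-1)%:E)%E.
  by apply: integral_ge0 => x _; rewrite lee_fin invr_ge0 ltW.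
by move: le ge; case: (\int[_]_(_ in _) _)%E => [r| |] //=; rewrite lee_fin.
Qed.

Lemma dR2_segment (u c : pt R) (L M : R) : 0 <= L -> 0 <= M -> c.1 ^+ 2 + c.2 ^+ 2 = 1 ->
  (forall s, 0 <= s <= L -> (1 + (u.1 + s * c.1) ^+ 2 + (u.2 + s * c.2) ^+ 2)^-1 <= M) ->
  dR2 u (u.1 + L * c.1, u.2 + L * c.2) <= M * L.
Proof.
move=> L0 M0 c1 H.
have ca a b : continuous (fun s : R => a + s * b).
  by move=> s; apply: cvgD; [exact: cvg_cst | apply: cvgM; [exact: cvg_id | exact: cvg_cst]].
apply: (@inf_le_mem _ (weighted_length (fun s => u.1 + s * c.1) (fun s => u.2 + s * c.2) L)).
- exists (fun s => u.1 + s * c.1), (fun s => u.2 + s * c.2), L; split=> //.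
  + by split; apply: smooth_affine.
  + by move=> s _; rewrite !derive1_affine.
  + by split=> //; rewrite !mul0r !addr0; case: (u).
- exact: weighted_length_le.
- exact: mulr_ge0.
Qed.

Definition n1 (u : pt R) : R := `|u.1| + `|u.2|.

(** The segment is used as test curve. Near the origin its weight is at most 1; farther out its
    length is at most [(e + C) * n1 u], and the quadratic decay of the weight beats this linear
    growth. *)
Lemma dR2_near (u v : pt R) (e C : R) : 0 <= e <= 1 / 4 -> 0 <= C <= 1 / 4 ->
  n1 (v.1 - u.1, v.2 - u.2) <= e * n1 u + C -> dR2 u v <= 2 * (e + C).
Proof.
move=> /andP[e0 e1] /andP[C0 C1]; set l := n1 (_, _) => lle.
have l0 : 0 <= l by rewrite addr_ge0.
pose L := Num.sqrt ((v.1 - u.1) ^+ 2 + (v.2 - u.2) ^+ 2).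
have sq0 : 0 <= (v.1 - u.1) ^+ 2 + (v.2 - u.2) ^+ 2 by rewrite addr_ge0 ?sqr_ge0.
have L0 : 0 <= L by rewrite sqrtr_ge0.
have L2 : L ^+ 2 = (v.1 - u.1) ^+ 2 + (v.2 - u.2) ^+ 2 by rewrite sqr_sqrtr.
have Ll : L <= l.
  rewrite -ler_sqr ?nnegrE // L2 /l /n1 /= -(real_normK (num_real (v.1 - u.1))) -(real_normK (num_real (v.2 - u.2))).
  have := mulr_ge0 (normr_ge0 (v.1 - u.1)) (normr_ge0 (v.2 - u.2)).
  by rewrite sqrrD mulr2n; lra.
have [c [cu c1 c2]] : exists c : pt R, [/\ c.1 ^+ 2 + c.2 ^+ 2 = 1, L * c.1 = v.1 - u.1 & L * c.2 = v.2 - u.2].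
  have [L00|Lp] := eqVneq L 0.
    exists (1, 0); rewrite /= L00 expr1n expr0n addr0 !mul0r.
    move: L2; rewrite L00 expr0n /= => /esym/eqP.
    by rewrite paddr_eq0 ?sqr_ge0 // !sqrf_eq0 => /andP[/eqP-> /eqP->].
  exists ((v.1 - u.1) / L, (v.2 - u.2) / L); split=> /=.
  - by rewrite !expr_div_n -mulrDl -L2 divff // expf_neq0.
  - by rewrite mulrC divfK.
  - by rewrite mulrC divfK.
have -> : v = (u.1 + L * c.1, u.2 + L * c.2).
  by rewrite c1 c2 !addrA ![u.1 + _]addrC ![u.2 + _]addrC !addrK; case: (v).
have cabs : `|c.1| <= 1 /\ `|c.2| <= 1.
  split; rewrite -(@ler_sqr _ _ 1) ?nnegrE // expr1n real_normK ?num_real //.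
    by have := sqr_ge0 c.2; lra.
  by have := sqr_ge0 c.1; lra.
pose U := n1 u; have U0 : 0 <= U by rewrite addr_ge0.
have [U1|U1] := lerP U 1.
  apply: le_trans (@dR2_segment u c L 1 L0 ler01 cu _) _ => [s _|].
    rewrite invf_le1; first by have := sqr_ge0 (u.1 + s * c.1); have := sqr_ge0 (u.2 + s * c.2); lra.
    by have := sqr_ge0 (u.1 + s * c.1); have := sqr_ge0 (u.2 + s * c.2); lra.
  by rewrite mul1r; rewrite -/U in lle; nra.
have Up : 0 < 1 + U ^+ 2 / 8 by have := sqr_ge0 U; lra.
apply: le_trans (@dR2_segment u c L (1 + U ^+ 2 / 8)^-1 L0 _ cu _) _.
- by rewrite invr_ge0 ltW.
- move=> s /andP[s0 sL]; rewrite lef_pV2 ?posrE //; last first.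
    by have := sqr_ge0 (u.1 + s * c.1); have := sqr_ge0 (u.2 + s * c.2); lra.
  set x := u.1 + _; set y := u.2 + _.
  have hx : `|u.1| - s * `|c.1| <= `|x|.
    have := ler_normB x (s * c.1); rewrite /x addrK normrM (ger0_norm s0); lra.
  have hy : `|u.2| - s * `|c.2| <= `|y|.
    have := ler_normB y (s * c.2); rewrite /y addrK normrM (ger0_norm s0); lra.
  have hc : L * `|c.1| + L * `|c.2| = l.
    by rewrite -{1 2}(ger0_norm L0) -!normrM c1 c2.
  have hs : s * `|c.1| + s * `|c.2| <= l.
    by rewrite -hc lerD // ler_wpM2r.
  (* The segment is no longer than [U / 2], so it stays that far from the origin. Passing from the
     sum of absolute values to the sum of squares turns [U / 2] into [U ^+ 2 / 8]. *)
  have xy : U / 2 <= `|x| + `|y|.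
    by rewrite -/U in lle; rewrite /U /n1 in lle U1 *; nra.
  rewrite -addrA lerD2l -(real_normK (num_real x)) -(real_normK (num_real y)).
  have := sqr_ge0 (`|x| - `|y|).
  have : (U / 2) ^+ 2 <= (`|x| + `|y|) ^+ 2 by rewrite ler_sqr ?nnegrE ?addr_ge0 // divr_ge0.
  by rewrite !expr2; nra.
- rewrite mulrC ler_pdivrMr //.
  have : L <= (e + C) * U by rewrite -/U in lle; nra.
  have : 0 <= (U - 2) ^+ 2 by rewrite sqr_ge0.
  by rewrite !expr2; nra.
Qed.

Lemma reparam_id : reparam (@id R).
Proof.
split=> [|x y _ _ //|]; first by apply: continuous_subspaceT => x; exact: cvg_id.
by apply/seteqP; split=> [_ [x xI <-]|x xI] //=; exists x.
Qed.

Lemma Dcurve_le (g1 g2 : curve R) (f1 f2 : R -> R) e : 0 <= e -> reparam f1 -> reparam f2 ->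
  (forall t, 0 <= t <= 1 -> dS (g1 (f1 t)) (g2 (f2 t)) <= e) -> Dcurve g1 g2 <= e.
Proof.
move=> e0 r1 r2 H.
apply: (@inf_le_mem _ (sup [set dS (g1 (f1 t)) (g2 (f2 t)) | t in `[0, 1]])) => //.
  by exists f1, f2.
apply: ge_sup; first by exists (dS (g1 (f1 0)) (g2 (f2 0))), 0 => //=; rewrite in_itv /= lexx ler01.
by move=> _ [t tI <-]; apply: H; move: tI; rewrite /= in_itv.
Qed.

(** Truncation to the unit interval, in a form whose continuity is immediate. *)
Definition clamp (x : R) : R := (`|x| - `|x - 1| + 1) / 2.

Lemma clamp_le0 x : x <= 0 -> clamp x = 0.
Proof. by move=> x0; rewrite /clamp (ler0_norm x0) ler0_norm; lra. Qed.

Lemma clamp_id x : 0 <= x <= 1 -> clamp x = x.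
Proof. by move=> /andP[x0 x1]; rewrite /clamp (ger0_norm x0) ler0_norm; lra. Qed.

Lemma clamp_ge1 x : 1 <= x -> clamp x = 1.
Proof. by move=> x1; rewrite /clamp !ger0_norm; lra. Qed.

Lemma clamp_homo : {homo clamp : x y / x <= y}.
Proof.
move=> x y xy; have [x0|x0] := lerP x 0.
  rewrite clamp_le0 //; have [y0|y0] := lerP y 0; first by rewrite clamp_le0.
  by have [y1|y1] := lerP y 1; [rewrite clamp_id | rewrite clamp_ge1]; lra.
have [y1|y1] := lerP y 1; first by rewrite !clamp_id; lra.
by rewrite (@clamp_ge1 y); [have [x1|x1] := lerP x 1; [rewrite clamp_id | rewrite clamp_ge1]|]; lra.
Qed.

Lemma continuous_clamp : continuous clamp.
Proof.
move=> x; apply: cvgM; last exact: cvg_cst.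
apply: cvgD; last exact: cvg_cst.
apply: cvgB; first by apply: cvg_norm; exact: cvg_id.
by apply: cvg_norm; apply: cvgB; [exact: cvg_id | exact: cvg_cst].
Qed.

(** The piecewise linear function through the points [(i, a i)], as a sum of ramps: continuity and
    monotonicity hold term by term. *)
Definition interp (a : nat -> R) (n : nat) (x : R) : R :=
  a 0%N + \sum_(i < n) clamp (x - i%:R) * (a i.+1 - a i).

Lemma interp_on (a : nat -> R) n i x : (i < n)%N -> i%:R <= x <= i.+1%:R ->
  interp a n x = a i + (x - i%:R) * (a i.+1 - a i).
Proof.
move=> lin /andP[ix xi]; rewrite /interp.
have := @big_mkord R 0 +%R n xpredT (fun i => clamp (x - i%:R) * (a i.+1 - a i)) => <-.
rewrite (@big_cat_nat _ _ _ i) //=; last exact: ltnW.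
rewrite [X in _ + (_ + X)]big_ltn //= [X in _ + (_ + (_ + X))]big_nat_cond.
rewrite [X in _ + (_ + (_ + X))]big1 ?addr0; last first.
  move=> j /andP[/andP[lij _] _]; rewrite clamp_le0 ?mul0r // subr_le0.
  by apply: le_trans xi _; rewrite ler_nat.
rewrite (@eq_big_nat _ _ _ _ _ _ (fun j => a j.+1 - a j)); last first.
  move=> j /andP[_ lji]; rewrite clamp_ge1 ?mul1r // lerBrDr addrC natr1.
  by apply: le_trans ix; rewrite ler_nat.
rewrite telescope_sumr // clamp_id; first by ring.
by rewrite subr_ge0 ix /= lerBlDl natr1 xi.
Qed.

Lemma interp_homo (a : nat -> R) n : (forall i, a i <= a i.+1) -> {homo interp a n : x y / x <= y}.
Proof.
move=> ha x y xy; rewrite lerD2l; apply: ler_sum => i _.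
by rewrite ler_wpM2r ?subr_ge0 // clamp_homo // lerB.
Qed.

Lemma continuous_interp (a : nat -> R) n : continuous (interp a n).
Proof.
elim: n => [|n IH] x.
  have -> : interp a 0 = cst (a 0%N) by apply/funext => y; rewrite /interp big_ord0 addr0.
  exact: cvg_cst.
have -> : interp a n.+1 = (fun y => interp a n y + clamp (y - n%:R) * (a n.+1 - a n)).
  by apply/funext => y; rewrite /interp big_ord_recr addrA.
have c2 : continuous (fun y : R => clamp (y - n%:R) * (a n.+1 - a n)).
  move=> y; apply: (@cvgM _ _ _ _ (fun y => clamp (y - n%:R)) (cst (a n.+1 - a n))); last exact: cvg_cst.
  apply: (@cvg_comp _ _ _ (fun y => y - n%:R) clamp _ (nbhs (y - n%:R))); last exact: continuous_clamp.
  by apply: cvgB; [exact: cvg_id | exact: cvg_cst].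
by apply: cvgD; [exact: IH | exact: c2].
Qed.

Lemma interp_nat (a : nat -> R) n i : (i <= n)%N -> (0 < n)%N -> interp a n i%:R = a i.
Proof.
case: (ltnP i n) => [lin _ _|nin lin n0].
  by rewrite (interp_on _ lin) ?lexx ?ler_nat //= subrr mul0r addr0.
have -> : i = n.-1.+1 by lia.
rewrite (@interp_on _ _ n.-1); [|by lia|by rewrite ler_nat lexx leqnSn].
by rewrite -natr1 addrAC subrr add0r mul1r addrC subrK.
Qed.

Lemma reparam_interp (a : nat -> R) n : (0 < n)%N -> (forall i, a i <= a i.+1) ->
  a 0%N = 0 -> a n = 1 -> reparam (fun t => interp a n (n%:R * t)).
Proof.
move=> n0 ha a0 an.
have f0 : interp a n (n%:R * 0) = 0 by rewrite mulr0 (@interp_nat a n 0).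
have f1 : interp a n (n%:R * 1) = 1 by rewrite mulr1 interp_nat.
have fh : {homo (fun t => interp a n (n%:R * t)) : x y / x <= y}.
  by move=> x y xy; apply: interp_homo => //; rewrite ler_wpM2l.
have fc : continuous (fun t : R => interp a n (n%:R * t)).
  move=> x; apply: (@cvg_comp _ _ _ (fun t : R => n%:R * t) (interp a n) _ (nbhs (n%:R * x))); last exact: continuous_interp.
  by apply: cvgM; [exact: cvg_cst | exact: cvg_id].
split.
- exact: continuous_subspaceT.
- by move=> x y _ _; apply: fh.
- apply/seteqP; split=> [_ [t + <-]|y] /=; rewrite !in_itv /= => /andP[h0 h1].
    by have := fh _ _ h0; have := fh _ _ h1; rewrite f0 f1 => -> ->.
  have [||c + cE] := @IVT R (fun t => interp a n (n%:R * t)) 0 1 y ler01.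
  + exact: continuous_subspaceT.
  + by rewrite f0 f1 minEle maxEle ler01 h0.
  + by rewrite in_itv /= => cI; exists c; rewrite ?in_itv.
Qed.

End Analysis.

(** * b-paths as orbit segments of [nx] *)

Lemma common_nbr a b z : adj a b -> adj a z -> adj b z -> z = turn a b \/ z = turn b a.
Proof.
move=> ab az bz.
have : (z == turn a b) || (z == turn b a).
  case: a b z ab az bz => a1 a2 [b1 b2] [z1 z2].
  rewrite !adjE /turn /= !xpair_eqE /=.
  by do 5 ?[case/orP]; case/andP => /eqP -> /eqP ->; lia.
by case/orP => /eqP; [left | right].
Qed.

Section Orbits.
Variables (s : config).

Definition und (e : edge) : edge := if s e.1 then e else (e.2, e.1).

Lemma und_iface e : adj e.1 e.2 -> s e.1 = ~~ s e.2 -> iface s (und e).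
Proof.
move=> ae se; rewrite /und; case: ifP => s1; rewrite /iface /= ?ae ?s1 /=.
  by move: se; rewrite s1 => /esym.
by rewrite adj_sym ae /= andbT; move: se; rewrite s1 => /esym/negbFE.
Qed.

Lemma triangle_step a b z : iface s (a, b) -> adj a z -> adj b z ->
  let f := if s z then (z, b) else (a, z) in f = nx s (a, b) \/ (a, b) = nx s f.
Proof.
move=> I az bz f; have /and3P[/= ab _ _] := I.
have [E|E] := common_nbr ab az bz; first by left; rewrite /nx /= -E.
right; rewrite -[LHS](pvK I); congr (nx s _).
by rewrite /pv /= -E.
Qed.

Lemma und_step e f : adj e.1 e.2 -> s e.1 = ~~ s e.2 -> adj f.1 f.2 -> s f.1 = ~~ s f.2 ->
  (f.1 = e.1 /\ adj e.2 f.2) \/ (f.2 = e.2 /\ adj e.1 f.1) ->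
  und f = nx s (und e) \/ und e = nx s (und f).
Proof.
case: e f => a b [c d] /= ab sab cd scd Hc.
have := @und_iface (a, b) ab sab; rewrite /und /=.
case: Hc => [[ca bd]|[db ac]]; subst.
- case sa: (s a) scd => /= /esym sd I.
    by have := triangle_step I cd bd; rewrite (negbTE (_ : ~~ s d)) ?sd.
  by have := triangle_step I bd cd; rewrite (negbFE sd).
- have bc : adj b c by rewrite adj_sym.
  rewrite scd -sab; case sa: (s a) => /= I.
    by have := triangle_step I ac bc; rewrite scd -sab sa.
  by have := triangle_step I bc ac; rewrite scd -sab sa.
Qed.

(** Each step of a b-path goes forward or backward along [nx]. A change of direction would, by
    injectivity of [nx], repeat the edge before last, so distinctness keeps the direction of the
    first step; [r] records it. *)
Lemma bpath_orbit k p : bpath s k p -> exists g, [/\ iface s g,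
    (forall i j, (i < j <= k)%N -> iter i (nx s) g <> iter j (nx s) g) &
    exists r : bool, forall i, (i <= k)%N ->
      has_site (p i).1 (iter (if r then k - i else i)%N (nx s) g)].
Proof.
case=> Hadj Hs Hc Hd.
have If i : (i <= k)%N -> iface s (und (p i)).
  by move=> ik; apply: und_iface; [apply: Hadj | apply: Hs].
have hs i : has_site (p i).1 (und (p i)).
  by rewrite /has_site /und; case: ifP; rewrite eqxx ?orbT.
have uinj i j : (i <= k)%N -> (j <= k)%N -> und (p i) = und (p j) -> i = j.
  move=> ik jk E; apply/eqP; apply: contrapT => /negP ij; apply: (Hd i j ik jk ij).
  move: E; rewrite /und /same_dual_edge; case: (p i) (p j) => a b [c d] /=.
  by case: ifP; case: ifP => _ _ [-> ->]; by [left|right].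
have st i : (i < k)%N -> und (p i.+1) = nx s (und (p i)) \/ und (p i) = nx s (und (p i.+1)).
  by move=> ik; apply: und_step; [apply: Hadj|apply: Hs|apply: Hadj|apply: Hs|apply: Hc] => //; apply: ltnW.
have dist g (F : nat -> nat) : (forall i, (i <= k)%N -> (F i <= k)%N /\ iter i (nx s) g = und (p (F i))) ->
    (forall i j, (i <= k)%N -> (j <= k)%N -> F i = F j -> i = j) ->
    forall i j, (i < j <= k)%N -> iter i (nx s) g <> iter j (nx s) g.
  move=> HF Finj i j /andP[ij jk]; have ik : (i <= k)%N by apply: leq_trans (ltnW ij) jk.
  have [Fi ->] := HF i ik; have [Fj ->] := HF j jk => /(uinj _ _ Fi Fj) /(Finj _ _ ik jk).
  by lia.
case: (posnP k) => [k0|k0].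
  exists (und (p 0%N)); split; [exact: If| |].
    by move=> i j; rewrite k0; case: j => //= j; rewrite ltn0 andbF.
  by exists false => i; rewrite k0 leqn0 => /eqP ->.
have [fwd|bwd] := st 0%N k0.
- have F i : (i < k)%N -> und (p i.+1) = nx s (und (p i)).
    elim: i => // i IH ik; have [//|E] := st _ ik.
    have E2 := IH (ltnW ik); rewrite E in E2.
    have := nx_inj (If _ ik) (If i (ltnW (ltnW ik))) E2.
    by move/(uinj _ _ ik (ltnW (ltnW ik))); lia.
  have it i : (i <= k)%N -> iter i (nx s) (und (p 0%N)) = und (p i).
    by elim: i => // i IH ik /=; rewrite IH ?F // ltnW.
  exists (und (p 0%N)); split; [exact: If| |].
    by apply: (dist _ id) => // i ik; rewrite it.
  by exists false => i ik; rewrite it.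
- have F i : (i < k)%N -> und (p i) = nx s (und (p i.+1)).
    elim: i => // i IH ik; have [E|//] := st _ ik.
    have E2 := IH (ltnW ik); rewrite -E in E2.
    by have := uinj _ _ (ltnW (ltnW ik)) ik E2; lia.
  have it i : (i <= k)%N -> iter i (nx s) (und (p k)) = und (p (k - i)%N).
    elim: i => [|i IH] ik /=; first by rewrite subn0.
    by rewrite IH 1?ltnW // subnS [RHS]F ?prednK // ?subn_gt0 //; lia.
  exists (und (p k)); split; [exact: If| |].
    apply: (dist _ (fun i => k - i)%N) => [i ik|i j ik jk]; last by lia.
    by rewrite it // leq_subr.
  by exists true => i ik; rewrite it ?leq_subr // subKn.
Qed.

End Orbits.

Section Curves.
Variable R : realType.
Implicit Types (delta : R) (s : config).

Definition curve_of delta s k (p : nat -> edge) (gamma : curve R) : Prop :=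
  exists v : nat -> pt R, [/\ bpath s k p,
    (forall i, (i <= k)%N -> dual_edge_ends delta (p i).1 (p i).2 (v i) (v i.+1)) &
    (forall i, (i <= k)%N -> forall t : R, i%:R / k.+1%:R <= t <= i.+1%:R / k.+1%:R ->
       gamma t = Some ((v i).1 + (k.+1%:R * t - i%:R) * ((v i.+1).1 - (v i).1),
                       (v i).2 + (k.+1%:R * t - i%:R) * ((v i.+1).2 - (v i).2)))].

Lemma curve_ofP delta s gamma :
  bpath_curves delta s gamma <-> exists k p, curve_of delta s k p gamma.
Proof. by split=> [[k [p [v H]]]|[k [p [v H]]]]; exists k, p, v. Qed.

Lemma curve_of_agree delta s s' k p gamma : curve_of delta s k p gamma ->
  (forall i, (i <= k)%N -> s (p i).1 = s' (p i).1 /\ s (p i).2 = s' (p i).2) ->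
  curve_of delta s' k p gamma.
Proof.
move=> [v [[h1 h2 h3 h4] ev gv]] ag; exists v; split=> //; split=> // i ik.
by have [<- <-] := ag i ik; apply: h2.
Qed.

Definition tail_pt delta (e : edge) : pt R :=
  centroid (pos delta e.1) (pos delta e.2) (pos delta (turn e.2 e.1)).
Definition head_pt delta (e : edge) : pt R :=
  centroid (pos delta e.1) (pos delta e.2) (pos delta (turn e.1 e.2)).

Lemma tail_pt_nx delta s e : tail_pt delta (nx s e) = head_pt delta e.
Proof.
case: e => a b; rewrite /nx /tail_pt /head_pt /=.
by case: ifP => _ /=; rewrite ?turn_back ?turn_forth /centroid; congr pair; congr (_ / _); ring.
Qed.

Lemma edge_ends delta s e : iface s e ->
  dual_edge_ends delta e.1 e.2 (tail_pt delta e) (head_pt delta e) /\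
  dual_edge_ends delta e.1 e.2 (head_pt delta e) (tail_pt delta e).
Proof.
case: e => a b /and3P[/= ab _ _].
have ba : adj b a by rewrite adj_sym.
have h1 : adj a (turn a b) && adj b (turn a b) by rewrite adj_turn ab adj_turn2.
have h2 : adj a (turn b a) && adj b (turn b a) by rewrite adj_turn ba adj_turn2.
have ne : turn a b != turn b a.
  apply/eqP => /(congr1 (fun x => (x.1, x.2))); rewrite /turn /= => -[]; move: ab; rewrite adjE; lia.
split; [exists (turn b a), (turn a b)|exists (turn a b), (turn b a)]; split=> //.
by rewrite eq_sym.
Qed.

Lemma polygon_exists k (v : nat -> pt R) : exists gamma : curve R,
  forall i, (i <= k)%N -> forall t : R, i%:R / k.+1%:R <= t <= i.+1%:R / k.+1%:R ->
       gamma t = Some ((v i).1 + (k.+1%:R * t - i%:R) * ((v i.+1).1 - (v i).1),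
                       (v i).2 + (k.+1%:R * t - i%:R) * ((v i.+1).2 - (v i).2)).
Proof.
exists (fun t => Some (interp (fun i => (v i).1) k.+1 (k.+1%:R * t),
                       interp (fun i => (v i).2) k.+1 (k.+1%:R * t))).
move=> i ik t /andP[t1 t2]; have k0 : 0 < k.+1%:R :> R by rewrite ltr0n.
have it : i%:R <= k.+1%:R * t <= i.+1%:R.
  by move: t1 t2; rewrite ler_pdivrMr // ler_pdivlMr // [t * _]mulrC => -> ->.
by rewrite !(interp_on _ _ it).
Qed.

Lemma orbit_curve delta s g k (r : bool) : iface s g ->
  (forall i j, (i < j <= k)%N -> iter i (nx s) g <> iter j (nx s) g) ->
  exists p gamma, curve_of delta s k p gamma /\
    forall i, (i <= k)%N -> p i = iter (if r then k - i else i)%N (nx s) g.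
Proof.
move=> Ig dg; pose e i := iter i (nx s) g.
have Ie i : iface s (e i) by apply: iface_iter.
pose p i := e (if r then k - i else i)%N.
pose v i := tail_pt delta (e (if r then k.+1 - i else i)%N).
have [gamma Hg] := polygon_exists k v.
exists p, gamma; split=> //; exists v; split=> //.
- split.
  + by move=> i _; case/and3P: (Ie (if r then k - i else i)%N).
  + by move=> i _; case/and3P: (Ie (if r then k - i else i)%N) => _ -> /negbTE ->.
  + have cons j : ((e j.+1).1 = (e j).1 /\ adj (e j).2 (e j.+1).2) \/
        ((e j.+1).2 = (e j).2 /\ adj (e j).1 (e j.+1).1).
      case/and3P: (Ie j) => aj _ _; rewrite /e /= -/(e j) /nx; case: ifP => _ /=.
        by right; rewrite adj_turn.
      by left; rewrite adj_turn2.
    move=> i ik; rewrite /p; case: (r) => //.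
    have -> : (k - i = (k - i.+1).+1)%N by lia.
    by have := cons (k - i.+1)%N => -[] [-> h]; [left|right]; rewrite adj_sym.
  + move=> i j ik jk ij [[E1 E2]|[E1 E2]].
      have E : p i = p j by case: (p i) (p j) E1 E2 => ? ? [? ?] /= -> ->.
      move: E; rewrite /p; set a := (if r then _ else _); set b := (if r then _ else _).
      have ab : a <> b by rewrite /a /b; case: (r); move: ij => /eqP; lia.
      have ak : (a <= k)%N by rewrite /a; case: (r); lia.
      have bk : (b <= k)%N by rewrite /b; case: (r); lia.
      by case: (ltngtP a b) => // h; [apply: dg|move=> /esym; apply: dg]; rewrite h.
    by case/and3P: (Ie (if r then k - i else i)%N) => _; rewrite -/(p i) E1;
      case/and3P: (Ie (if r then k - j else j)%N) => _ _; rewrite -/(p j) => /negbTE ->.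
- move=> i ik; rewrite /p /v; case: (r).
    have -> : (k.+1 - i = (k - i).+1)%N by lia.
    by rewrite subSS [e (k - i).+1]/(nx s _) -/(e (k - i)%N) tail_pt_nx; case: (edge_ends delta (Ie (k - i)%N)).
  by rewrite [e i.+1]/(nx s _) -/(e i) tail_pt_nx; case: (edge_ends delta (Ie i)).
Qed.

End Curves.

(** * Distance between curves with matched indices *)

Section Matching.
Variable R : realType.
Implicit Types (delta : R) (s : config).

Lemma sqrt3_bounds : 3 / 2 <= Num.sqrt (3 : R) <= 2.
Proof.
have s3 : Num.sqrt 3 ^+ 2 = 3 :> R by rewrite sqr_sqrtr.
have s0 : 0 <= Num.sqrt 3 :> R by rewrite sqrtr_ge0.
by apply/andP; split; nra.
Qed.

Lemma natr_absz (z : int) : (absz z)%:R = `|z%:~R| :> R.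
Proof. by rewrite pmulrn abszE intr_norm. Qed.

Lemma pos_dist delta x y : 0 <= delta ->
  `|(pos delta y).1 - (pos delta x).1| <= delta * (dist1 x y)%:R /\
  `|(pos delta y).2 - (pos delta x).2| <= delta * (dist1 x y)%:R.
Proof.
move=> d0; have /andP[h1 h2] := sqrt3_bounds.
rewrite /pos /dist1 /= natrD !natr_absz !rmorphB /=.
have n0 := normr_ge0 (x.1%:~R - y.1%:~R : R); have n0' := normr_ge0 (x.2%:~R - y.2%:~R : R).
split; rewrite -mulrBr normrM (ger0_norm d0) ler_wpM2l //.
  have -> : y.1%:~R + y.2%:~R / 2 - (x.1%:~R + x.2%:~R / 2) =
     (y.1%:~R - x.1%:~R) + (y.2%:~R - x.2%:~R) / 2 :> R by ring.
  apply: le_trans (ler_normD _ _) _; rewrite normrM (@ger0_norm _ 2^-1) ?invr_ge0 //.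
  by rewrite (distrC y.1%:~R) (distrC y.2%:~R); lra.
rewrite -!mulrBl normrM (@ger0_norm _ 2^-1) ?invr_ge0 // normrM (distrC y.2%:~R).
by rewrite (@ger0_norm _ (Num.sqrt 3)) ?sqrtr_ge0 //; nra.
Qed.

Lemma pos_norm delta x : 0 <= delta -> delta * (norm1 x)%:R <= 2 * n1 (pos delta x).
Proof.
move=> d0; have /andP[h1 h2] := sqrt3_bounds.
rewrite /n1 /pos /norm1 /= natrD !natr_absz !normrM (ger0_norm d0).
rewrite (@ger0_norm _ (Num.sqrt 3)) ?sqrtr_ge0 // (@ger0_norm _ 2^-1) ?invr_ge0 //.
have H : `|x.1%:~R| <= `|x.1%:~R + x.2%:~R / 2| + `|x.2%:~R| / 2 :> R.
  have := ler_normB (x.1%:~R + x.2%:~R / 2) (x.2%:~R / 2 : R).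
  by rewrite addrK normrM (@ger0_norm _ 2^-1) ?invr_ge0.
have n0 := normr_ge0 (x.2%:~R : R); have n0' := normr_ge0 (x.1%:~R + x.2%:~R / 2 : R).
have : `|x.1%:~R| + `|x.2%:~R| <= 2 * (`|x.1%:~R + x.2%:~R / 2| + `|x.2%:~R| * Num.sqrt 3 / 2) :> R.
  by nra.
by move=> /(ler_wpM2l d0); lra.
Qed.

Definition near_site delta x (u : pt R) : Prop :=
  `|u.1 - (pos delta x).1| <= 2 * delta /\ `|u.2 - (pos delta x).2| <= 2 * delta.

Lemma centroid_near delta x y z : 0 <= delta -> adj x y -> adj x z ->
  near_site delta x (centroid (pos delta x) (pos delta y) (pos delta z)).
Proof.
move=> d0 xy xz.
have D2 w : adj x w -> delta * (dist1 x w)%:R <= 2 * delta.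
  by move=> /adj_dist1 H; rewrite mulrC ler_wpM2r // ler_nat.
have [a1 a2] := pos_dist x y d0; have [b1 b2] := pos_dist x z d0.
have := D2 _ xy; have := D2 _ xz.
move: a1 a2 b1 b2; rewrite /near_site /centroid /= !ler_norml.
by move=> /andP[? ?] /andP[? ?] /andP[? ?] /andP[? ?] ? ?; split; lra.
Qed.

Lemma curve_near delta s k p gamma i t : 0 <= delta -> curve_of delta s k p gamma ->
  (i <= k)%N -> i%:R <= k.+1%:R * t <= i.+1%:R ->
  exists2 u, gamma t = Some u & near_site delta (p i).1 u.
Proof.
move=> d0 [v [[Ha _ _ _] ev gv]] ik /andP[t1 t2].
have k0 : 0 < k.+1%:R :> R by rewrite ltr0n.
have [z [z' [/andP[a1 _] /andP[a2 _] _ E1 E2]]] := ev i ik.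
have [h1 h2] := centroid_near d0 (Ha i ik) a1; rewrite -E1 in h1 h2.
have [h3 h4] := centroid_near d0 (Ha i ik) a2; rewrite -E2 in h3 h4.
exists ((v i).1 + (k.+1%:R * t - i%:R) * ((v i.+1).1 - (v i).1),
        (v i).2 + (k.+1%:R * t - i%:R) * ((v i.+1).2 - (v i).2)).
  by apply: gv => //; rewrite ler_pdivrMr // ler_pdivlMr // [t * _]mulrC t1.
have l0 : 0 <= k.+1%:R * t - i%:R by rewrite subr_ge0.
have l1 : k.+1%:R * t - i%:R <= 1 by rewrite lerBlDl natr1.
move: l0 l1; move: (k.+1%:R * t - i%:R) => l l0 l1.
have conv (a b c e : R) : `|a - c| <= e -> `|b - c| <= e -> `|a + l * (b - a) - c| <= e.
  have l1' : 0 <= 1 - l by rewrite subr_ge0.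
  have -> : a + l * (b - a) - c = (1 - l) * (a - c) + l * (b - c) by ring.
  move=> ha hb; apply: le_trans (ler_normD _ _) _; rewrite !normrM (ger0_norm l0) (ger0_norm l1').
  have := ler_wpM2l l1' ha; have := ler_wpM2l l0 hb; move: (`|a - c|) (`|b - c|) => A B; lra.
by split=> /=; apply: conv.
Qed.

(** The outcome of [dR2_near]. The coefficient 6 is doubled by [pos_norm] and doubled again by
    adding two coordinates, giving 24; 104 is 96 plus 8, from the offsets between points of the
    curves and lattice sites. *)
Definition err delta (m K : nat) : R := 2 * (24 / m%:R + delta * (104 + 2 * K%:R)).

Lemma dS_near delta m K x y u w : 0 < delta -> (96 <= m)%N ->
  delta * (104 + 2 * K%:R) <= 1 / 4 ->
  (m * dist1 x y <= 6 * norm1 x + K)%N ->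
  near_site delta x u -> near_site delta y w -> dS (Some u) (Some w) <= err delta m K.
Proof.
move=> d0 m96 dK Dxy [u1 u2] [w1 w2] /=.
have m0 : 0 < m%:R :> R by rewrite ltr0n (leq_trans _ m96).
apply: dR2_near.
- rewrite divr_ge0 //= ler_pdivrMr //.
  have : 96%:R <= m%:R :> R by rewrite ler_nat.
  by lra.
- by rewrite dK andbT mulr_ge0 ?ltW // addr_ge0 // mulr_ge0.

have [p1 p2] := pos_dist x y (ltW d0); have pn := pos_norm x (ltW d0).
have {}Dxy : m%:R * (dist1 x y)%:R <= 6 * (norm1 x)%:R + K%:R :> R.
  by rewrite -!natrM -natrD ler_nat.
set D := (dist1 x y)%:R in Dxy p1 p2 *; set N := (norm1 x)%:R in Dxy pn *.
have hu : n1 (pos delta x) <= n1 u + 4 * delta.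
  rewrite /n1; have := ler_normB u.1 (u.1 - (pos delta x).1); have := ler_normB u.2 (u.2 - (pos delta x).2).
  by rewrite !subKr; lra.
have hw : n1 (w.1 - u.1, w.2 - u.2) <= 2 * (delta * D) + 8 * delta.
  move: u1 u2 w1 w2 p1 p2; rewrite /n1 /= !ler_norml => /andP[? ?] /andP[? ?] /andP[? ?] /andP[? ?] /andP[? ?] /andP[? ?].
  have : `|w.1 - u.1| <= delta * D + 4 * delta by rewrite ler_norml; apply/andP; split; lra.
  have : `|w.2 - u.2| <= delta * D + 4 * delta by rewrite ler_norml; apply/andP; split; lra.
  by lra.
have dD : delta * D <= (12 * (n1 u + 4 * delta) + delta * K%:R) / m%:R.
  rewrite ler_pdivlMr //.
  have -> : delta * D * m%:R = delta * (m%:R * D) by ring.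
  apply: le_trans (ler_wpM2l (ltW d0) Dxy) _.
  have -> : delta * (6 * N + K%:R) = 6 * (delta * N) + delta * K%:R by ring.
  by rewrite lerD2r; move: pn hu; clear; move: (delta * N) (n1 (pos delta x)) (n1 u) => a b c; lra.
have m1 : m%:R^-1 <= 1 :> R by rewrite invf_le1 // ler1n (leq_trans _ m96).
have mi0 : 0 < m%:R^-1 :> R by rewrite invr_gt0.
have h1 : delta / m%:R <= delta / 96.
  by rewrite ler_pM2l // lef_pV2 ?posrE // ler_nat.
have h2 : delta * K%:R / m%:R <= delta * K%:R.
  by rewrite ler_piMr // mulr_ge0 // ltW.
have n0 : 0 <= n1 u by rewrite addr_ge0.
apply: le_trans hw _.
have -> : 24 / m%:R * n1 u = 24 * (n1 u / m%:R) by ring.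
have E : (12 * (n1 u + 4 * delta) + delta * K%:R) / m%:R =
  12 * (n1 u / m%:R) + 48 * (delta / m%:R) + delta * K%:R / m%:R by ring.
move: dD h1 h2 d0; rewrite {}E; clear.
move: (delta * D) (n1 u / m%:R) (delta / m%:R) (delta * K%:R / m%:R) => a b c e.
have -> : delta * (104 + 2 * K%:R) = 104 * delta + 2 * (delta * K%:R) by ring.
by move: (delta * K%:R) => f; lra.
Qed.

Lemma nat_between (A B : nat) (x : R) : (A <= B)%N -> A%:R <= x <= B.+1%:R ->
  exists2 j, (A <= j <= B)%N & j%:R <= x <= j.+1%:R.
Proof.
elim: B => [|B IH] AB /andP[x1 x2].
  by exists A; [rewrite AB leqnn | move: AB x1; rewrite leqn0 => /eqP -> ->].
case: (ltngtP A B.+1) AB x1 => // [AB _ x1|-> _ x1]; last by exists B.+1; rewrite ?leqnn // x1 x2.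
have [xB|xB] := lerP x B.+1%:R.
  have [j /andP[j1 j2] jx] := IH AB (introT andP (conj x1 xB)).
  by exists j => //; rewrite j1 (leq_trans j2).
by exists B.+1; [rewrite ltnW //= leqnn | rewrite ltW].
Qed.

(** [gamma'] is reparametrised by interpolating the values [J i / k']. A curve has [k.+1] edges but
    [J] is interpolated over [k] intervals; this mismatch is why closeness is required on the window
    from [J i.-1] to [J i.+1]. *)
Lemma match_curves delta m K s s' k p gamma k' p' gamma' (J : nat -> nat) :
  0 < delta -> (96 <= m)%N -> delta * (104 + 2 * K%:R) <= 1 / 4 ->
  curve_of delta s k p gamma -> curve_of delta s' k' p' gamma' ->
  (forall i, (J i <= J i.+1)%N) -> J 0%N = 0%N -> J k = k' ->
  (forall i j, (i <= k)%N -> (j <= k')%N -> (J i.-1 <= j <= J i.+1)%N ->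
    (m * dist1 (p i).1 (p' j).1 <= 6 * norm1 (p i).1 + K)%N) ->
  Dcurve gamma gamma' <= err delta m K.
Proof.
move=> d0 m96 dK C C' Jle J0 Jk close.
have e0 : 0 <= err delta m K.
  by rewrite mulr_ge0 // addr_ge0 ?divr_ge0 // mulr_ge0 ?ltW // addr_ge0 // mulr_ge0.
have Jhomo : {homo J : a b / (a <= b)%N}.
  by apply: homo_leq => //; exact: leq_trans.
have near i j t t' : (i <= k)%N -> (j <= k')%N -> (J i.-1 <= j <= J i.+1)%N ->
    i%:R <= k.+1%:R * t <= i.+1%:R -> j%:R <= k'.+1%:R * t' <= j.+1%:R ->
    dS (gamma t) (gamma' t') <= err delta m K.
  move=> ik jk' Jij ti tj.
  have [u -> Hu] := curve_near (ltW d0) C ik ti.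
  have [w -> Hw] := curve_near (ltW d0) C' jk' tj.
  by apply: dS_near Hu Hw => //; apply: close.
have idx n (t : R) : 0 <= t <= 1 -> exists2 i, (i <= n)%N & i%:R <= n.+1%:R * t <= i.+1%:R.
  move=> /andP[t0 t1]; have [||i /andP[_ ?] ?] := @nat_between 0 n (n.+1%:R * t); rewrite ?leq0n //.
    by rewrite mulr_ge0 //= ler_piMr.
  by exists i.
(* The quotients by [k'] make no sense for a single edge, but then every edge of [gamma] is close to
   it and any parametrisation serves. *)
case: (posnP k') => [k'0|k'0].
  apply: (Dcurve_le e0 (reparam_id R) (reparam_id R)) => t t01.
  have [i ik ti] := idx k t t01; have [j jk' tj] := idx k' t t01.
  apply: (near i j) => //; move: jk'; rewrite k'0 leqn0 => /eqP ->.
  have : (J i.-1 <= J k)%N by apply: Jhomo; apply: leq_trans (leq_pred _) ik.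
  by rewrite Jk k'0 => ->.
have k0 : (0 < k)%N by case: (posnP k) Jk k'0 => // ->; rewrite J0 => <-.
pose a i : R := (J i)%:R / k'%:R.
have k'R : 0 < k'%:R :> R by rewrite ltr0n.
have ale i : a i <= a i.+1 by rewrite ler_pM2r ?invr_gt0 // ler_nat.
have a0 : a 0%N = 0 by rewrite /a J0 mul0r.
have ak : a k = 1 by rewrite /a Jk divff // gt_eqF.
apply: (Dcurve_le e0 (reparam_id R) (reparam_interp k0 ale a0 ak)) => t /andP[t0 t1].
have [||i /andP[_ ik] ti] := @nat_between 0 k.-1 (k%:R * t); rewrite ?leq0n //.
  by rewrite mulr_ge0 //= prednK // ler_piMr.
have {}ik : (i < k)%N by rewrite -(prednK k0) ltnS.
move: (ti) => /andP[ti1 ti2].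
rewrite (interp_on a ik ti); set y := a i + _.
have tl0 : 0 <= k%:R * t - i%:R by rewrite subr_ge0.
have tl1 : k%:R * t - i%:R <= 1 by rewrite lerBlDl natr1.
have y1 : a i <= y by rewrite /y lerDl mulr_ge0 // subr_ge0.
have y2 : y <= a i.+1.
  have := ale i; rewrite /y -subr_ge0 => h; nra.
have Jy1 : (J i)%:R <= k'%:R * y by rewrite mulrC -ler_pdivrMr.
have Jy2 : k'%:R * y <= (J i.+1)%:R by rewrite mulrC -ler_pdivlMr.
have yge0 : 0 <= y by apply: le_trans y1; rewrite divr_ge0.
have yle1 : y <= 1.
  apply: le_trans y2 _; rewrite ler_pdivrMr // mul1r ler_nat -Jk.
  exact: Jhomo.
have [||j /andP[j1 j2] tj] := @nat_between (J i) (J i.+1) (k'.+1%:R * y); rewrite ?Jle //.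
  rewrite -natr1 mulrDl mul1r -(natr1 (J i.+1)); apply/andP; split; lra.
have jk' : (j <= k')%N by apply: leq_trans j2 _; rewrite -Jk Jhomo.
(* The [i]-th of [k] intervals meets only the edges [i] and [i.+1] among the [k.+1]. *)
have [ti'|ti'] := lerP (k.+1%:R * t) i.+1%:R.
  apply: (near i j) => //; first exact: ltnW.
    by rewrite j2 andbT (leq_trans _ j1) // Jhomo // leq_pred.
  by rewrite ti' andbT -natr1 mulrDl mul1r; lra.
apply: (near i.+1 j) => //.
  by rewrite j1 (leq_trans j2).
rewrite ltW //= -(natr1 k) -(natr1 i.+1) mulrDl mul1r; lra.
Qed.

End Matching.

(** * Comparison of the interfaces *)

(** Reduces matching to orbits followed forward: a reversed traversal conjugates [J] by both
    reversals. The norm bound confines the new path to a region given by the old one, for use with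
    [sigma_inf]. *)
Lemma orbit_match (R : realType) (delta : R) m K s s' k p gamma k' (r : bool) g g' (J : nat -> nat) :
  0 < delta -> (96 <= m)%N -> delta * (104 + 2 * K%:R) <= 1 / 4 ->
  curve_of delta s k p gamma ->
  (forall i, (i <= k)%N -> has_site (p i).1 (iter (if r then k - i else i)%N (nx s) g)) ->
  iface s' g' -> (forall i j, (i < j <= k')%N -> iter i (nx s') g' <> iter j (nx s') g') ->
  (forall i, (J i <= J i.+1)%N) -> J 0%N = 0%N -> J k = k' ->
  (forall i j x y, (i <= k)%N -> (j <= k')%N -> (J i.-1 <= j <= J i.+1)%N ->
    has_site x (iter i (nx s) g) -> has_site y (iter j (nx s') g') ->
    (m * dist1 x y <= 6 * norm1 x + K)%N) ->
  exists p' gamma', [/\ curve_of delta s' k' p' gamma', Dcurve gamma gamma' <= err delta m K &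
    forall j, (j <= k')%N -> exists2 i, (i <= k)%N & (norm1 (p' j).1 <= 7 * norm1 (p i).1 + K)%N].
Proof.
move=> d0 m96 dK C ps Ig' dist Jle J0 Jk close.
have Jhomo : {homo J : a b / (a <= b)%N} by apply: homo_leq => //; exact: leq_trans.
have [p' [gamma' [C' Hp']]] := orbit_curve delta r Ig' dist.
pose J' := if r then (fun i => k' - J (k - i))%N else J.
have J'le i : (J' i <= J' i.+1)%N.
  rewrite /J'; case: (r); last exact: Jle.
  by apply: leq_sub2l; apply: Jhomo; apply: leq_sub2l.
have J'0 : J' 0%N = 0%N by rewrite /J'; case: (r); rewrite // subn0 Jk subnn.
have J'k : J' k = k' by rewrite /J'; case: (r); rewrite // subnn J0 subn0.
have close' i j : (i <= k)%N -> (j <= k')%N -> (J' i.-1 <= j <= J' i.+1)%N ->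
    (m * dist1 (p i).1 (p' j).1 <= 6 * norm1 (p i).1 + K)%N.
  move=> ik jk' Jij; have := ps i ik; have := Hp' j jk'; move: Jij; rewrite /J'; case: (r) => Jij Ep hp.
    apply: (close (k - i)%N (k' - j)%N _ _ (leq_subr _ _) (leq_subr _ _) _ hp); last by rewrite Ep /has_site eqxx.
    move: Jij => /andP[h1 h2]; apply/andP; split.
      rewrite -subnS; have := Jhomo (k - i.+1)%N k (leq_subr _ _); rewrite Jk.
      by move: h2; move: (J _) => a; lia.
    case: i h1 {h2 hp} ik => [|i] h1 ik.
      by rewrite subn0 (leq_trans (leq_subr _ _)) // -{1}Jk.
    rewrite subnSK //; move: h1 => /=.
    by have := Jhomo _ _ (leq_subr i k); rewrite Jk; move: (J _) => a; lia.
  by apply: (close i j _ _ ik jk' Jij hp); rewrite Ep /has_site eqxx.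
exists p', gamma'; split=> //.
  exact: match_curves C C' J'le J'0 J'k close'.
move=> j jk'.
have ex : exists i, (j <= J' i)%N by exists k; rewrite J'k.
case: (ex_minnP ex) => i ji imin.
have ik : (i <= k)%N by apply: imin; rewrite J'k.
exists i => //; have := close' i j ik jk'.
have -> : (J' i.-1 <= j <= J' i.+1)%N.
  rewrite (leq_trans ji) // andbT; case: i ji imin {ik} => [|i] ji imin /=; first by rewrite J'0.
  by rewrite leqNgt; apply/negP => h; have := imin i (ltnW h); rewrite ltnn.
move=> /(_ isT); have := norm1_le (p' j).1 (p i).1; rewrite dist1C.
by move: (dist1 _ _) m96 => D; clear; nia.
Qed.

Section Comparison.
Variables (s0 : config) (m C : nat).
Hypothesis m96 : (96 <= m)%N.
Hypothesis conf : confined s0 m C.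
Hypothesis dens : pins_dense s0 m C.

Let sn n := sigma_n s0 n.
Let m4 : (4 <= m)%N := leq_trans (isT : (4 <= 96)%N) m96.
Let K := (6 * C + 200 + 20 * m)%N.

(** Only the interior is assumed unpinned; confinement applies there, and one step of [nx] is added
    at each end. *)
Lemma gap_dist h t : iface s0 h -> (forall i, (0 < i < t)%N -> ~ pin s0 (iter i (nx s0) h)) ->
  (m * dist1 (iter t (nx s0) h).1 h.1 <= norm1 h.1 + C + 2 + 4 * m)%N.
Proof.
case: t => [|[|t]] Ih HU; first by rewrite /= dist1xx muln0.
  by have := nx_dist1 Ih; rewrite dist1C /=; nia.
have In := iface_nx Ih.
have HU' i : (i <= t)%N -> ~ pin s0 (iter i (nx s0) (nx s0 h)).
  by move=> it; rewrite -iterSr; apply: HU; lia.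
have -> : iter t.+2 (nx s0) h = nx s0 (iter t (nx s0) (nx s0 h)).
  by rewrite -[RHS]/(iter t.+1 (nx s0) (nx s0 h)) -iterSr.
have h1 := conf In HU'; have h2 := nx_dist1 (iface_iter t In); have h3 := nx_dist1 Ih.
have h4 := norm1_le (nx s0 h).1 h.1.
set f := iter t _ _ in h1 h2 *; set n := nx s0 h in h1 h3 h4 *.
have h5 := dist1_tri f.1 (nx s0 f).1 h.1; have h6 := dist1_tri n.1 f.1 h.1.
rewrite (dist1C (nx s0 f).1 f.1) in h5; rewrite (dist1C n.1 h.1) in h4 h6.
move: h1 h2 h3 h4 h5 h6; move: (dist1 (nx s0 f).1 h.1) (dist1 f.1 (nx s0 f).1) (dist1 f.1 n.1).
move: (dist1 f.1 h.1) (dist1 h.1 n.1) (norm1 h.1) (norm1 n.1) => a b c d e g i; clear.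
nia.
Qed.

(** Stated relative to either site, because the curve that is being approximated may be the one at
    time [n] or the one at time 0. *)
Lemma close_gap n g t x y : iface (sn n) g -> has_site x g ->
  (forall i, (0 < i < t)%N -> ~ pin s0 (iter i (nx s0) (phi s0 n g))) ->
  has_site y (iter t (nx s0) (phi s0 n g)) ->
  (m * dist1 x y <= 6 * norm1 x + 6 * C + 62 + 10 * m)%N /\
  (m * dist1 y x <= 6 * norm1 y + 6 * C + 62 + 10 * m)%N.
Proof.
move=> Ig xg HU yh; have Ip := phi_iface Ig.
have h1 := phi_dist m4 conf Ig xg; have h1' := phi_dist_site m4 conf Ig xg.
have h2 := gap_dist Ip HU; have h3 := has_site_dist1 (iface_iter t Ip) yh.
have n1 := norm1_le (phi s0 n g).1 x; have n2 := norm1_le (phi s0 n g).1 y.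
have t1 := dist1_tri (phi s0 n g).1 x y; have t2 := dist1_tri (iter t (nx s0) (phi s0 n g)).1 (phi s0 n g).1 y.
rewrite (dist1C y x); rewrite (dist1C x (phi _ _ _).1) in t1; rewrite (dist1C (phi _ _ _).1 (iter _ _ _).1) in t2.
set X := norm1 (phi s0 n g).1 in h1 h2 n1 n2 *.
set a := dist1 (phi s0 n g).1 x in h1 h1' n1 t1 *.
set b := dist1 (phi s0 n g).1 y in n2 t1 t2 *.
set c := dist1 (iter t _ _).1 _ in h2 t2 *; set d := dist1 (iter t _ _).1 y in h3 t2 *.
move: h1 h1' h2 h3 n1 n2 t1 t2 m96; move: (dist1 x y) (norm1 x) (norm1 y) => D Nx Ny.
move: X a b c d; clear => X a b c d h1 h1' h2 h3 n1 n2 t1 t2 m96.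
have mD : (m * D <= 3 * X + 3 * C + 2 + 10 * m)%N by nia.
have Xx : (X <= 2 * Nx + C + 8)%N by lia.
have mb : (m * b <= X + C + 2 + 6 * m)%N.
  have : (m * b <= m * (c + 2))%N by rewrite leq_mul2l; lia.
  by rewrite mulnDr; lia.
have Xy : (X <= 2 * Ny + C + 20)%N.
  case: (leqP b (Ny + C + 20)) => [|lb]; first by lia.
  have : (96 * (b - 7) <= m * (b - 7))%N by rewrite leq_mul2r m96 orbT.
  by rewrite mulnBr; nia.
by split; lia.
Qed.

Lemma shift_close x x' y A : (m * dist1 x' y <= 6 * norm1 x' + A)%N -> (dist1 x' x <= 4)%N ->
  (m * dist1 x y <= 6 * norm1 x + A + 24 + 4 * m)%N.
Proof.
move=> h1 h2; have := dist1_tri x' x y; have := norm1_le x' x; rewrite (dist1C x x').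
by move: h1 h2; move: (dist1 x y) (dist1 x' y) (dist1 x' x) (norm1 x) (norm1 x') => a b c d e; nia.
Qed.

Lemma shift_close_r x y y' A : (m * dist1 x y' <= 6 * norm1 x + A)%N -> (dist1 y' y <= 4)%N ->
  (m * dist1 x y <= 6 * norm1 x + A + 4 * m)%N.
Proof.
move=> h1 h2; have := dist1_tri y' x y.
by move: h1 h2; move: (dist1 x y) (dist1 x y') (dist1 y' y) (norm1 x) => a b c d; nia.
Qed.

Lemma next_site_dist s e x : iface s e -> has_site x (nx s e) -> (dist1 e.1 x <= 4)%N.
Proof.
move=> Ie hx; have := nx_dist1 Ie; have := has_site_dist1 (iface_nx Ie) hx.
by have := dist1_tri (nx s e).1 e.1 x; lia.
Qed.

Lemma prev_site_dist s e x : iface s e -> has_site x e -> (dist1 (nx s e).1 x <= 4)%N.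
Proof.
move=> Ie hx; have := nx_dist1 Ie; have := has_site_dist1 Ie hx.
by have := dist1_tri e.1 (nx s e).1 x; rewrite (dist1C (nx s e).1 e.1); lia.
Qed.

(** The match is the initial orbit from the image of the first edge to that of the last, with the
    return times [t] as index map. *)
Lemma from_time_n (R : realType) (delta : R) n gamma : 0 < delta ->
  delta * (104 + 2 * K%:R) <= 1 / 4 -> bpath_curves delta (sn n) gamma ->
  exists2 gamma', bpath_curves delta s0 gamma' & Dcurve gamma gamma' <= err delta m K.
Proof.
move=> d0 dK /curve_ofP[k [p Cp]].
have [g [Ig dg [r Hr]]] : exists g, [/\ iface (sn n) g,
    (forall i j, (i < j <= k)%N -> iter i (nx (sn n)) g <> iter j (nx (sn n)) g) &
    exists r : bool, forall i, (i <= k)%N ->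
      has_site (p i).1 (iter (if r then k - i else i)%N (nx (sn n)) g)].
  by case: Cp => v [Bp _ _]; apply: bpath_orbit Bp.
have Ii i : iface (sn n) (iter i (nx (sn n)) g) by apply: iface_iter.
have [t [t0 tlt tE tgap]] := first_return_times (phi_first_return (s0 := s0) (n := n)) (@iface_nx (sn n)) Ig.
have Ip := phi_iface Ig.
have tmono : {homo t : a b / (a < b)%N} by apply: homo_ltn => //; exact: ltn_trans.
have tle : {homo t : a b / (a <= b)%N}.
  by apply: homo_leq => // [? ? ?|i]; [exact: leq_trans | apply: ltnW].
(* A repetition gives a period [l] of [phi s0 n g]. If [l] is a return time, the orbit at time [n]
   repeats within [k] steps; otherwise the image [phi s0 n g] lies inside a gap. *)
have dist i j : (i < j <= t k)%N -> iter i (nx s0) (phi s0 n g) <> iter j (nx s0) (phi s0 n g).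
  move=> /andP[ij jt] E.
  have {E} E : phi s0 n g = iter (j - i) (nx s0) (phi s0 n g).
    by apply: (iter_nx_inj (t := i) Ip (iface_iter _ Ip)); rewrite -iterD subnKC // ltnW.
  have ji : (0 < j - i)%N by rewrite subn_gt0.
  have jik : (j - i <= t k)%N by apply: leq_trans (leq_subr _ _) jt.
  move: (j - i)%N E ji jik => l E l0 lk.
  have ex : exists a, (l <= t a)%N by exists k.
  case: (ex_minnP ex) => -[|a] la amin; first by move: la l0; rewrite t0 leqn0 => /eqP ->.
  have al : (t a < l)%N by rewrite ltnNge; apply/negP => /amin; rewrite ltnn.
  have ak : (a < k)%N by apply: amin.
  move: la; rewrite leq_eqVlt => /predU1P[El|la].
    rewrite El tE in E; have := phi_inj Ig (Ii a.+1) E.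
    by apply: (dg 0%N); rewrite /= ak.
  by apply: (tgap a l _ g) => //; rewrite al la.
have base i j x y : (t i <= j <= t i.+1)%N -> has_site x (iter i (nx (sn n)) g) ->
    has_site y (iter j (nx s0) (phi s0 n g)) ->
    (m * dist1 x y <= 6 * norm1 x + (6 * C + 62 + 10 * m))%N.
  move=> /andP[j1 j2] hx hy.
  have shift l : (t i <= l)%N -> iter (l - t i) (nx s0) (phi s0 n (iter i (nx (sn n)) g)) =
      iter l (nx s0) (phi s0 n g) by move=> tl; rewrite -tE -iterD subnK.
  have [||h _] := @close_gap n _ (j - t i) x y (Ii i) hx; [|by rewrite shift|by move: h; clear; lia].
  move=> l /andP[l0 l1]; apply: (@nonimage_unpin _ n); first by apply: iface_iter; apply: phi_iface.
  move=> g' Ig' E; apply: (tgap i (l + t i)%N _ g' Ig'); last by rewrite E -tE -iterD.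
  by apply/andP; split; move: l0 l1 j2; clear; lia.
have [|p' [gamma' [C' D' _]]] :=
  @orbit_match R delta m K (sn n) s0 k p gamma (t k) r g (phi s0 n g) t d0 m96 dK Cp Hr Ip dist
    (fun i => ltnW (tlt i)) t0 erefl.
  move=> i j x y ik jk /andP[j1 j2] hx hy.
  case: (leqP (t i) j) => tj.
    by apply: leq_trans (base i j x y _ hx hy) _; rewrite ?tj // /K; clear; lia.
  case: i ik j1 j2 hx tj => [|i] ik j1 j2 hx tj; first by move: tj; rewrite t0.
  have hx' : has_site (iter i (nx (sn n)) g).1 (iter i (nx (sn n)) g) by rewrite /has_site eqxx.
  have := base i j _ y _ hx' hy; rewrite j1 ltnW // => /(_ isT) /shift_close H.
  by apply: leq_trans (H x (next_site_dist (Ii i) hx)) _; rewrite /K; clear; lia.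
by exists gamma' => //; apply/curve_ofP; exists (t k), p'.
Qed.

(** The match consists of the time-[n] edges whose images lie on [gamma]. That [B] is chosen before
    [n] is what allows the passage to [sigma_inf]. *)
Lemma from_time_0 (R : realType) (delta : R) gamma : 0 < delta ->
  delta * (104 + 2 * K%:R) <= 1 / 4 -> bpath_curves delta s0 gamma ->
  exists B, forall n, exists k' p' gamma', [/\ curve_of delta (sn n) k' p' gamma',
    Dcurve gamma gamma' <= err delta m K & forall j, (j <= k')%N -> (norm1 (p' j).1 <= B)%N].
Proof.
move=> d0 dK /curve_ofP[k [p Cp]].
have [h [Ih dh [r Hr]]] : exists g, [/\ iface s0 g,
    (forall i j, (i < j <= k)%N -> iter i (nx s0) g <> iter j (nx s0) g) &
    exists r : bool, forall i, (i <= k)%N ->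
      has_site (p i).1 (iter (if r then k - i else i)%N (nx s0) g)].
  by case: Cp => v [Bp _ _]; apply: bpath_orbit Bp.
have Ii i : iface s0 (iter i (nx s0) h) by apply: iface_iter.
exists (\max_(i < k.+1) (7 * norm1 (p i).1 + K)) => n.
suff [k' [g' [J [Ig' [dg' [Jle J0 Jk close]]]]]] : exists k' g' (J : nat -> nat), iface (sn n) g' /\
    ((forall i j, (i < j <= k')%N -> iter i (nx (sn n)) g' <> iter j (nx (sn n)) g') /\
    [/\ (forall i, (J i <= J i.+1)%N), J 0%N = 0%N, J k = k' &
    forall i j x y, (i <= k)%N -> (j <= k')%N -> (J i.-1 <= j <= J i.+1)%N ->
    has_site x (iter i (nx s0) h) -> has_site y (iter j (nx (sn n)) g') ->
    (m * dist1 x y <= 6 * norm1 x + K)%N]).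
  have [p' [gamma' [C' D' bd]]] := orbit_match d0 m96 dK Cp Hr Ig' dg' Jle J0 Jk close.
  exists k', p', gamma'; split=> // j /bd[i ik H]; apply: leq_trans H _.
  by apply: (@leq_bigmax _ (fun i : 'I_k.+1 => 7 * norm1 (p i).1 + K)%N (Ordinal (ik : (i < k.+1)%N))).
pose im l := `[< exists2 g, iface (sn n) g & phi s0 n g = iter l (nx s0) h >].
have unpin l : ~~ im l -> ~ pin s0 (iter l (nx s0) h).
  by move=> /asboolP ni; apply: (@nonimage_unpin _ n) => // g Ig E; apply: ni; exists g.
have [|nim] := pselect (exists l, (l <= k)%N && im l); last first.
  have HU i : (i <= k)%N -> ~ pin s0 (iter i (nx s0) h).
    by move=> ik; apply: unpin; apply/negP => ii; apply: nim; exists i; rewrite ik.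
  (* Without images the whole path is unpinned, hence short, and a pinned edge near its start
     approximates it. *)
  have [e [Ie pe he]] := dens h.1.
  exists 0%N, e, (fun=> 0%N); split; first by rewrite pin_iface.
  split; first by move=> i j /andP[ij]; rewrite leqn0 => /eqP j0; rewrite j0 in ij.
  split=> // i j x y ik; rewrite leqn0 => /eqP -> _ hx /= hy.
  have h1 := conf Ih (fun l li => HU l (leq_trans li ik)).
  have h2 := has_site_dist1 (Ii i) hx; have h3 := has_site_dist1 Ie hy.
  have := norm1_le h.1 (iter i (nx s0) h).1; rewrite dist1C => n1.
  have := norm1_le (iter i (nx s0) h).1 x => n2.
  have := dist1_tri (iter i (nx s0) h).1 x y; rewrite (dist1C x (iter i _ _).1) => t1.
  have := dist1_tri h.1 (iter i (nx s0) h).1 y => t2.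
  have := dist1_tri e.1 h.1 y => t3.
  move: he h1 h2 h3 n1 n2 t1 t2 t3 m96; rewrite /K.
  move: (dist1 x y) (dist1 (iter i _ _).1 x) (dist1 (iter i _ _).1 h.1) (dist1 (iter i _ _).1 y).
  move: (dist1 h.1 e.1) (dist1 e.1 y) (dist1 h.1 y) (norm1 h.1) (norm1 x) (norm1 (iter i _ _).1).
  clear; move=> a b v H X Z D c q w he h1 h2 h3 n1 n2 t1 t2 t3 m96.
  have mq : (96 * q <= m * q)%N by rewrite leq_mul2r m96 orbT.
  have HZ : (H <= 2 * Z + C)%N by lia.
  have : (m * D <= m * (c + (q + (a + b))))%N by rewrite leq_mul2l; lia.
  have : (m * c <= m * 2)%N by rewrite leq_mul2l h2 orbT.
  have : (m * b <= m * 2)%N by rewrite leq_mul2l h3 orbT.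
  by rewrite !mulnDr; lia.
move=> ex; case: (ex_minnP ex) => i0 /andP[i0k /asboolP[g0 Ig0 Eg0]] i0min.
have Ii' i : iface (sn n) (iter i (nx (sn n)) g0) by apply: iface_iter.
have [t [t0 tlt tE tgap]] := first_return_times (phi_first_return (s0 := s0) (n := n)) (@iface_nx (sn n)) Ig0.
have tE' a : phi s0 n (iter a (nx (sn n)) g0) = iter (i0 + t a) (nx s0) h.
  by rewrite -tE Eg0 -iterD addnC.
have tmono : {homo t : a b / (a < b)%N} by apply: homo_ltn => //; exact: ltn_trans.
(* From the first image [i0] on, [J l] is the index of the last image met up to [l]; before [i0] it
   is 0. [JP] states this. *)
pose J := fix J l := if l is l'.+1 then
  (if (l'.+1 == i0 + t (J l').+1)%N then (J l').+1 else J l') else 0%N.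
have JS l : J l.+1 = if (l.+1 == i0 + t (J l).+1)%N then (J l).+1 else J l by [].
have JP l : ((l < i0)%N -> J l = 0%N) /\ ((i0 <= l)%N -> (i0 + t (J l) <= l < i0 + t (J l).+1)%N).
  elim: l => [|l [IH1 IH2]].
    split=> // /[!leqn0] /eqP ->; rewrite t0 /= add0n.
    by have := tlt 0%N; rewrite t0.
  have ti a : (t a < t a.+1)%N by apply: tlt.
  rewrite JS; split=> li.
    rewrite IH1; last exact: ltnW.
    by rewrite ifN //; apply/eqP; have := ti 0%N; move: li; clear; lia.
  case: (leqP i0 l) => il.
    have /andP[h1 h2] := IH2 il; case: eqP => [E|ne].
      by have := ti (J l).+1; move: E; clear; lia.
    by move: h1 h2 ne; clear; lia.
  have i0l : i0 = l.+1 by move: li il; clear; lia.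
  rewrite (IH1 il); have := ti 0%N => h1; rewrite ifN; last by apply/eqP; move: h1 i0l; clear; lia.
  by rewrite t0; move: h1 i0l; clear; lia.
have Jle i : (J i <= J i.+1)%N by rewrite JS; case: ifP.
have Jle1 i : (J i.+1 <= (J i).+1)%N by rewrite JS; case: ifP.
exists (J k), g0, J; split=> //; split.
  move=> i j /andP[ij jk] E.
  have /andP[h1 _] := (JP k).2 i0k.
  have jt : (t j <= t (J k))%N.
    by move: jk; rewrite leq_eqVlt => /predU1P[->//|/tmono /ltnW].
  apply: (dh (i0 + t i)%N (i0 + t j)%N); last by rewrite -!tE' E.
  by have := tmono _ _ ij; move: h1 jt; clear; lia.
split=> // i j x y ik jk Jij hx hy.
(* Edge [i] is compared with [J i]: after [i0] they are within one gap, before [i0] the piece up to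
   [i0] is unpinned. Other indices of the window are neighbours of [J i], at the cost of one
   shift. *)
have base z : has_site z (iter (J i) (nx (sn n)) g0) ->
    (m * dist1 x z <= 6 * norm1 x + (6 * C + 100 + 12 * m))%N.
  move=> hz; case: (leqP i0 i) => ii.
    have /andP[j1 j2] := (JP i).2 ii.
    have shift l : iter l (nx s0) (phi s0 n (iter (J i) (nx (sn n)) g0)) =
        iter (l + (i0 + t (J i))) (nx s0) h by rewrite tE' -iterD.
    have [||_ H] := @close_gap n _ (i - (i0 + t (J i))) z x (Ii' (J i)) hz.
    - move=> l /andP[l0 l1]; apply: (@nonimage_unpin _ n); first by apply: iface_iter; apply: phi_iface.
      move=> g' Ig' E; apply: (tgap (J i) (l + t (J i))%N _ g' Ig').
        by move: l0 l1 j1 j2; clear; lia.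
      by rewrite E shift Eg0 -iterD; congr iter; clear; lia.
    - by rewrite shift subnK.
    - by apply: leq_trans H _; clear; lia.
  rewrite ((JP i).1 ii) /= in hz.
  have HU l : (l <= i0.-1 - i)%N -> ~ pin s0 (iter l (nx s0) (iter i (nx s0) h)).
    move=> li; rewrite -iterD; apply: unpin; apply/negP => imli.
    have : (i0 <= l + i)%N by apply: i0min; rewrite imli andbT; move: li ii i0k; clear; lia.
    by move: li ii; clear; lia.
  have h1 := conf (Ii i) HU.
  rewrite -iterD subnK in h1; last by move: ii; clear; lia.
  have h2 := nx_dist1 (Ii i0.-1); rewrite -[nx s0 _]/(iter i0.-1.+1 (nx s0) h) prednK in h2; last first.
    by apply: leq_ltn_trans ii.
  have h3 := phi_dist m4 conf Ig0 hz; rewrite Eg0 in h3.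
  have h4 := has_site_dist1 (Ii i) hx.
  have n1 := norm1_le (iter i0 (nx s0) h).1 (iter i (nx s0) h).1.
  have n2 := norm1_le (iter i (nx s0) h).1 x.
  have t1 := dist1_tri (iter i0.-1 (nx s0) h).1 (iter i0 (nx s0) h).1 (iter i (nx s0) h).1.
  have t2 := dist1_tri (iter i (nx s0) h).1 x z.
  have t3 := dist1_tri (iter i0 (nx s0) h).1 (iter i (nx s0) h).1 z.
  rewrite (dist1C (iter i0.-1 _ _).1 (iter i0 _ _).1) in h2.
  rewrite (dist1C x (iter i _ _).1) in t2; rewrite (dist1C (iter i _ _).1 (iter i0 _ _).1) in t3.
  move: h1 h2 h3 h4 n1 n2 t1 t2 t3 m96.
  move: (dist1 x z) (dist1 (iter i0 _ _).1 z) (dist1 (iter i0 _ _).1 (iter i _ _).1).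
  move: (dist1 (iter i _ _).1 z) (dist1 (iter i _ _).1 x) (dist1 (iter i0 _ _).1 (iter i0.-1 _ _).1).
  move: (dist1 (iter i0.-1 _ _).1 _) (norm1 x) (norm1 (iter i0 _ _).1) (norm1 (iter i _ _).1).
  clear; move=> a X Y Z b c d D f e h1 h2 h3 h4 n1 n2 t1 t2 t3 m96.
  have me : (m * e <= Z + C + 2 * m)%N.
    have : (m * e <= m * (2 + a))%N by rewrite leq_mul2l; lia.
    by rewrite mulnDr; lia.
  have YZ : (Y <= 2 * Z + C + 2)%N.
    have : (96 * (e - 2) <= m * (e - 2))%N by rewrite leq_mul2r m96 orbT.
    by rewrite mulnBr; lia.
  have : (m * D <= m * (c + (e + f)))%N by rewrite leq_mul2l; lia.
  have : (m * c <= m * 2)%N by rewrite leq_mul2l h4 orbT.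
  by rewrite !mulnDr; lia.
have fin A : (m * dist1 x y <= 6 * norm1 x + (6 * C + 100 + 12 * m) + A -> A <= 4 * m ->
    m * dist1 x y <= 6 * norm1 x + K)%N by rewrite /K; clear; lia.
have self e : has_site e.1 e by rewrite /has_site eqxx.
have /andP[j1 j2] := Jij.
have [ji|ji|ji] := ltngtP j (J i).
- have Eji : J i = j.+1.
    case: i ik hx base Jij j1 j2 ji => [|i] ik hx base Jij j1 j2 ji; first by [].
    by have := Jle1 i; move: j1 ji; rewrite /=; clear; lia.
  apply: (fin (4 * m)%N) => //; apply: shift_close_r (base _ (self _)) _.
  by rewrite Eji; apply: prev_site_dist (Ii' j) hy.
- have Eji : j = (J i).+1 by have := Jle1 i; move: j2 ji; clear; lia.
  apply: (fin (4 * m)%N) => //; apply: shift_close_r (base _ (self _)) _.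
  by apply: next_site_dist (Ii' (J i)) _; rewrite Eji in hy.
- by apply: (fin 0%N) => //; rewrite addn0; apply: base; rewrite -ji.
Qed.

End Comparison.

(** For [sigma_inf], every curve involved stays in a bounded box, where [sigma_inf] agrees with some
    [sigma_n]; the bounds at time [n] are uniform in [n], so they carry over. *)
Lemma confined_dist_to_zero (R : realType) (s0 : config) :
  (forall m, (0 < m)%N -> exists C, confined s0 m C /\ pins_dense s0 m C) ->
  (forall n, dist_to_zero (fun delta : R => bpath_curves delta s0)
                          (fun delta : R => bpath_curves delta (sigma_n s0 n))) /\
  dist_to_zero (fun delta : R => bpath_curves delta s0)
               (fun delta : R => bpath_curves delta (sigma_inf s0)).
Proof.
move=> Hm.
have key (eps : R) : 0 < eps -> exists m C K, [/\ (96 <= m)%N, confined s0 m C, pins_dense s0 m C,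
    K = (6 * C + 200 + 20 * m)%N & exists2 delta0 : R, 0 < delta0 &
    forall delta, 0 < delta < delta0 -> delta * (104 + 2 * K%:R) <= 1 / 4 /\ err delta m K <= eps].
  (* Makes [24 / m] at most [eps / 4]; the choice of [delta0] bounds the other term of [err] by
     [eps / 4] as well. *)
  move=> e0; pose m := (Num.trunc (96 / eps) + 96).+1%N.
  have [C [cC dC]] := Hm m isT.
  exists m, C, (6 * C + 200 + 20 * m)%N; split=> //; first by rewrite /m; lia.
  set K := (6 * C + 200 + 20 * m)%N.
  have K0 : 0 < 104 + 2 * K%:R :> R by rewrite ltr_pwDl // mulr_ge0.
  have mine : 0 < Num.min (1 / 4) (eps / 4) by rewrite lt_min !divr_gt0.
  exists (Num.min (1 / 4) (eps / 4) / (104 + 2 * K%:R)); first by rewrite divr_gt0.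
  move=> delta /andP[d0]; rewrite ltr_pdivlMr // lt_min => /andP[h1 h2]; split; first exact: ltW.
  have m0 : 0 < m%:R :> R by rewrite ltr0n.
  have me : 96 / eps < m%:R.
    have /Num.Theory.trunc_itv/andP[_ h] : 0 <= 96 / eps by rewrite divr_ge0 // ltW.
    by apply: lt_le_trans h _; rewrite ler_nat /m; lia.
  have : 24 / m%:R <= eps / 4.
    by rewrite ler_pdivrMr //; move: me; rewrite ltr_pdivrMr // => me; lra.
  by rewrite /err; lra.
split=> [n|] eps e0; have [m [C [K [m96 cC dC EK [delta0 d00 Hd]]]]] := key eps e0;
  exists delta0; split=> // delta dd; have [dK ee] := Hd delta dd;
  have d0 : 0 < delta by case/andP: dd.
- rewrite EK in dK ee; split=> gamma.
    move=> /(from_time_0 m96 cC dC d0 dK)[B /(_ n)[k' [p' [gamma' [C' D' _]]]]].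
    by exists gamma'; split; [apply/curve_ofP; exists k', p' | apply: le_trans D' ee].
  move=> /(from_time_n m96 cC d0 dK)[gamma' Bg D'].
  by exists gamma'; split=> //; apply: le_trans D' ee.
rewrite EK in dK ee.
have m4 : (4 <= m)%N by apply: leq_trans m96.
have agree r : exists n, forall x, (norm1 x <= r)%N -> sigma_inf s0 x = sigma_n s0 n x.
  have [x _|n Hn] := @eventually_all _ (fun n x => sigma_inf s0 x = sigma_n s0 n x) (box r).
    exact: sigma_inf_eventually m4 cC x.
  by exists n => x xr; apply: Hn => //; apply: mem_box.
have near (p : nat -> site * site) i r : adj (p i).1 (p i).2 -> (norm1 (p i).1 <= r)%N ->
    (norm1 (p i).2 <= r + 2)%N.
  move=> /adj_dist1; have := norm1_le (p i).2 (p i).1; rewrite dist1C; lia.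
split=> gamma.
  move=> /(from_time_0 m96 cC dC d0 dK)[B HB].
  have [n Hn] := agree (B + 2)%N.
  have [k' [p' [gamma' [C' D' bd]]]] := HB n.
  exists gamma'; split; last exact: le_trans D' ee.
  apply/curve_ofP; exists k', p'; apply: (curve_of_agree C') => i ik.
  have ap : adj (p' i).1 (p' i).2 by case: C' => v [[H _ _ _] _ _]; apply: H.
  have b1 := bd i ik; rewrite !Hn //; first exact: near ap b1.
  by apply: leq_trans b1 _; apply: leq_addr.
move=> /curve_ofP[k [p Cp]].
pose r := \max_(i < k.+1) norm1 (p i).1.
have [n Hn] := agree (r + 2)%N.
have Bp : bpath_curves delta (sigma_n s0 n) gamma.
  apply/curve_ofP; exists k, p; apply: (curve_of_agree Cp) => i ik.
  have ap : adj (p i).1 (p i).2 by case: Cp => v [[H _ _ _] _ _]; apply: H.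
  have b1 : (norm1 (p i).1 <= r)%N.
    exact: (@leq_bigmax _ (fun i : 'I_k.+1 => norm1 (p i).1) (Ordinal (ik : (i < k.+1)%N))).
  rewrite !Hn //; first exact: near ap b1.
  by apply: leq_trans b1 _; apply: leq_addr.
have [gamma' Bg D'] := from_time_n m96 cC d0 dK Bp.
by exists gamma'; split=> //; apply: le_trans D' ee.
Qed.

Theorem theorem1 (R : realType) (d : measure_display) (Omega : measurableType d)
  (P : probability Omega R) (s : site -> Omega -> bool) :
  iid_fair P s ->
  {ae P, forall w : Omega,
    (forall n : nat, (1 <= n)%N ->
       dist_to_zero (fun delta : R => bpath_curves delta (fun x => s x w))
                    (fun delta : R => bpath_curves delta (sigma_n (fun x => s x w) n))) /\
    dist_to_zero (fun delta : R => bpath_curves delta (fun x => s x w))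
                 (fun delta : R => bpath_curves delta (sigma_inf (fun x => s x w)))}.
Proof.
move=> iid.
(* One null set serves all the countably many precisions [m]. *)
have := ae_foralln (fun m => ae_confined iid (ltn0Sn m)).
apply: filterS => w H.
have [|h1 h2] := @confined_dist_to_zero R (fun x => s x w); last by split.
by case=> // m _; apply: H.
Qed.
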